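(* Let $r_1,q_1,r_2,q_2\in\mathbb{N}$ with $r_1\le q_1$, $r_2\le q_2$, and let $\tilde\Delta_2(x)=\Delta_2(x;r_1,q_1,r_2,q_2)$. Then for every non-negative integer $k$, $$\int_{1}^{\infty}\frac{\log^kx - k \log^{k-1}x}{x^2}\tilde{\Delta}_{2}(x)\, dx = \sum_{i=0}^{k}\binom{k}{i}\gamma_{k-i}(r_2,q_2)\gamma_i(r_1,q_1) + \left\lfloor \frac{1}{k+1} \right\rfloor \left( \frac{1}{q_1q_2}-\frac{\gamma_0(r_1,q_1)}{q_2} - \frac{\gamma_0(r_2,q_2)}{q_1} \right) - \frac{\gamma_{k+1}(r_2,q_2)}{q_1(k+1)}-\frac{\gamma_{k+1}(r_1,q_1)}{q_2(k+1)},$$ and for every $\alpha\in\left(\frac{131}{416},1\right)$, $$\int_{1}^{\infty}\frac{\alpha\log^kx - k \log^{k-1}x}{x^{1+\alpha}}\tilde{\Delta}_{2}(x)\, dx = \sum_{l=0}^{k}\zeta_l(\alpha,r_1,q_1)\zeta_{k-l}(\alpha,r_2,q_2) +\left\lfloor \frac{1}{k+1} \right\rfloor \left( \frac{1}{q_1q_2}-\frac{\gamma_0(r_1,q_1)}{q_2} - \frac{\gamma_0(r_2,q_2)}{q_1} \right) - \frac{1}{q_1q_2}\cdot\frac{(k+1)!}{(\alpha-1)^{k+2}} - \left( \frac{\gamma_0(r_1,q_1)}{q_2} + \frac{\gamma_0(r_2,q_2)}{q_1} \right)\frac{k!}{(\alpha-1)^{k+1}}.$$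
   Context: $\lfloor 1/(k+1)\rfloor$ is $1$ for $k=0$ and $0$ otherwise; for $k=0$ the terms $k\log^{k-1}x$ vanish. $\zeta(s;r,q)=\sum_{n\ge1,\,n\equiv r\bmod q}n^{-s}$ for $\Re s>1$, meromorphically continued. $d_*(n)$ is the number of pairs $(n_1,n_2)\in\mathbb{N}^2$ with $n=n_1n_2$, $n_1\equiv r_1 \bmod q_1$, $n_2\equiv r_2\bmod q_2$, and $$\Delta_2(x;r_1,q_1,r_2,q_2)=\sum_{n\le x}d_*(n)-\mathrm{Res}_{s=1}\Big(\zeta(s;r_1,q_1)\zeta(s;r_2,q_2)\frac{x^s}{s}\Big).$$ The generalized Euler–Lehmer constants are $\gamma_k(r,q):=\lim_{x\to\infty}\Big(\sum_{n\le x,\,n\equiv r\bmod q}\frac{\log^k n}{n}-\frac{\log^{k+1}x}{q(k+1)}\Big)$. For $\alpha\in(0,1)$: $\zeta_k(\alpha,r,q):=\lim_{x\to\infty}\Big(\sum_{1\le n\le x,\ n\equiv r \bmod q}\frac{\log^k n}{n^{\alpha}}-\frac{I_k(x,\alpha)}{q}\Big)$, with $I_k(x,\alpha)=x^{1-\alpha}\sum_{i=0}^{k}(-1)^i\frac{k!}{(k-i)!}\frac{\log^{k-i}x}{(1-\alpha)^{i+1}}$.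
   Formalization: In the second identity the sum over l carries the binomial coefficient binom(k,l), missing in print; as printed it is false, e.g. for k=2 and r1=q1=r2=q2=1, where the two sides differ by ζ'(α)^2 ≠ 0. For k=0,1 the two versions agree. *)

(* Defs.v *)
From Stdlib Require Import Reals Arith List Bool ClassicalEpsilon.
From Coquelicot Require Import Coquelicot.

Open Scope R_scope.

(** [n = r (mod q)] *)
Definition congb (n r q : nat) : bool := Nat.eqb (n mod q) (r mod q).

(** Sum of [f n] over the integers [1 <= n <= x]. *)
Definition sum_upto (x : R) (f : nat -> R) : R :=
  sum_n_m f 1 (Z.to_nat (Int_part x)).

(** Sum of [f n] over the integers [1 <= n <= x] with [n = r (mod q)]. *)
Definition sum_ap (x : R) (r q : nat) (f : nat -> R) : R :=
  sum_upto x (fun n => if congb n r q then f n else 0).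

(** [Lim] is evaluated along the integers, which is harmless here: the limits
    over real [x] exist. *)
Definition gamma (k r q : nat) : R :=
  real (Lim (fun x =>
    sum_ap x r q (fun n => ln (INR n) ^ k / INR n)
    - ln x ^ (k + 1) / (INR q * INR (k + 1))) p_infty).

Definition I_ (k : nat) (x alpha : R) : R :=
  Rpower x (1 - alpha) *
  sum_f_R0 (fun i =>
    (-1) ^ i * (INR (fact k) / INR (fact (k - i)))
    * (ln x ^ (k - i) / (1 - alpha) ^ (i + 1))) k.

Definition zeta_k (k : nat) (alpha : R) (r q : nat) : R :=
  real (Lim (fun x =>
    sum_ap x r q (fun n => ln (INR n) ^ k / Rpower (INR n) alpha)
    - I_ k x alpha / INR q) p_infty).

(** [x ^ s = exp (s * ln x)] for real [x > 0] and complex [s]. *)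
Definition cpow (x : R) (s : C) : C :=
  (exp (Re s * ln x) * cos (Im s * ln x),
   exp (Re s * ln x) * sin (Im s * ln x)).

(** On some punctured disc around [a], [f] is the sum of the Laurent series
    [sum_(n >= 0) c n * (s - a) ^ (n - m)]. *)
Definition is_laurent (f : C -> C) (a : C) (m : nat) (c : nat -> C) : Prop :=
  exists delta : posreal, forall s : C, 0 < Cmod (s - a) < delta ->
    @is_pseries C_AbsRing C_NormedModule c (s - a)%C ((s - a) ^ m * f s)%C.

Definition meromorphic_at (f : C -> C) (a : C) : Prop :=
  exists m c, is_laurent f a m c.

(** The coefficient of [(s - a) ^ (-1)]; requiring a shift [m + 1] is no
    restriction, since [c] may start with zeros. *)
Definition is_residue (f : C -> C) (a rho : C) : Prop :=
  exists m c, is_laurent f a (S m) c /\ rho = c m.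

Definition Residue (f : C -> C) (a : C) : C :=
  epsilon (inhabits (RtoC 0)) (is_residue f a).

(** [Z] is given by the Dirichlet series for [Re s > 1] and is meromorphic in
    the half-plane [Re s > 0].  By uniqueness of continuation it agrees there,
    up to its values at isolated points, with the continuation to the whole
    plane, of which only the germ at [s = 1] is used below. *)
Definition is_zeta_ap (r q : nat) (Z : C -> C) : Prop :=
  (forall s : C, 1 < Re s ->
     @is_series C_AbsRing C_NormedModule
       (fun j => if congb (S j) r q then cpow (INR (S j)) (- s)%C else RtoC 0)
       (Z s)) /\
  (forall a : C, 0 < Re a -> meromorphic_at Z a).

Definition zeta_ap (r q : nat) : C -> C :=
  epsilon (inhabits (fun _ : C => RtoC 0)) (is_zeta_ap r q).

Definition d_star (r1 q1 r2 q2 n : nat) : nat :=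
  length (filter
    (fun p => Nat.eqb (fst p * snd p) n
              && congb (fst p) r1 q1 && congb (snd p) r2 q2)
    (list_prod (seq 1 n) (seq 1 n))).

(** The residue is real, because both zeta functions are real on the real axis;
    [Re] only changes its type. *)
Definition Delta2 (x : R) (r1 q1 r2 q2 : nat) : R :=
  sum_upto x (fun n => INR (d_star r1 q1 r2 q2 n))
  - Re (Residue
          (fun s => zeta_ap r1 q1 s * zeta_ap r2 q2 s * (cpow x s / s))%C
          (RtoC 1)).

(* Main.v *)
Require Import Defs.
From Stdlib Require Import Reals Arith Lia Lra Psatz ZArith List ClassicalEpsilon.
From Coquelicot Require Import Coquelicot.

Open Scope R_scope.

(** Put [f(x) = ln x ^ k / x ^ a] with [0 < a <= 1]. The integrand is
    [- f' * Delta2], so by partial summation its integral over [[1, X]] is [sum_(n <= X) d_star(n) (f(n) - f(X))] plus an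
    explicit smooth term. Since [f(m n)] is a binomial convolution of the functions
    [ln ^ j m / m ^ a] and [ln ^ (k - j) n / n ^ a], the hyperbola method with
    [y = sqrt X] reduces this sum to sums over arithmetic progressions, which
    second order Euler-Maclaurin evaluates up to [O(y ^ (- 1 - b))], [0 < b < a].
    In each product of two such evaluations the sawtooth terms cancel exactly, so
    no bound for [Delta2] itself is needed: the integral converges for every
    [a > 0], and the constants [gamma] and [zeta_k] are what remains.

    For the residue, first order Euler-Maclaurin is applied to every Taylor
    coefficient in [s] of [(s - 1) t ^ (- s)]. This continues
    [(s - 1) zeta (s; r, q)] to [Re s > 0] and gives its first two coefficients
    [1 / q] and [gamma 0 r q] at [s = 1]. *)

(** * Sums over an arithmetic progression *)

Definition fl (x : R) : nat := Z.to_nat (Int_part x).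

Lemma fl_bounds (x : R) : 0 <= x -> INR (fl x) <= x < INR (fl x) + 1.
Proof.
  intros Hx. unfold fl. destruct (base_Int_part x) as [H1 H2].
  assert (H : (0 <= Int_part x)%Z).
  { assert (-1 < Int_part x)%Z by (apply lt_IZR; lra). lia. }
  rewrite INR_IZR_INZ, Z2Nat.id by exact H. lra.
Qed.

Lemma fl_unique (x : R) (n : nat) : INR n <= x < INR n + 1 -> fl x = n.
Proof.
  intros [H1 H2]. unfold fl.
  rewrite <- (Int_part_spec x (Z.of_nat n)); [apply Nat2Z.id|].
  rewrite <- INR_IZR_INZ. lra.
Qed.

Lemma fl_INR (n : nat) : fl (INR n) = n.
Proof. apply fl_unique. lra. Qed.

Lemma fl_ge (x : R) (n : nat) : 0 <= x -> INR n <= x -> (n <= fl x)%nat.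
Proof.
  intros H0 H. destruct (fl_bounds x H0) as [_ H2].
  assert (INR n < INR (S (fl x))) by (rewrite S_INR; lra).
  apply INR_lt in H1. lia.
Qed.

Lemma fl_le_mono (x y : R) : 0 <= x <= y -> (fl x <= fl y)%nat.
Proof.
  intros H. apply fl_ge; [lra|]. destruct (fl_bounds x); lra.
Qed.

Lemma le_fl_iff (x : R) (n : nat) : 0 <= x -> (n <= fl x)%nat <-> INR n <= x.
Proof.
  intros H. split; intros H1; [|now apply fl_ge].
  apply le_INR in H1. destruct (fl_bounds x H); lra.
Qed.

(** [psum f n] is the sum of [f i] over [1 <= i <= n]. *)
Fixpoint psum (f : nat -> R) (n : nat) : R :=
  match n with O => 0 | S m => psum f m + f (S m) end.

Lemma sum_upto_psum (x : R) (f : nat -> R) : sum_upto x f = psum f (fl x).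
Proof.
  unfold sum_upto. fold (fl x). induction (fl x) as [|n IH].
  - rewrite sum_n_m_zero by lia. reflexivity.
  - rewrite sum_n_Sm by lia. rewrite IH. reflexivity.
Qed.

Lemma psum_ext (f g : nat -> R) (n : nat) :
  (forall i, (1 <= i <= n)%nat -> f i = g i) -> psum f n = psum g n.
Proof.
  induction n as [|n IH]; intros H; simpl; [reflexivity|].
  rewrite IH, (H (S n)) by (intros; try apply H; lia). reflexivity.
Qed.

Lemma psum_plus (f g : nat -> R) (n : nat) :
  psum (fun i => f i + g i) n = psum f n + psum g n.
Proof. induction n as [|n IH]; simpl; [ring|rewrite IH; ring]. Qed.

Lemma psum_scal (c : R) (f : nat -> R) (n : nat) :
  psum (fun i => c * f i) n = c * psum f n.
Proof. induction n as [|n IH]; simpl; [ring|rewrite IH; ring]. Qed.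

Lemma psum_le (f g : nat -> R) (n : nat) :
  (forall i, (1 <= i <= n)%nat -> f i <= g i) -> psum f n <= psum g n.
Proof.
  induction n as [|n IH]; intros H; simpl; [lra|].
  apply Rplus_le_compat; [apply IH; intros|]; apply H; lia.
Qed.

Lemma psum_abs (f : nat -> R) (n : nat) :
  Rabs (psum f n) <= psum (fun i => Rabs (f i)) n.
Proof.
  induction n as [|n IH]; simpl; [rewrite Rabs_R0; lra|].
  eapply Rle_trans; [apply Rabs_triang|]. lra.
Qed.

Lemma psum_const (c : R) (n : nat) : psum (fun _ => c) n = INR n * c.
Proof. induction n as [|n IH]; [simpl; ring|]. cbn [psum]. rewrite IH, S_INR. ring. Qed.

Lemma psum_swap (f : nat -> nat -> R) (n m : nat) :
  psum (fun i => psum (fun j => f i j) m) n = psum (fun j => psum (fun i => f i j) n) m.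
Proof.
  induction n as [|n IH]; simpl.
  - induction m as [|m IHm]; simpl; [reflexivity|]. rewrite <- IHm. ring.
  - rewrite IH, <- psum_plus. reflexivity.
Qed.

Lemma psum_trunc (f : nat -> R) (m n : nat) : (m <= n)%nat ->
  psum (fun i => if (i <=? m)%nat then f i else 0) n = psum f m.
Proof.
  intros H. induction n as [|n IH].
  - replace m with 0%nat by lia. reflexivity.
  - destruct (Nat.eq_dec m (S n)) as [->|Hn].
    + apply psum_ext. intros i Hi.
      replace (i <=? S n)%nat with true by (symmetry; apply Nat.leb_le; lia).
      reflexivity.
    + cbn [psum]. rewrite IH by lia.
      replace (S n <=? m)%nat with false by (symmetry; apply Nat.leb_gt; lia). ring.
Qed.

Definition chi (r q n : nat) : R := if congb n r q then 1 else 0.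

Definition apsum (r q : nat) (f : nat -> R) : nat -> R :=
  psum (fun i => chi r q i * f i).

Lemma sum_ap_apsum (x : R) (r q : nat) (f : nat -> R) :
  sum_ap x r q f = apsum r q f (fl x).
Proof.
  unfold sum_ap, apsum. rewrite sum_upto_psum. apply psum_ext.
  intros i _. unfold chi. destruct (congb i r q); ring.
Qed.

Lemma chi_01 (r q n : nat) : chi r q n = 0 \/ chi r q n = 1.
Proof. unfold chi. destruct (congb n r q); auto. Qed.

Lemma chi_bounds (r q n : nat) : 0 <= chi r q n <= 1.
Proof. destruct (chi_01 r q n) as [-> | ->]; lra. Qed.

Definition cnt (r q : nat) : nat -> R := psum (chi r q).

Lemma congb_succ (r q n : nat) : (1 <= r <= q)%nat ->
  congb (S n) r q = ((n + q - r) mod q =? q - 1)%nat.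
Proof.
  intros H. unfold congb.
  assert (Hq : q <> 0%nat) by lia.
  assert (E : ((n + q - r) mod q + (r + 1)) mod q = (S n + 1 + q - 1) mod q).
  { rewrite Nat.Div0.add_mod_idemp_l. f_equal. lia. }
  pose proof (Nat.mod_upper_bound (n + q - r) q Hq) as Hb.
  set (p := ((n + q - r) mod q)%nat) in *.
  replace (S n + 1 + q - 1)%nat with (S n + 1 * q)%nat in E by lia.
  rewrite Nat.Div0.mod_add in E. rewrite <- E.
  destruct (Nat.eqb_spec p (q - 1)) as [Hp|Hp].
  - replace (p + (r + 1))%nat with (r + 1 * q)%nat by lia.
    rewrite Nat.Div0.mod_add. apply Nat.eqb_refl.
  - apply Nat.eqb_neq. intros F.
    destruct (Nat.eq_dec r q) as [->|Hr].
    + rewrite Nat.Div0.mod_same in F.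
      replace (p + (q + 1))%nat with (p + 1 + 1 * q)%nat in F by lia.
      rewrite Nat.Div0.mod_add, Nat.mod_small in F by lia. lia.
    + rewrite (Nat.mod_small r) in F by lia.
      destruct (le_lt_dec q (p + (r + 1))) as [L|L].
      * replace (p + (r + 1))%nat with (p + (r + 1) - q + 1 * q)%nat in F by lia.
        rewrite Nat.Div0.mod_add, Nat.mod_small in F by lia. lia.
      * rewrite Nat.mod_small in F by lia. lia.
Qed.

Lemma cnt_div (r q n : nat) : (1 <= r <= q)%nat -> cnt r q n = INR ((n + q - r) / q).
Proof.
  intros H. assert (Hq : q <> 0%nat) by lia.
  induction n as [|n IH].
  - rewrite Nat.div_small by lia. reflexivity.
  - change (cnt r q (S n)) with (cnt r q n + chi r q (S n)).
    rewrite IH. unfold chi. rewrite congb_succ by exact H.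
    pose proof (Nat.div_mod (n + q - r) q Hq) as E.
    pose proof (Nat.mod_upper_bound (n + q - r) q Hq) as Hb.
    set (p := ((n + q - r) mod q)%nat) in *. set (d := ((n + q - r) / q)%nat) in *.
    destruct (Nat.eqb_spec p (q - 1)) as [Hp|Hp].
    + rewrite <- S_INR. f_equal. apply (Nat.div_unique _ _ _ 0); lia.
    + rewrite Rplus_0_r. f_equal. apply (Nat.div_unique _ _ _ (p + 1)); lia.
Qed.

Definition mean (r q : nat) : R := 1 / 2 - INR r / INR q.

(** The sawtooth [1/2 - {(t - r)/q}], when [n] is the integer part of [t]. *)
Definition saw (r q n : nat) (t : R) : R := cnt r q n - t / INR q - mean r q.

Lemma saw_bound (r q n : nat) (t : R) : (1 <= r <= q)%nat ->
  INR n <= t <= INR n + 1 -> Rabs (saw r q n t) <= 1 / 2.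
Proof.
  intros H Ht. unfold saw, mean. rewrite cnt_div by exact H.
  assert (Hq : q <> 0%nat) by lia.
  pose proof (Nat.div_mod (n + q - r) q Hq) as E.
  pose proof (Nat.mod_upper_bound (n + q - r) q Hq) as Hb.
  set (p := ((n + q - r) mod q)%nat) in *. set (d := ((n + q - r) / q)%nat) in *.
  assert (E' : (n + q = q * d + p + r)%nat) by lia.
  apply (f_equal INR) in E'. rewrite !plus_INR, mult_INR in E'.
  assert (Hp : INR p + 1 <= INR q) by (rewrite <- S_INR; apply le_INR; lia).
  pose proof (pos_INR p).
  replace (INR d - t / INR q - (1 / 2 - INR r / INR q))
    with (1 / 2 - (INR p + (t - INR n)) / INR q).
  2:{ replace (INR r) with (INR n + INR q - INR q * INR d - INR p) by lra. field. lra. }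
  assert (0 <= (INR p + (t - INR n)) / INR q <= 1).
  { split; [apply Rdiv_le_0_compat; lra|]. apply (Rdiv_le_1 _ (INR q)); lra. }
  apply Rabs_le. lra.
Qed.

Lemma saw_jump (r q n : nat) : (1 <= r <= q)%nat -> chi r q (S n) = 1 ->
  saw r q n (INR (S n)) = - (1 / 2).
Proof.
  intros H Hc. unfold saw, mean. rewrite cnt_div by exact H.
  unfold chi in Hc. rewrite congb_succ in Hc by exact H.
  assert (Hq : q <> 0%nat) by lia.
  pose proof (Nat.div_mod (n + q - r) q Hq) as E.
  destruct (Nat.eqb_spec ((n + q - r) mod q) (q - 1)) as [Hp|Hp]; [|lra].
  rewrite Hp in E. set (d := ((n + q - r) / q)%nat) in *.
  assert (E' : (S n = q * d + r)%nat) by lia.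
  rewrite E', plus_INR, mult_INR. field. apply not_0_INR. lia.
Qed.

Lemma saw_step (r q n : nat) (t : R) : saw r q (S n) t = saw r q n t + chi r q (S n).
Proof. unfold saw, cnt. cbn [psum]. ring. Qed.

Lemma mean_bound (r q : nat) : (1 <= r <= q)%nat -> Rabs (mean r q) <= 1 / 2.
Proof.
  intros H. unfold mean.
  assert (1 <= INR r <= INR q).
  { split; [change 1 with (INR 1)|]; apply le_INR; lia. }
  assert (0 <= INR r / INR q <= 1).
  { split; [apply Rdiv_le_0_compat; lra|]. apply (Rdiv_le_1 _ (INR q)); lra. }
  apply Rabs_le. lra.
Qed.

Lemma Rpower_pos (x y : R) : 0 < Rpower x y.
Proof. apply exp_pos. Qed.

Lemma Rpower_1_l (y : R) : Rpower 1 y = 1.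
Proof. unfold Rpower. rewrite ln_1, Rmult_0_r, exp_0. reflexivity. Qed.

Lemma is_derive_Rpower (a t : R) : 0 < t ->
  is_derive (fun x => Rpower x a) t (a * Rpower t (a - 1)).
Proof. intros H. apply is_derive_Reals. now apply derivable_pt_lim_power. Qed.

Lemma abs_mvt (f df h dh : R -> R) (a b : R) : a <= b ->
  (forall t, a <= t <= b -> is_derive f t (df t)) ->
  (forall t, a <= t <= b -> is_derive h t (dh t)) ->
  (forall t, a <= t <= b -> Rabs (df t) <= dh t) ->
  Rabs (f b - f a) <= h b - h a.
Proof.
  intros Hab Hf Hh H.
  assert (Hc : forall (g dg : R -> R), (forall t, a <= t <= b -> is_derive g t (dg t)) ->
    (forall t, a <= t <= b -> 0 <= dg t) -> 0 <= g b - g a).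
  { intros g dg Hg Hp.
    destruct (MVT_gen g a b dg) as [c [Hc E]].
    - intros x Hx. rewrite Rmin_left, Rmax_right in Hx by lra. apply Hg; lra.
    - intros x Hx. rewrite Rmin_left, Rmax_right in Hx by lra.
      apply derivable_continuous_pt. exists (dg x). apply is_derive_Reals, Hg; lra.
    - rewrite Rmin_left, Rmax_right in Hc by lra. rewrite E.
      apply Rmult_le_pos; [apply Hp|]; lra. }
  assert (H1 : 0 <= (h b - f b) - (h a - f a)).
  { apply (Hc (fun t => h t - f t) (fun t => dh t - df t)).
    - intros t Ht. apply (is_derive_minus h f); auto.
    - intros t Ht. specialize (H t Ht). apply Rabs_le_between in H. lra. }
  assert (H2 : 0 <= (h b + f b) - (h a + f a)).
  { apply (Hc (fun t => h t + f t) (fun t => dh t + df t)).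
    - intros t Ht. apply (is_derive_plus h f); auto.
    - intros t Ht. specialize (H t Ht). apply Rabs_le_between in H. lra. }
  apply Rabs_le. lra.
Qed.

(** [F n] is the branch on [[n, n + 1]] of one continuous function. *)
Lemma piecewise_limit (F dF : nat -> R -> R) (K eta : R) : 0 < eta -> 0 <= K ->
  (forall n t, (1 <= n)%nat -> INR n <= t <= INR n + 1 ->
     is_derive (F n) t (dF n t) /\ Rabs (dF n t) <= K * Rpower t (- eta - 1)) ->
  (forall n, (1 <= n)%nat -> F n (INR (S n)) = F (S n) (INR (S n))) ->
  exists c, forall y, 1 <= y -> Rabs (F (fl y) y - c) <= K / eta * Rpower y (- eta).
Proof.
  intros He HK HF Hj.
  set (H := fun y => K / eta * Rpower y (- eta)).
  assert (Hpos : forall y, 0 <= H y).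
  { intros y. apply Rmult_le_pos; [apply Rdiv_le_0_compat; lra|]. left; apply Rpower_pos. }
  assert (loc : forall n s t, (1 <= n)%nat -> INR n <= s -> s <= t -> t <= INR n + 1 ->
    Rabs (F n t - F n s) <= H s - H t).
  { intros n s t Hn Hs Hst Ht.
    assert (1 <= INR n) by (change 1 with (INR 1); now apply le_INR).
    replace (H s - H t) with ((fun x => - H x) t - (fun x => - H x) s) by (simpl; ring).
    apply (abs_mvt (F n) (dF n) (fun x => - H x) (fun t => K * Rpower t (- eta - 1))); [lra| | |].
    - intros x Hx. apply HF; [exact Hn|lra].
    - intros x Hx. unfold H.
      evar_last.
      { apply @is_derive_opp. apply is_derive_scal. apply is_derive_Rpower. lra. }
      unfold opp; simpl. field. lra.
    - intros x Hx. apply HF; [exact Hn|lra]. }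
  assert (nat_step : forall n k, (1 <= n)%nat ->
    Rabs (F (n + k)%nat (INR (n + k)) - F n (INR n)) <= H (INR n) - H (INR (n + k))).
  { intros n k Hn. induction k as [|k IH].
    - rewrite Nat.add_0_r, Rminus_diag, Rabs_R0. lra.
    - rewrite Nat.add_succ_r. rewrite <- Hj by lia.
      assert (L := loc (n + k)%nat (INR (n + k)) (INR (S (n + k)))).
      rewrite S_INR in *.
      specialize (L ltac:(lia) ltac:(lra) ltac:(lra) ltac:(lra)).
      replace (F (n + k)%nat (INR (n + k) + 1) - F n (INR n)) with
        ((F (n + k)%nat (INR (n + k) + 1) - F (n + k)%nat (INR (n + k)))
         + (F (n + k)%nat (INR (n + k)) - F n (INR n))) by ring.
      eapply Rle_trans; [apply Rabs_triang|]. lra. }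
  assert (glob : forall y z, 1 <= y -> y <= z ->
    Rabs (F (fl z) z - F (fl y) y) <= H y - H z).
  { intros y z Hy Hyz.
    destruct (fl_bounds y) as [a1 a2]; [lra|]. destruct (fl_bounds z) as [b1 b2]; [lra|].
    assert (Hf1 : (1 <= fl y)%nat) by (apply fl_ge; simpl; lra).
    assert (Hf : (fl y <= fl z)%nat) by (apply fl_le_mono; lra).
    destruct (Nat.eq_dec (fl y) (fl z)) as [E|E].
    - rewrite E in *. apply loc; [lia|lra|lra|lra].
    - assert (L1 := loc (fl y) y (INR (S (fl y)))). rewrite (S_INR (fl y)) in L1.
      specialize (L1 Hf1 ltac:(lra) ltac:(lra) ltac:(lra)).
      assert (L2 := loc (fl z) (INR (fl z)) z ltac:(lia) ltac:(lra) ltac:(lra) ltac:(lra)).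
      assert (L3 := nat_step (S (fl y)) (fl z - S (fl y))%nat ltac:(lia)).
      replace (S (fl y) + (fl z - S (fl y)))%nat with (fl z) in L3 by lia.
      rewrite <- Hj in L3 by lia. rewrite S_INR in L3.
      replace (F (fl z) z - F (fl y) y) with
        ((F (fl z) z - F (fl z) (INR (fl z)))
         + ((F (fl z) (INR (fl z)) - F (fl y) (INR (fl y) + 1))
         + (F (fl y) (INR (fl y) + 1) - F (fl y) y))) by ring.
      eapply Rle_trans; [apply Rabs_triang|].
      eapply Rle_trans; [apply Rplus_le_compat_l, Rabs_triang|]. lra. }
  destruct (completeness (fun v => exists y, 1 <= y /\ v = F (fl y) y - H y)) as [c [Hub Hlub]].
  - exists (F (fl 1) 1 + H 1). intros v [y [Hy ->]].
    assert (G := glob 1 y ltac:(lra) Hy). apply Rabs_le_between in G.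
    generalize (Hpos y). lra.
  - exists (F (fl 1) 1 - H 1), 1. split; [lra|reflexivity].
  - exists c. intros y Hy. fold (H y).
    assert (F (fl y) y - H y <= c) by (apply Hub; exists y; auto).
    assert (c <= F (fl y) y + H y).
    { apply Hlub. intros v [z [Hz ->]].
      destruct (Rle_dec y z) as [L|L].
      - assert (G := glob y z Hy L). apply Rabs_le_between in G. generalize (Hpos z). lra.
      - assert (G := glob z y Hz ltac:(lra)). apply Rabs_le_between in G.
        generalize (Hpos y). lra. }
    apply Rabs_le. lra.
Qed.

Lemma em_first_order (r q : nat) (g g1 P : R -> R) (K eta : R) :
  (1 <= r <= q)%nat -> 0 < eta -> 0 <= K ->
  (forall t, 1 <= t -> is_derive P t (g t)) ->
  (forall t, 1 <= t -> is_derive g t (g1 t)) ->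
  (forall t, 1 <= t -> Rabs (g1 t) <= K * Rpower t (- eta - 1)) ->
  exists c, forall y, 1 <= y ->
    Rabs (apsum r q (fun n => g (INR n)) (fl y) - P y / INR q
          - g y * (cnt r q (fl y) - y / INR q) - c) <= K / eta * Rpower y (- eta).
Proof.
  intros H He HK HP Hg Hb.
  assert (Hq : INR q <> 0) by (apply not_0_INR; lia).
  apply (piecewise_limit
    (fun n t => apsum r q (fun n => g (INR n)) n - P t / INR q - g t * (cnt r q n - t / INR q))
    (fun n t => - (g1 t * (cnt r q n - t / INR q)))); [exact He|exact HK| |].
  - intros n t Hn Ht.
    assert (1 <= INR n) by (change 1 with (INR 1); now apply le_INR).
    assert (1 <= t) by lra. split.
    + auto_derive.
      * repeat split; [exists (g t); now apply HP|exists (g1 t); now apply Hg].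
      * rewrite (is_derive_unique (fun x : R => P x) _ _ (HP t H1)),
          (is_derive_unique (fun x : R => g x) _ _ (Hg t H1)). field. exact Hq.
    + rewrite Rabs_Ropp, Rabs_mult, <- (Rmult_1_r (K * _)).
      apply Rmult_le_compat; try apply Rabs_pos; [now apply Hb|].
      replace (cnt r q n - t / INR q) with (saw r q n t + mean r q) by (unfold saw; ring).
      eapply Rle_trans; [apply Rabs_triang|].
      generalize (saw_bound r q n t H Ht) (mean_bound r q H). lra.
  - intros n Hn. unfold apsum, cnt. cbn [psum]. ring.
Qed.

(** The extra term [q / 2 * g' * saw ^ 2] is continuous at the jumps of [saw],
    and its derivative removes the term of order [g'] left by [em_first_order]. *)
Lemma em_second_order (r q : nat) (g g1 g2 P : R -> R) (K eta : R) :
  (1 <= r <= q)%nat -> 0 < eta -> 0 <= K ->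
  (forall t, 1 <= t -> is_derive P t (g t)) ->
  (forall t, 1 <= t -> is_derive g t (g1 t)) ->
  (forall t, 1 <= t -> is_derive g1 t (g2 t)) ->
  (forall t, 1 <= t -> Rabs (g1 t) <= K * Rpower t (- eta)) ->
  (forall t, 1 <= t -> Rabs (g2 t) <= K * Rpower t (- eta - 1)) ->
  exists c K', 0 <= K' /\ forall y, 1 <= y ->
    Rabs (apsum r q (fun n => g (INR n)) (fl y) - P y / INR q
          - g y * saw r q (fl y) y - c) <= K' * Rpower y (- eta).
Proof.
  intros H He HK HP Hg Hg1 Hb1 Hb2.
  assert (Hq : 0 < INR q) by (apply lt_0_INR; lia).
  assert (sq : forall n t, INR n <= t <= INR n + 1 -> 0 <= (saw r q n t) ^ 2 <= 1).
  { intros n t Ht. generalize (saw_bound r q n t H Ht). intros B.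
    apply Rabs_le_between in B. nra. }
  destruct (piecewise_limit
    (fun n t => apsum r q (fun n => g (INR n)) n - P t / INR q - g t * saw r q n t
                - INR q / 2 * g1 t * (saw r q n t) ^ 2)
    (fun n t => - (INR q / 2 * g2 t * (saw r q n t) ^ 2)) (INR q / 2 * K) eta)
    as [c Hc]; [exact He|nra| | |].
  - intros n t Hn Ht.
    assert (1 <= INR n) by (change 1 with (INR 1); now apply le_INR).
    assert (1 <= t) by lra. split.
    + unfold saw. auto_derive.
      * repeat split; [exists (g t); now apply HP|exists (g1 t); now apply Hg
          |exists (g2 t); now apply Hg1].
      * rewrite (is_derive_unique (fun x : R => P x) _ _ (HP t H1)),
          (is_derive_unique (fun x : R => g x) _ _ (Hg t H1)),
          (is_derive_unique (fun x : R => g1 x) _ _ (Hg1 t H1)). field. lra.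
    + rewrite Rabs_Ropp, !Rabs_mult, (Rabs_right (INR q / 2)) by lra.
      specialize (sq n t Ht). specialize (Hb2 t H1).
      rewrite (Rabs_right (saw r q n t ^ 2)) by lra.
      rewrite (Rmult_assoc _ K), <- (Rmult_1_r (INR q / 2 * (K * _))).
      generalize (Rabs_pos (g2 t)). intros.
      apply Rmult_le_compat; [nra|lra| |lra].
      apply Rmult_le_compat_l; lra.
  - intros n Hn. rewrite saw_step. unfold apsum. cbn [psum].
    destruct (chi_01 r q (S n)) as [E|E].
    + rewrite E. ring.
    + rewrite (saw_jump r q n H E), E. lra.
  - exists c, (INR q / 2 * K / eta + INR q / 2 * K). split.
    { apply Rplus_le_le_0_compat; [apply Rdiv_le_0_compat|]; nra. }
    intros y Hy. specialize (Hc y Hy).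
    replace (apsum r q (fun n => g (INR n)) (fl y) - P y / INR q
          - g y * saw r q (fl y) y - c) with
      ((apsum r q (fun n => g (INR n)) (fl y) - P y / INR q - g y * saw r q (fl y) y
                - INR q / 2 * g1 y * (saw r q (fl y) y) ^ 2 - c)
       + INR q / 2 * g1 y * (saw r q (fl y) y) ^ 2) by ring.
    eapply Rle_trans; [apply Rabs_triang|]. rewrite Rmult_plus_distr_r.
    apply Rplus_le_compat; [exact Hc|].
    rewrite !Rabs_mult, (Rabs_right (INR q / 2)) by lra.
    destruct (fl_bounds y) as [a1 a2]; [lra|].
    specialize (sq (fl y) y ltac:(lra)). specialize (Hb1 y Hy).
    rewrite (Rabs_right (_ ^ 2)) by lra.
    rewrite (Rmult_assoc _ K), <- (Rmult_1_r (INR q / 2 * (K * _))).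
    generalize (Rabs_pos (g1 y)). intros.
    apply Rmult_le_compat; [nra|lra| |lra].
    apply Rmult_le_compat_l; lra.
Qed.

(** * The hyperbola method *)

Definition lsum {T : Type} (f : T -> R) (l : list T) : R :=
  fold_right (fun a acc => f a + acc) 0 l.

Lemma lsum_app {T : Type} (f : T -> R) (l l' : list T) :
  lsum f (l ++ l') = lsum f l + lsum f l'.
Proof. induction l as [|a l IH]; simpl; [ring|rewrite IH; ring]. Qed.

Lemma lsum_seq (f : nat -> R) (n : nat) : lsum f (seq 1 n) = psum f n.
Proof.
  induction n as [|n IH]; [reflexivity|].
  rewrite seq_S, lsum_app, IH. simpl. ring.
Qed.

Lemma length_filter_lsum {T : Type} (p : T -> bool) (l : list T) :
  INR (length (filter p l)) = lsum (fun a => if p a then 1 else 0) l.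
Proof.
  induction l as [|a l IH]; [reflexivity|].
  simpl filter. simpl lsum. rewrite <- IH. destruct (p a).
  - change (length (a :: filter p l)) with (S (length (filter p l))). rewrite S_INR. ring.
  - ring.
Qed.

Lemma lsum_list_prod {T U : Type} (f : T * U -> R) (l : list T) (l' : list U) :
  lsum f (list_prod l l') = lsum (fun a => lsum (fun b => f (a, b)) l') l.
Proof.
  induction l as [|a l IH]; [reflexivity|].
  simpl list_prod. rewrite lsum_app, IH. simpl. apply (f_equal (fun z => z + _)).
  clear. induction l' as [|b l' IH]; [reflexivity|]. simpl. apply f_equal. exact IH.
Qed.

Lemma d_star_psum (r1 q1 r2 q2 n m : nat) : (1 <= n <= m)%nat ->
  INR (d_star r1 q1 r2 q2 n) =
  psum (fun a => psum (fun b =>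
    chi r1 q1 a * chi r2 q2 b * (if (a * b =? n)%nat then 1 else 0)) m) m.
Proof.
  intros H. unfold d_star. rewrite length_filter_lsum, lsum_list_prod, lsum_seq.
  set (h := fun a b => chi r1 q1 a * chi r2 q2 b * (if (a * b =? n)%nat then 1 else 0)).
  rewrite <- (psum_trunc _ n m) by lia.
  apply psum_ext. intros a Ha. destruct (Nat.leb_spec a n) as [L|L].
  - rewrite lsum_seq, <- (psum_trunc _ n m) by lia.
    apply psum_ext. intros b Hb. unfold h, chi. destruct (Nat.leb_spec b n) as [L'|L'].
    + simpl fst; simpl snd. destruct (a * b =? n)%nat, (congb a r1 q1), (congb b r2 q2);
        simpl; ring.
    + replace (a * b =? n)%nat with false by (symmetry; apply Nat.eqb_neq; nia). ring.
  - transitivity (psum (fun _ => 0) m); [rewrite psum_const; ring|].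
    apply psum_ext. intros b Hb. unfold h.
    replace (a * b =? n)%nat with false by (symmetry; apply Nat.eqb_neq; nia). ring.
Qed.

Lemma psum_delta (f : nat -> R) (m n : nat) : (1 <= m)%nat ->
  psum (fun i => if (m =? i)%nat then f i else 0) n = if (m <=? n)%nat then f m else 0.
Proof.
  intros Hm. induction n as [|n IH].
  - replace (m <=? 0)%nat with false by (symmetry; apply Nat.leb_gt; lia). reflexivity.
  - cbn [psum]. rewrite IH.
    destruct (Nat.leb_spec m n), (Nat.leb_spec m (S n)), (Nat.eqb_spec m (S n));
      subst; try lia; ring.
Qed.

Lemma psum_d_star (r1 q1 r2 q2 N : nat) (phi : nat -> R) :
  psum (fun n => INR (d_star r1 q1 r2 q2 n) * phi n) N =
  psum (fun a => psum (fun b =>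
    chi r1 q1 a * chi r2 q2 b * (if (a * b <=? N)%nat then phi (a * b)%nat else 0)) N) N.
Proof.
  transitivity (psum (fun n => psum (fun a => psum (fun b =>
    chi r1 q1 a * chi r2 q2 b * (if (a * b =? n)%nat then phi n else 0)) N) N) N).
  - apply psum_ext. intros n Hn. rewrite (d_star_psum r1 q1 r2 q2 n N) by exact Hn.
    rewrite Rmult_comm, <- psum_scal. apply psum_ext. intros a _.
    rewrite <- psum_scal. apply psum_ext. intros b _. destruct (a * b =? n)%nat; ring.
  - rewrite psum_swap. apply psum_ext. intros a Ha.
    rewrite psum_swap. apply psum_ext. intros b Hb.
    rewrite psum_scal, psum_delta by nia. reflexivity.
Qed.

Lemma hyperbola (r1 q1 r2 q2 : nat) (y : R) (phi : nat -> R) : 1 <= y ->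
  psum (fun n => INR (d_star r1 q1 r2 q2 n) * phi n) (fl (y * y)) =
  apsum r1 q1 (fun a => apsum r2 q2 (fun b => phi (a * b)%nat) (fl (y * y / INR a))) (fl y)
  + apsum r2 q2 (fun b => apsum r1 q1 (fun a => phi (a * b)%nat) (fl (y * y / INR b))) (fl y)
  - apsum r1 q1 (fun a => apsum r2 q2 (fun b => phi (a * b)%nat) (fl y)) (fl y).
Proof.
  intros Hy. rewrite psum_d_star. set (N := fl (y * y)).
  assert (Hyy : y <= y * y) by nra.
  assert (HyN : (fl y <= N)%nat) by (apply fl_le_mono; lra).
  assert (posN : forall a, (1 <= a)%nat -> 1 <= INR a).
  { intros a Ha. change 1 with (INR 1). now apply le_INR. }
  assert (key : forall a b, (1 <= a)%nat -> (1 <= b)%nat ->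
    (b <=? fl (y * y / INR a))%nat = (a * b <=? N)%nat).
  { intros a b Ha Hb. specialize (posN a Ha).
    assert (P0 : 0 <= y * y / INR a) by (apply Rdiv_le_0_compat; nra).
    apply Bool.eq_iff_eq_true. rewrite !Nat.leb_le. unfold N.
    rewrite (le_fl_iff _ b P0), (le_fl_iff _ (a * b)) by nra.
    rewrite mult_INR. split; intros L.
    - apply (Rmult_le_compat_l (INR a)) in L; [|lra].
      replace (INR a * (y * y / INR a)) with (y * y) in L by (field; lra). exact L.
    - apply (Rmult_le_reg_l (INR a)); [lra|].
      replace (INR a * (y * y / INR a)) with (y * y) by (field; lra). exact L. }
  assert (small : forall a, (1 <= a)%nat -> (fl (y * y / INR a) <= N)%nat).
  { intros a Ha. specialize (posN a Ha). apply fl_le_mono. split.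
    - apply Rdiv_le_0_compat; nra.
    - apply (Rmult_le_reg_r (INR a)); [lra|].
      replace (y * y / INR a * INR a) with (y * y) by (field; lra). nra. }
  assert (ext : forall (f : nat -> nat -> R) (c : nat -> nat) s q t p,
    (forall a, (1 <= a)%nat -> (c a <= N)%nat) ->
    apsum s q (fun a => apsum t p (f a) (c a)) (fl y) =
    psum (fun a => psum (fun b => chi s q a * chi t p b *
      (if ((a <=? fl y) && (b <=? c a))%nat%bool then f a b else 0)) N) N).
  { intros f c s q t p Hc. unfold apsum. rewrite <- (psum_trunc _ (fl y) N) by exact HyN.
    apply psum_ext. intros a Ha. destruct (a <=? fl y)%nat; simpl andb.
    - rewrite <- (psum_trunc _ (c a) N) by (apply Hc; lia).
      rewrite <- psum_scal. apply psum_ext. intros b _.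
      destruct (b <=? c a)%nat; ring.
    - transitivity (psum (fun _ => 0) N); [rewrite psum_const; ring|].
      apply psum_ext. intros b _. ring. }
  rewrite (ext (fun a b => phi (a * b)%nat) (fun a => fl (y * y / INR a))) by exact small.
  rewrite (ext (fun b a => phi (a * b)%nat) (fun a => fl (y * y / INR a))) by exact small.
  rewrite (ext (fun a b => phi (a * b)%nat) (fun a => fl y)) by auto.
  rewrite (psum_swap (fun a b => chi r2 q2 a * _ * _)).
  unfold Rminus. rewrite <- psum_plus.
  replace (- psum (fun a => psum (fun b => chi r1 q1 a * chi r2 q2 b *
      (if ((a <=? fl y) && (b <=? fl y))%nat%bool then phi (a * b)%nat else 0)) N) N)
    with (psum (fun a => -1 * psum (fun b => chi r1 q1 a * chi r2 q2 b *
      (if ((a <=? fl y) && (b <=? fl y))%nat%bool then phi (a * b)%nat else 0)) N) N)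
    by (rewrite psum_scal; ring).
  rewrite <- psum_plus. apply psum_ext. intros a Ha.
  rewrite <- psum_scal, <- !psum_plus. apply psum_ext. intros b Hb.
  rewrite (key a b), (key b a) by lia. rewrite (Nat.mul_comm b a).
  assert (Ia := posN a ltac:(lia)). assert (Ib := posN b ltac:(lia)).
  assert (mult_le : (a <= fl y -> b <= fl y -> a * b <= N)%nat).
  { unfold N. rewrite !le_fl_iff, mult_INR by nra. intros. nra. }
  assert (one_le : (a * b <= N -> a <= fl y \/ b <= fl y)%nat).
  { unfold N. rewrite !le_fl_iff, mult_INR by nra. intros.
    destruct (Rle_dec (INR a) y); [now left|]. right.
    destruct (Rle_dec (INR b) y); [assumption|]. nra. }
  destruct (Nat.leb_spec a (fl y)), (Nat.leb_spec b (fl y)), (Nat.leb_spec (a * b) N);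
    simpl andb; cbn iota; try ring; exfalso; lia.
Qed.

(** The binomial convolution, the form in which [ln (s * t) ^ k] splits. *)
Definition bconv (k : nat) (u v : nat -> R) : R :=
  sum_f_R0 (fun j => Binomial.C k j * u j * v (k - j)%nat) k.

Lemma sum_f_R0_rev (f : nat -> R) (n : nat) :
  sum_f_R0 (fun j => f (n - j)%nat) n = sum_f_R0 f n.
Proof.
  revert f. induction n as [|n IH]; intros f; [reflexivity|].
  rewrite decomp_sum by lia. rewrite tech5, Nat.sub_0_r.
  simpl Nat.pred. rewrite <- (IH f).
  rewrite (sum_eq _ (fun j => f (n - j)%nat)) by (intros; f_equal; lia). ring.
Qed.

Lemma bconv_ext (k : nat) (u u' v v' : nat -> R) :
  (forall j, (j <= k)%nat -> u j = u' j) -> (forall j, (j <= k)%nat -> v j = v' j) ->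
  bconv k u v = bconv k u' v'.
Proof.
  intros Hu Hv. apply sum_eq. intros j Hj. rewrite Hu, Hv by lia. reflexivity.
Qed.

Lemma bconv_comm (k : nat) (u v : nat -> R) : bconv k u v = bconv k v u.
Proof.
  unfold bconv. rewrite <- sum_f_R0_rev. apply sum_eq. intros j Hj.
  replace (k - (k - j))%nat with j by lia. rewrite <- pascal_step1 by lia. ring.
Qed.

Lemma bconv_plus_l (k : nat) (u u' v : nat -> R) :
  bconv k (fun j => u j + u' j) v = bconv k u v + bconv k u' v.
Proof. unfold bconv. rewrite <- plus_sum. apply sum_eq. intros. ring. Qed.

Lemma bconv_scal_l (k : nat) (c : R) (u v : nat -> R) :
  bconv k (fun j => c * u j) v = c * bconv k u v.
Proof. unfold bconv. rewrite scal_sum. apply sum_eq. intros. ring. Qed.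

Lemma bconv_plus_r (k : nat) (u v v' : nat -> R) :
  bconv k u (fun j => v j + v' j) = bconv k u v + bconv k u v'.
Proof. rewrite bconv_comm, bconv_plus_l, !(bconv_comm k u). reflexivity. Qed.

Lemma bconv_scal_r (k : nat) (c : R) (u v : nat -> R) :
  bconv k u (fun j => c * v j) = c * bconv k u v.
Proof. rewrite bconv_comm, bconv_scal_l, (bconv_comm k u). reflexivity. Qed.

Lemma bconv_psum_l (k : nat) (f : nat -> nat -> R) (v : nat -> R) (n : nat) :
  bconv k (fun j => psum (f j) n) v = psum (fun i => bconv k (fun j => f j i) v) n.
Proof.
  induction n as [|n IH]; cbn [psum].
  - rewrite (bconv_ext k _ (fun j => 0 * v j) v v) by (intros; ring || reflexivity).
    rewrite bconv_scal_l. ring.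
  - rewrite bconv_plus_l, IH. reflexivity.
Qed.

Lemma bconv_apsum_l (k r q : nat) (f : nat -> nat -> R) (v : nat -> R) (n : nat) :
  bconv k (fun j => apsum r q (f j) n) v = apsum r q (fun i => bconv k (fun j => f j i) v) n.
Proof.
  unfold apsum. rewrite bconv_psum_l. apply psum_ext. intros i _.
  rewrite <- bconv_scal_l. reflexivity.
Qed.

Lemma bconv_apsum_r (k r q : nat) (f : nat -> nat -> R) (v : nat -> R) (n : nat) :
  bconv k v (fun j => apsum r q (f j) n) = apsum r q (fun i => bconv k v (fun j => f j i)) n.
Proof.
  rewrite bconv_comm, bconv_apsum_l. apply psum_ext. intros i _. now rewrite bconv_comm.
Qed.

Lemma is_derive_sum_f_R0 (f df : nat -> R -> R) (n : nat) (t : R) :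
  (forall j, (j <= n)%nat -> is_derive (f j) t (df j t)) ->
  is_derive (fun x => sum_f_R0 (fun j => f j x) n) t (sum_f_R0 (fun j => df j t) n).
Proof.
  intros H. induction n as [|n IH]; simpl.
  - apply H; lia.
  - apply (is_derive_plus (fun x => sum_f_R0 (fun j => f j x) n) (f (S n))).
    + apply IH. intros; apply H; lia.
    + apply H; lia.
Qed.

Lemma is_derive_bconv (k : nat) (f df g dg : nat -> R -> R) (t : R) :
  (forall j, (j <= k)%nat -> is_derive (f j) t (df j t)) ->
  (forall j, (j <= k)%nat -> is_derive (g j) t (dg j t)) ->
  is_derive (fun x => bconv k (fun j => f j x) (fun j => g j x)) t
    (bconv k (fun j => df j t) (fun j => g j t) + bconv k (fun j => f j t) (fun j => dg j t)).
Proof.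
  intros Hf Hg. unfold bconv. rewrite <- plus_sum.
  apply (is_derive_sum_f_R0 (fun j x => Binomial.C k j * f j x * g (k - j)%nat x)
   (fun j t => Binomial.C k j * df j t * g (k - j)%nat t + Binomial.C k j * f j t * dg (k - j)%nat t)).
  intros j Hj. specialize (Hf j Hj). specialize (Hg (k - j)%nat ltac:(lia)).
  auto_derive.
  - repeat split; [now exists (df j t)|now exists (dg (k - j)%nat t)].
  - rewrite (is_derive_unique (fun x : R => f j x) _ _ Hf),
      (is_derive_unique (fun x : R => g (k - j)%nat x) _ _ Hg). ring.
Qed.

Definition lpow (a : R) (j : nat) (t : R) : R := ln t ^ j * Rpower t (- a).

Lemma lpow_mult (a : R) (k : nat) (s t : R) : 0 < s -> 0 < t ->
  lpow a k (s * t) = bconv k (fun j => lpow a j s) (fun j => lpow a j t).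
Proof.
  intros Hs Ht. unfold lpow, bconv. rewrite ln_mult, binomial by assumption.
  rewrite <- Rpower_mult_distr by assumption. rewrite Rmult_comm, scal_sum.
  apply sum_eq. intros. ring.
Qed.

Definition dlpow (a : R) (j : nat) (t : R) : R :=
  INR j * lpow (a + 1) (j - 1) t - a * lpow (a + 1) j t.

Lemma is_derive_lpow (a : R) (j : nat) (t : R) : 0 < t ->
  is_derive (lpow a j) t (dlpow a j t).
Proof.
  intros H. unfold lpow, dlpow, lpow.
  evar_last.
  - apply (is_derive_mult (fun t => ln t ^ j) (fun t => Rpower t (- a)) t
      (INR j * / t * ln t ^ pred j) (- a * Rpower t (- a - 1))).
    + apply (is_derive_pow ln j t (/ t)). now apply is_derive_ln.
    + now apply is_derive_Rpower.
    + intros; apply Rmult_comm.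
  - unfold plus, mult; simpl.
    replace (Rpower t (- (a + 1))) with (Rpower t (- a) * / t).
    + replace (Rpower t (- a - 1)) with (Rpower t (- a) * / t).
      * replace (pred j) with (j - 1)%nat by lia. ring.
      * unfold Rminus. rewrite Rpower_plus, (Rpower_Ropp t 1), Rpower_1 by exact H. reflexivity.
    + rewrite Ropp_plus_distr, Rpower_plus, (Rpower_Ropp t 1), Rpower_1 by exact H. reflexivity.
Qed.

(** [f = O(y ^ (- b))] on [y >= 1]; a negative [b] means growth. *)
Definition bigO (b : R) (f : R -> R) : Prop :=
  exists K, 0 <= K /\ forall y, 1 <= y -> Rabs (f y) <= K * Rpower y (- b).

Lemma bigO_ext (b : R) (f g : R -> R) :
  (forall y, 1 <= y -> f y = g y) -> bigO b f -> bigO b g.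
Proof.
  intros H [K [HK B]]. exists K. split; [exact HK|]. intros y Hy. rewrite <- H; auto.
Qed.

Lemma bigO_plus (b : R) (f g : R -> R) :
  bigO b f -> bigO b g -> bigO b (fun y => f y + g y).
Proof.
  intros [K [HK B]] [K' [HK' B']]. exists (K + K'). split; [lra|]. intros y Hy.
  eapply Rle_trans; [apply Rabs_triang|]. rewrite Rmult_plus_distr_r.
  apply Rplus_le_compat; auto.
Qed.

Lemma bigO_mult (b b' : R) (f g : R -> R) :
  bigO b f -> bigO b' g -> bigO (b + b') (fun y => f y * g y).
Proof.
  intros [K [HK B]] [K' [HK' B']]. exists (K * K'). split; [nra|]. intros y Hy.
  rewrite Rabs_mult, Ropp_plus_distr, Rpower_plus.
  replace (K * K' * (Rpower y (- b) * Rpower y (- b')))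
    with ((K * Rpower y (- b)) * (K' * Rpower y (- b'))) by ring.
  apply Rmult_le_compat; auto using Rabs_pos.
Qed.

Lemma bigO_const (c : R) : bigO 0 (fun _ => c).
Proof.
  exists (Rabs c). split; [apply Rabs_pos|]. intros y Hy.
  rewrite Ropp_0, Rpower_O by lra. lra.
Qed.

Lemma bigO_scal (b c : R) (f : R -> R) : bigO b f -> bigO b (fun y => c * f y).
Proof. intros H. replace b with (0 + b) by ring. apply bigO_mult; auto using bigO_const. Qed.

Lemma bigO_weaken (b b' : R) (f : R -> R) : b' <= b -> bigO b f -> bigO b' f.
Proof.
  intros Hb [K [HK B]]. exists K. split; [exact HK|]. intros y Hy.
  eapply Rle_trans; [apply B; exact Hy|]. apply Rmult_le_compat_l; [exact HK|].
  apply Rle_Rpower; lra.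
Qed.

Lemma bigO_bconv2 (k : nat) (b b' : R) (f g : nat -> R -> R) :
  (forall j, bigO b (f j)) -> (forall j, bigO b' (g j)) ->
  exists K, 0 <= K /\ forall s t, 1 <= s -> 1 <= t ->
    Rabs (bconv k (fun j => f j s) (fun j => g j t)) <= K * Rpower s (- b) * Rpower t (- b').
Proof.
  intros Hf Hg. unfold bconv.
  generalize k at 1 2 as n. intros n.
  assert (HT : forall j, exists K, 0 <= K /\ forall s t, 1 <= s -> 1 <= t ->
    Rabs (Binomial.C n j * f j s * g (n - j)%nat t) <= K * Rpower s (- b) * Rpower t (- b')).
  { intros j. destruct (Hf j) as [K [HK B]]. destruct (Hg (n - j)%nat) as [K' [HK' B']].
    exists (Rabs (Binomial.C n j) * K * K'). split.
    { repeat apply Rmult_le_pos; auto using Rabs_pos. }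
    intros s t Hs Ht. rewrite !Rabs_mult.
    replace (Rabs (Binomial.C n j) * K * K' * Rpower s (- b) * Rpower t (- b'))
      with (Rabs (Binomial.C n j) * (K * Rpower s (- b)) * (K' * Rpower t (- b'))) by ring.
    apply Rmult_le_compat; auto using Rabs_pos.
    - apply Rmult_le_pos; apply Rabs_pos.
    - apply Rmult_le_compat_l; auto using Rabs_pos. }
  induction k as [|m IH]; simpl; [apply HT|].
  destruct IH as [K [HK B]]. destruct (HT (S m)) as [K' [HK' B']].
  exists (K + K'). split; [lra|]. intros s t Hs Ht.
  eapply Rle_trans; [apply Rabs_triang|]. rewrite !Rmult_plus_distr_r.
  apply Rplus_le_compat; auto.
Qed.

Lemma bigO_bconv (k : nat) (b b' : R) (f g : nat -> R -> R) :
  (forall j, bigO b (f j)) -> (forall j, bigO b' (g j)) ->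
  bigO (b + b') (fun y => bconv k (fun j => f j y) (fun j => g j y)).
Proof.
  intros Hf Hg. destruct (bigO_bconv2 k b b' f g Hf Hg) as [K [HK B]].
  exists K. split; [exact HK|]. intros y Hy.
  rewrite Ropp_plus_distr, Rpower_plus, <- Rmult_assoc. apply B; exact Hy.
Qed.

Lemma pow_div_fact_le_exp (x : R) (n : nat) : 0 <= x -> x ^ n / INR (fact n) <= exp x.
Proof.
  intros Hx. eapply Rle_trans; [|now apply (exp_ge_taylor _ n)].
  destruct n as [|n]; [apply Rle_refl|]. rewrite tech5.
  assert (0 <= sum_f_R0 (fun k => x ^ k / INR (fact k)) n); [|lra].
  apply cond_pos_sum. intros i. apply Rdiv_le_0_compat; [now apply pow_le|].
  apply lt_0_INR, lt_O_fact.
Qed.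

Lemma bigO_lpow (a b : R) (j : nat) : b < a -> bigO b (lpow a j).
Proof.
  intros H. set (e := a - b).
  assert (He : 0 < e) by (unfold e; lra).
  exists (INR (fact j) / e ^ j). split.
  { apply Rdiv_le_0_compat; [apply pos_INR|now apply pow_lt]. }
  intros y Hy. unfold lpow.
  assert (Hl : 0 <= ln y) by (rewrite <- ln_1; apply ln_le; lra).
  rewrite Rabs_mult, (Rabs_right (ln y ^ j)) by (apply Rle_ge, pow_le, Hl).
  rewrite (Rabs_right (Rpower _ _)) by (left; apply Rpower_pos).
  replace (- b) with (e + - a) by (unfold e; ring).
  rewrite Rpower_plus, <- Rmult_assoc. apply Rmult_le_compat_r; [left; apply Rpower_pos|].
  assert (E := pow_div_fact_le_exp (e * ln y) j ltac:(nra)).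
  fold (Rpower y e) in E. rewrite Rpow_mult_distr in E.
  assert (0 < INR (fact j)) by apply lt_0_INR, lt_O_fact.
  assert (0 < e ^ j) by now apply pow_lt.
  apply (Rmult_le_compat_l (INR (fact j) / e ^ j)) in E; [|apply Rdiv_le_0_compat; lra].
  eapply Rle_trans; [|exact E]. right. field. lra.
Qed.

Lemma bigO_dlpow (a b : R) (j : nat) : b < a + 1 -> bigO b (dlpow a j).
Proof.
  intros H. unfold dlpow.
  apply (bigO_ext b (fun t => INR j * lpow (a + 1) (j - 1) t + (- a) * lpow (a + 1) j t)).
  { intros; ring. }
  apply bigO_plus; apply bigO_scal, bigO_lpow; exact H.
Qed.

Lemma em_lpow (r q j : nat) (a eta : R) (P : R -> R) :
  (1 <= r <= q)%nat -> 0 < eta < a + 1 ->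
  (forall t, 0 < t -> is_derive P t (lpow a j t)) ->
  exists c, bigO eta (fun y => apsum r q (fun n => lpow a j (INR n)) (fl y) - P y / INR q
          - lpow a j y * saw r q (fl y) y - c).
Proof.
  intros H He HP.
  set (g2 := fun t => INR j * dlpow (a + 1) (j - 1) t - a * dlpow (a + 1) j t).
  assert (O2 : bigO (eta + 1) g2).
  { apply (bigO_ext _ (fun t => INR j * dlpow (a + 1) (j - 1) t + (- a) * dlpow (a + 1) j t)).
    { intros; unfold g2; ring. }
    apply bigO_plus; apply bigO_scal, bigO_dlpow; lra. }
  destruct O2 as [K2 [HK2 B2]].
  destruct (bigO_dlpow a eta j ltac:(lra)) as [K1 [HK1 B1]].
  destruct (em_second_order r q (lpow a j) (dlpow a j) g2 P (K1 + K2) eta) as [c [K [HK B]]];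
    try lra; try assumption.
  - intros; apply HP; lra.
  - intros; apply is_derive_lpow; lra.
  - intros t Ht. unfold g2, dlpow.
    apply (is_derive_minus (fun t => INR j * lpow (a + 1) (j - 1) t)
      (fun t => a * lpow (a + 1) j t)); apply is_derive_scal, is_derive_lpow; lra.
  - intros t Ht. eapply Rle_trans; [apply B1, Ht|].
    apply Rmult_le_compat_r; [left; apply Rpower_pos|lra].
  - intros t Ht. eapply Rle_trans; [apply B2, Ht|].
    replace (- (eta + 1)) with (- eta - 1) by ring.
    apply Rmult_le_compat_r; [left; apply Rpower_pos|lra].
  - exists c, K. auto.
Qed.

Lemma apsum_ext (r q : nat) (f g : nat -> R) (n : nat) :
  (forall i, (1 <= i <= n)%nat -> f i = g i) -> apsum r q f n = apsum r q g n.
Proof. intros H. apply psum_ext. intros i Hi. now rewrite H. Qed.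

Lemma apsum_plus (r q : nat) (f g : nat -> R) (n : nat) :
  apsum r q (fun i => f i + g i) n = apsum r q f n + apsum r q g n.
Proof. unfold apsum. rewrite <- psum_plus. apply psum_ext. intros; ring. Qed.

Lemma apsum_scal (r q : nat) (c : R) (f : nat -> R) (n : nat) :
  apsum r q (fun i => c * f i) n = c * apsum r q f n.
Proof. unfold apsum. rewrite <- psum_scal. apply psum_ext. intros; ring. Qed.

Lemma apsum_const (r q : nat) (c : R) (n : nat) :
  apsum r q (fun _ => c) n = c * cnt r q n.
Proof. unfold apsum, cnt. rewrite <- psum_scal. apply psum_ext. intros; ring. Qed.

Lemma apsum_bound (r q : nat) (f : nat -> R) (K : R) (n : nat) :
  0 <= K -> (forall i, (1 <= i <= n)%nat -> Rabs (f i) <= K) ->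
  Rabs (apsum r q f n) <= INR n * K.
Proof.
  intros HK H. unfold apsum. eapply Rle_trans; [apply psum_abs|].
  rewrite <- psum_const. apply psum_le. intros i Hi. rewrite Rabs_mult.
  destruct (chi_01 r q i) as [-> | ->].
  - rewrite Rabs_R0. lra.
  - rewrite Rabs_R1. specialize (H i Hi). lra.
Qed.

Lemma zero_derive_const (f : R -> R) (t : R) : 0 < t ->
  (forall x, 0 < x -> is_derive f x 0) -> f t = f 1.
Proof.
  intros Ht H. destruct (Rtotal_order t 1) as [L|[->|L]]; [|reflexivity|symmetry];
    apply eq_is_derive; try assumption; intros; apply H; lra.
Qed.

Lemma lpow_1_0 (t : R) : 0 < t -> lpow 1 0 t = / t.
Proof. intros H. unfold lpow. rewrite Rpower_Ropp, Rpower_1 by exact H. simpl. ring. Qed.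

Lemma lpow_1 (k : nat) (t : R) : 0 < t -> lpow 1 k t = ln t ^ k / t.
Proof. intros H. unfold lpow. rewrite Rpower_Ropp, Rpower_1 by exact H. reflexivity. Qed.

Lemma primitive_conv (k : nat) (a kap : R) (P : nat -> R -> R) :
  (forall j t, 0 < t -> is_derive (P j) t (lpow a j t)) ->
  (forall s, 0 < s -> bconv k (fun j => lpow a j s) (fun j => P j 1)
     = P k s / s - kap * lpow 1 (k + 1) s) ->
  forall s t, 0 < s -> 0 < t ->
  bconv k (fun j => lpow a j s) (fun j => P j t) = P k (s * t) / s - kap * lpow 1 (k + 1) s.
Proof.
  intros HP H1 s t Hs Ht.
  apply Rminus_diag_uniq. symmetry.
  rewrite <- (Rminus_diag_eq _ _ (H1 s Hs)).
  set (h := fun t => bconv k (fun j => lpow a j s) (fun j => P j t)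
     - (P k (s * t) / s - kap * lpow 1 (k + 1) s)).
  transitivity (h 1); [unfold h; now rewrite Rmult_1_r|]. change (h 1 = h t).
  symmetry. unfold h.
  apply (zero_derive_const h); [exact Ht|]. intros x Hx. unfold h.
  evar_last.
  - apply @is_derive_minus.
    + apply (is_derive_bconv k (fun j _ => lpow a j s) (fun j _ => 0) P (lpow a)).
      * intros. apply @is_derive_const.
      * intros. now apply HP.
    + apply @is_derive_minus.
      * unfold Rdiv. apply (is_derive_ext (fun x => / s * P k (s * x))).
        { intros. apply Rmult_comm. }
        apply is_derive_scal. apply (is_derive_comp (P k) (fun x => s * x)).
        -- apply HP. nra.
        -- apply (is_derive_scal (fun x => x)). apply @is_derive_id.
      * apply @is_derive_const.
  - rewrite (bconv_ext k _ (fun j => 0 * 0) _ (fun j => P j x)) by (intros; simpl; ring).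
    rewrite bconv_scal_l, <- lpow_mult by assumption.
    unfold minus, plus, opp, scal, zero, one; simpl. unfold mult; simpl. field. lra.
Qed.

Lemma primitive_square (k : nat) (a kap : R) (P : nat -> R -> R) :
  (forall j t, 0 < t -> is_derive (P j) t (lpow a j t)) ->
  (forall s, 0 < s -> bconv k (fun j => lpow a j s) (fun j => P j 1)
     = P k s / s - kap * lpow 1 (k + 1) s) ->
  - P (k + 1)%nat 1 = bconv k (fun j => P j 1) (fun j => P j 1) ->
  forall y, 0 < y ->
  P k (y * y) * (2 * ln y) - P (k + 1)%nat (y * y)
  = bconv k (fun j => P j y) (fun j => P j y) + 2 * kap * (ln y ^ (k + 2) / INR (k + 2)).
Proof.
  intros HP H1 H2 y Hy.
  assert (H3 := primitive_conv k a kap P HP H1).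
  assert (Hk : INR (k + 2) <> 0) by (apply not_0_INR; lia).
  apply Rminus_diag_uniq.
  set (h := fun y => P k (y * y) * (2 * ln y) - P (k + 1)%nat (y * y)
    - (bconv k (fun j => P j y) (fun j => P j y) + 2 * kap * (ln y ^ (k + 2) / INR (k + 2)))).
  change (h y = 0). rewrite (zero_derive_const h y Hy).
  - unfold h. rewrite ln_1, Rmult_1_r, <- H2, pow_i by lia. unfold Rdiv. ring.
  - intros x Hx. unfold h.
    assert (Hsq : forall j, is_derive (fun x => P j (x * x)) x (2 * x * lpow a j (x * x))).
    { intros j. evar_last.
      - apply (is_derive_comp (P j) (fun x => x * x) x (lpow a j (x * x)) (2 * x));
          [apply HP; nra|].
        auto_derive; [exact I|ring].
      - reflexivity. }
    evar_last.
    + apply @is_derive_minus; [apply @is_derive_minus|apply @is_derive_plus].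
      * apply (is_derive_mult (fun x => P k (x * x)) (fun x => 2 * ln x)).
        -- apply Hsq.
        -- apply is_derive_scal. now apply is_derive_ln.
        -- intros; apply Rmult_comm.
      * apply Hsq.
      * apply (is_derive_bconv k P (lpow a) P (lpow a)); intros; now apply HP.
      * apply is_derive_scal. unfold Rdiv.
        apply (is_derive_ext (fun x => / INR (k + 2) * ln x ^ (k + 2))).
        { intros; apply Rmult_comm. }
        apply is_derive_scal. apply (is_derive_pow ln (k + 2) x (/ x)). now apply is_derive_ln.
    + rewrite (bconv_comm k (fun j => P j x)), H3 by assumption.
      rewrite lpow_1 by exact Hx.
      unfold lpow. rewrite ln_mult by assumption.
      replace (pred (k + 2)) with (k + 1)%nat by lia.
      rewrite (pow_add (ln x + ln x) k 1).
      unfold minus, plus, opp, scal, zero, one; simpl. unfold mult; simpl.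
      field. split; lra.
Qed.

Lemma bigO_sq (b : R) (f : R -> R) : bigO b f -> bigO (2 * b) (fun y => f (y * y)).
Proof.
  intros [K [HK B]]. exists K. split; [exact HK|]. intros y Hy.
  eapply Rle_trans; [apply B; nra|]. right. f_equal.
  replace (- (2 * b)) with (- b + - b) by ring.
  rewrite Rpower_plus, Rpower_mult_distr by lra. reflexivity.
Qed.

Lemma bigO_id : bigO (- 1) (fun y => y).
Proof.
  exists 1. split; [lra|]. intros y Hy. replace (- - 1) with 1 by ring. rewrite Rpower_1 by lra.
  rewrite Rabs_right; lra.
Qed.

Lemma bigO_saw (r q : nat) : (1 <= r <= q)%nat -> bigO 0 (fun y => saw r q (fl y) y).
Proof.
  intros H. exists 1. split; [lra|]. intros y Hy. rewrite Ropp_0, Rpower_O by lra.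
  destruct (fl_bounds y); [lra|].
  generalize (saw_bound r q (fl y) y H). intros B. specialize (B ltac:(lra)). lra.
Qed.

Definition em_error (r q : nat) (g P : R -> R) (c y : R) : R :=
  apsum r q (fun n => g (INR n)) (fl y) - P y / INR q - g y * saw r q (fl y) y - c.

(** For fixed [n], the summand [f(n m) - f(y ^ 2)] vanishes at the end point
    [m = y ^ 2 / n], so no sawtooth at [y ^ 2 / n] survives. *)
Lemma hyperbola_side (r1 q1 r2 q2 k : nat) (a beta kap : R) (P : nat -> R -> R)
  (c2 : nat -> R) :
  (1 <= r2 <= q2)%nat -> 0 < beta < a ->
  (forall s t, 0 < s -> 0 < t -> bconv k (fun j => lpow a j s) (fun j => P j t)
     = P k (s * t) / s - kap * lpow 1 (k + 1) s) ->
  (forall j, bigO (1 + beta) (em_error r2 q2 (lpow a j) (P j) (c2 j))) ->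
  bigO (2 * beta) (fun y =>
    apsum r1 q1 (fun n => apsum r2 q2 (fun m => lpow a k (INR (n * m)) - lpow a k (y * y))
      (fl (y * y / INR n))) (fl y)
    - (bconv k (fun j => apsum r1 q1 (fun n => lpow a j (INR n)) (fl y)) c2
       + / INR q2 * ((P k (y * y) - y * y * lpow a k (y * y))
                      * apsum r1 q1 (fun n => lpow 1 0 (INR n)) (fl y)
                    - kap * apsum r1 q1 (fun n => lpow 1 (k + 1) (INR n)) (fl y))
       - mean r2 q2 * lpow a k (y * y) * cnt r1 q1 (fl y))).
Proof.
  intros H2 Hb Hconv HE.
  assert (Hq : INR q2 <> 0) by (apply not_0_INR; lia).
  destruct (bigO_bconv2 k beta (1 + beta) (lpow a)
    (fun j => em_error r2 q2 (lpow a j) (P j) (c2 j))) as [K [HK B]];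
    [intros; apply bigO_lpow; lra|exact HE|].
  exists K. split; [exact HK|]. intros y Hy.
  set (X := y * y). assert (HX : 0 < X) by (unfold X; nra).
  destruct (fl_bounds y) as [f1 f2]; [lra|].
  assert (pos : forall n, (1 <= n <= fl y)%nat -> 1 <= INR n <= y).
  { intros n Hn. split; [change 1 with (INR 1); apply le_INR; lia|].
    eapply Rle_trans; [apply le_INR, Hn|exact f1]. }
  assert (posY : forall n, (1 <= n <= fl y)%nat -> y <= X / INR n).
  { intros n Hn. specialize (pos n Hn). apply (Rmult_le_reg_r (INR n)); [lra|].
    replace (X / INR n * INR n) with X by (field; lra). unfold X. nra. }
  set (err := fun n => bconv k (fun j => lpow a j (INR n))
    (fun j => em_error r2 q2 (lpow a j) (P j) (c2 j) (X / INR n))).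
  assert (inner : forall n, (1 <= n <= fl y)%nat ->
    apsum r2 q2 (fun m => lpow a k (INR (n * m)) - lpow a k X) (fl (X / INR n))
    = bconv k (fun j => lpow a j (INR n)) c2
      + ((/ INR q2 * (P k X - X * lpow a k X)) * lpow 1 0 (INR n)
      + ((- (/ INR q2 * kap)) * lpow 1 (k + 1) (INR n)
      + (- (mean r2 q2 * lpow a k X) + err n)))).
  { intros n Hn. assert (Pn := pos n Hn). assert (PY := posY n Hn).
    set (Y := X / INR n) in *.
    assert (EX : X = INR n * Y) by (unfold Y; field; lra).
    rewrite (apsum_ext _ _ _ (fun m =>
      bconv k (fun j => lpow a j (INR n)) (fun j => lpow a j (INR m)) + - lpow a k X)).
    2:{ intros m Hm. rewrite mult_INR, lpow_mult; [ring|lra|].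
        apply lt_0_INR; lia. }
    rewrite apsum_plus, <- (bconv_apsum_r k r2 q2 (fun j m => lpow a j (INR m))).
    rewrite apsum_const.
    rewrite (bconv_ext k _ (fun j => lpow a j (INR n)) _
      (fun j => c2 j + (/ INR q2 * P j Y + (saw r2 q2 (fl Y) Y * lpow a j Y
        + em_error r2 q2 (lpow a j) (P j) (c2 j) Y))));
      [|reflexivity|intros; unfold em_error; field; exact Hq].
    rewrite !bconv_plus_r, !bconv_scal_r, Hconv, <- lpow_mult, <- EX by lra.
    rewrite lpow_1_0 by lra. unfold err. fold Y.
    replace (cnt r2 q2 (fl Y)) with (saw r2 q2 (fl Y) Y + X / INR n / INR q2 + mean r2 q2)
      by (unfold saw; fold Y; ring).
    field. split; [exact Hq|lra]. }
  rewrite (apsum_ext _ _ _ _ _ inner).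
  rewrite !apsum_plus, !apsum_scal, <- (bconv_apsum_l k r1 q1 (fun j n => lpow a j (INR n))).
  rewrite apsum_const.
  match goal with |- Rabs ?x <= _ => replace x with (apsum r1 q1 err (fl y)) by ring end.
  replace (K * Rpower y (- (2 * beta)))
    with (y * (K * Rpower X (- (1 + beta)) * y)).
  2:{ unfold X. rewrite <- Rpower_mult_distr by lra.
      replace (y * (K * (Rpower y (- (1 + beta)) * Rpower y (- (1 + beta))) * y))
        with (K * ((Rpower y 1 * Rpower y 1) * (Rpower y (- (1 + beta)) * Rpower y (- (1 + beta)))))
        by (rewrite Rpower_1 by lra; ring).
      rewrite <- !Rpower_plus. do 2 f_equal. ring. }
  assert (0 <= K * Rpower X (- (1 + beta))).
  { apply Rmult_le_pos; [exact HK|left; apply Rpower_pos]. }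
  eapply Rle_trans; [apply (apsum_bound _ _ _ (K * Rpower X (- (1 + beta)) * y))|].
  - nra.
  - intros n Hn. assert (Pn := pos n Hn). assert (PY := posY n Hn). unfold err.
    eapply Rle_trans; [apply B; lra|].
    replace (Rpower X (- (1 + beta))) with
      (Rpower (INR n) (- beta) * Rpower (INR n) (- 1) * Rpower (X / INR n) (- (1 + beta))).
    + replace (Rpower (INR n) (- 1)) with (/ INR n)
        by (rewrite <- (Rpower_1 (INR n)) at 1 by lra; symmetry; apply Rpower_Ropp).
      assert (0 < Rpower (INR n) (- beta)) by apply Rpower_pos.
      assert (0 < Rpower (X / INR n) (- (1 + beta))) by apply Rpower_pos.
      assert (0 <= K * Rpower (INR n) (- beta) * Rpower (X / INR n) (- (1 + beta))).
      { repeat apply Rmult_le_pos; lra. }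
      replace (K * (Rpower (INR n) (- beta) * / INR n * Rpower (X / INR n) (- (1 + beta))) * y)
        with ((K * Rpower (INR n) (- beta) * Rpower (X / INR n) (- (1 + beta))) * (y / INR n))
        by (field; lra).
      rewrite <- (Rmult_1_r (K * _ * _)) at 1. apply Rmult_le_compat_l; [assumption|].
      apply (Rmult_le_reg_r (INR n)); [lra|].
      replace (y / INR n * INR n) with y by (field; lra). lra.
    + rewrite <- Rpower_plus. replace (- beta + -1) with (- (1 + beta)) by ring.
      rewrite Rpower_mult_distr; [|lra|lra]. f_equal. field. lra.
  - apply Rmult_le_compat_r; [nra|exact f1].
Qed.

Definition main_term (q1 q2 : nat) (g1 g2 x : R) : R :=
  x * ((ln x - 1) / (INR q1 * INR q2) + (g1 / INR q2 + g2 / INR q1)).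

(** [kap] distinguishes the cases [a < 1], where [kap = 0] and [P j] is [I_ j], and
    [a = 1], where [kap = 1 / (k + 1)] and [P j t = ln t ^ (j + 1) / (j + 1)]. *)
Lemma hyperbola_asymptotics (r1 q1 r2 q2 k : nat) (a beta kap : R) (P : nat -> R -> R)
  (c1 c2 : nat -> R) (g1 g2 d1 d2 : R) :
  (1 <= r1 <= q1)%nat -> (1 <= r2 <= q2)%nat -> 0 < beta < a -> beta < 1 ->
  (forall j t, 0 < t -> is_derive (P j) t (lpow a j t)) ->
  (forall s, 0 < s -> bconv k (fun j => lpow a j s) (fun j => P j 1)
     = P k s / s - kap * lpow 1 (k + 1) s) ->
  - P (k + 1)%nat 1 = bconv k (fun j => P j 1) (fun j => P j 1) ->
  (forall j, bigO (beta - 1) (P j)) ->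
  (forall j, bigO (1 + beta) (em_error r1 q1 (lpow a j) (P j) (c1 j))) ->
  (forall j, bigO (1 + beta) (em_error r2 q2 (lpow a j) (P j) (c2 j))) ->
  bigO (2 - beta) (em_error r1 q1 (lpow 1 0) ln g1) ->
  bigO (2 - beta) (em_error r2 q2 (lpow 1 0) ln g2) ->
  bigO beta (em_error r1 q1 (lpow 1 (k + 1)) (fun t => ln t ^ (k + 2) / INR (k + 2)) d1) ->
  bigO beta (em_error r2 q2 (lpow 1 (k + 1)) (fun t => ln t ^ (k + 2) / INR (k + 2)) d2) ->
  bigO beta (fun y =>
    psum (fun n => INR (d_star r1 q1 r2 q2 n) * (lpow a k (INR n) - lpow a k (y * y)))
      (fl (y * y))
    + lpow a k (y * y) * main_term q1 q2 g1 g2 (y * y)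
    - (g1 / INR q2 + g2 / INR q1) * P k (y * y)
    - P (k + 1)%nat (y * y) / (INR q1 * INR q2)
    - (bconv k c1 c2 - kap * d1 / INR q2 - kap * d2 / INR q1)).
Proof.
  intros H1 H2 Hb Hb1 HP Hc Hone HPg HE1 HE2 HL1 HL2 HQ1 HQ2.
  assert (Hq1 : INR q1 <> 0) by (apply not_0_INR; lia).
  assert (Hq2 : INR q2 <> 0) by (apply not_0_INR; lia).
  assert (Hk : INR (k + 2) <> 0) by (apply not_0_INR; lia).
  assert (Hconv := primitive_conv k a kap P HP Hc).
  assert (Hsq := primitive_square k a kap P HP Hc Hone).
  assert (S12 := hyperbola_side r1 q1 r2 q2 k a beta kap P c2 H2 Hb Hconv HE2).
  assert (S21 := hyperbola_side r2 q2 r1 q1 k a beta kap P c1 H1 Hb Hconv HE1).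
  set (A := fun r q j y => / INR q * P j y + saw r q (fl y) y * lpow a j y).
  set (rho1 := fun j => em_error r1 q1 (lpow a j) (P j) (c1 j)) in *.
  set (rho2 := fun j => em_error r2 q2 (lpow a j) (P j) (c2 j)) in *.
  assert (HA : forall r q, (1 <= r <= q)%nat -> forall j, bigO (beta - 1) (A r q j)).
  { intros r q H j. apply bigO_plus; [now apply bigO_scal|].
    apply (bigO_weaken (0 + beta)); [lra|]. apply bigO_mult; [now apply bigO_saw|].
    apply bigO_lpow; lra. }
  assert (HF : bigO (2 * beta) (fun y => lpow a k (y * y))).
  { apply bigO_sq, bigO_lpow; lra. }
  assert (HD : bigO (2 * (beta - 1)) (fun y => P k (y * y) + -1 * (y * y * lpow a k (y * y)))).
  { apply bigO_plus; [now apply bigO_sq|]. apply bigO_scal.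
    replace (2 * (beta - 1)) with (2 * (- 1) + 2 * beta) by ring.
    apply bigO_mult; [|exact HF]. apply (bigO_sq (- 1) (fun y => y)), bigO_id. }
  assert (HX : bigO beta (fun y =>
    - (bconv k (fun j => rho1 j y) (fun j => A r2 q2 j y)
       + bconv k (fun j => A r1 q1 j y) (fun j => rho2 j y)
       + bconv k (fun j => rho1 j y) (fun j => rho2 j y)))).
  { apply (bigO_ext beta (fun y => -1 * (bconv k (fun j => rho1 j y) (fun j => A r2 q2 j y)
       + bconv k (fun j => A r1 q1 j y) (fun j => rho2 j y)
       + bconv k (fun j => rho1 j y) (fun j => rho2 j y)))); [intros; ring|].
    apply bigO_scal. apply bigO_plus; [apply bigO_plus|].
    - apply (bigO_weaken (1 + beta + (beta - 1))); [lra|]. apply bigO_bconv; auto.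
    - apply (bigO_weaken ((beta - 1) + (1 + beta))); [lra|]. apply bigO_bconv; auto.
    - apply (bigO_weaken (1 + beta + (1 + beta))); [lra|]. apply bigO_bconv; auto. }
  assert (HDL1 := bigO_scal _ (/ INR q2) _ (bigO_mult _ _ _ _ HD HL1)).
  assert (HDL2 := bigO_scal _ (/ INR q1) _ (bigO_mult _ _ _ _ HD HL2)).
  apply (bigO_weaken _ beta) in HDL1; [|lra]. apply (bigO_weaken _ beta) in HDL2; [|lra].
  apply (bigO_scal _ (- (kap / INR q2))) in HQ1. apply (bigO_scal _ (- (kap / INR q1))) in HQ2.
  apply (bigO_scal _ (- (mean r1 q1 * mean r2 q2))) in HF.
  apply (bigO_weaken _ beta) in HF; [|lra].
  apply (bigO_weaken _ beta) in S12; [|lra]. apply (bigO_weaken _ beta) in S21; [|lra].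
  assert (Tot := bigO_plus _ _ _ (bigO_plus _ _ _ (bigO_plus _ _ _ S12 S21)
    (bigO_plus _ _ _ HDL1 HDL2)) (bigO_plus _ _ _ (bigO_plus _ _ _ HQ1 HQ2)
    (bigO_plus _ _ _ HX HF))).
  revert Tot. apply bigO_ext. intros y Hy. cbv beta.
  set (X := y * y).
  assert (HY := hyperbola r1 q1 r2 q2 y (fun n => lpow a k (INR n) - lpow a k X) Hy).
  fold X in HY. rewrite HY. clear HY.
  set (T12 := apsum r1 q1 (fun n => apsum r2 q2 _ _) (fl y)).
  set (T21 := apsum r2 q2 (fun n => apsum r1 q1 _ _) (fl y)).
  replace (apsum r2 q2 (fun b => apsum r1 q1 (fun a0 => lpow a k (INR (a0 * b)) - lpow a k X)
    (fl (X / INR b))) (fl y)) with T21.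
  2:{ unfold T21. apply apsum_ext. intros b _. apply apsum_ext. intros m _.
      now rewrite Nat.mul_comm. }
  set (s1 := fun j => apsum r1 q1 (fun n => lpow a j (INR n)) (fl y)) in *.
  set (s2 := fun j => apsum r2 q2 (fun n => lpow a j (INR n)) (fl y)) in *.
  assert (ES : apsum r1 q1 (fun a0 => apsum r2 q2
      (fun b => lpow a k (INR (a0 * b)) - lpow a k X) (fl y)) (fl y)
      = bconv k s1 s2 - lpow a k X * cnt r1 q1 (fl y) * cnt r2 q2 (fl y)).
  { rewrite (apsum_ext _ _ _ (fun n => bconv k (fun j => lpow a j (INR n)) s2
      + - (lpow a k X * cnt r2 q2 (fl y)))).
    - rewrite apsum_plus, apsum_const, <- (bconv_apsum_l k r1 q1 (fun j n => lpow a j (INR n))).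
      fold s1. ring.
    - intros n Hn.
      rewrite (apsum_ext _ _ _ (fun m =>
        bconv k (fun j => lpow a j (INR n)) (fun j => lpow a j (INR m)) + - lpow a k X)).
      + rewrite apsum_plus, <- (bconv_apsum_r k r2 q2 (fun j m => lpow a j (INR m))).
        rewrite apsum_const. fold s2. ring.
      + intros m Hm. rewrite mult_INR, lpow_mult; [ring|apply lt_0_INR; lia|apply lt_0_INR; lia]. }
  rewrite ES. clear ES.
  assert (E1 : forall j, s1 j = c1 j + (A r1 q1 j y + rho1 j y)).
  { intros j. unfold s1, A, rho1, em_error. field. exact Hq1. }
  assert (E2 : forall j, s2 j = c2 j + (A r2 q2 j y + rho2 j y)).
  { intros j. unfold s2, A, rho2, em_error. field. exact Hq2. }
  rewrite (bconv_ext k s1 (fun j => c1 j + (A r1 q1 j y + rho1 j y)) c2 c2) by auto.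
  rewrite (bconv_ext k s2 (fun j => c2 j + (A r2 q2 j y + rho2 j y)) c1 c1) by auto.
  rewrite (bconv_ext k s1 (fun j => c1 j + (A r1 q1 j y + rho1 j y)) s2
    (fun j => c2 j + (A r2 q2 j y + rho2 j y))) by auto.
  rewrite !bconv_plus_l, !bconv_plus_r.
  rewrite !(bconv_comm k _ c1).
  assert (EA : bconv k (fun j => A r1 q1 j y) (fun j => A r2 q2 j y) =
    (P k X * (2 * ln y) - P (k + 1)%nat X - 2 * kap * (ln y ^ (k + 2) / INR (k + 2)))
      / (INR q1 * INR q2)
    + (saw r1 q1 (fl y) y / INR q2 + saw r2 q2 (fl y) y / INR q1)
      * (P k X / y - kap * lpow 1 (k + 1) y)
    + saw r1 q1 (fl y) y * saw r2 q2 (fl y) y * lpow a k X).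
  { unfold A. rewrite !bconv_plus_l, !bconv_plus_r, !bconv_scal_l, !bconv_scal_r.
    rewrite (bconv_comm k (fun j => P j y) (fun j => lpow a j y)).
    unfold X. rewrite (Hsq y) by lra.
    rewrite !Hconv, <- lpow_mult by lra. field. repeat split; try assumption; lra. }
  rewrite EA. clear EA.
  unfold em_error. rewrite lpow_1_0 by lra. unfold main_term.
  replace (ln X) with (2 * ln y) by (unfold X; rewrite ln_mult by lra; ring).
  replace (cnt r1 q1 (fl y)) with (saw r1 q1 (fl y) y + y / INR q1 + mean r1 q1)
    by (unfold saw; ring).
  replace (cnt r2 q2 (fl y)) with (saw r2 q2 (fl y) y + y / INR q2 + mean r2 q2)
    by (unfold saw; ring).
  set (F := lpow a k X). set (PX := P k X). set (PX1 := P (k + 1)%nat X).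
  clearbody F PX PX1 T12 T21.
  unfold X. clear X.
  set (RR := ln y ^ (k + 2) / INR (k + 2)). clearbody RR.
  field. repeat split; try assumption; lra.
Qed.

Lemma bigO_small (b : R) (f : R -> R) : 0 < b -> bigO b f ->
  forall eps, 0 < eps -> exists A, 1 <= A /\ forall y, A <= y -> Rabs (f y) < eps.
Proof.
  intros Hb [K [HK B]] eps He.
  set (L := K / eps + 1).
  assert (HL : 1 <= L).
  { unfold L. assert (0 <= K / eps) by (apply Rdiv_le_0_compat; lra). lra. }
  exists (Rpower L (/ b)). split.
  { rewrite <- (Rpower_O L) by lra. apply Rle_Rpower; [exact HL|].
    left. now apply Rinv_0_lt_compat. }
  intros y Hy.
  assert (H1 : 1 <= Rpower L (/ b)).
  { rewrite <- (Rpower_O L) by lra. apply Rle_Rpower; [exact HL|].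
    left. now apply Rinv_0_lt_compat. }
  eapply Rle_lt_trans; [apply B; lra|].
  assert (Hp : L <= Rpower y b).
  { replace L with (Rpower (Rpower L (/ b)) b).
    - apply Rle_Rpower_l; lra.
    - rewrite Rpower_mult, Rinv_l, Rpower_1; lra. }
  rewrite Rpower_Ropp. apply (Rmult_lt_reg_r (Rpower y b)); [apply Rpower_pos|].
  rewrite Rmult_assoc, Rinv_l, Rmult_1_r by (generalize (Rpower_pos y b); lra).
  apply (Rlt_le_trans _ (eps * L)); [|apply Rmult_le_compat_l; lra].
  unfold L. replace (eps * (K / eps + 1)) with (K + eps) by (field; lra). lra.
Qed.

Lemma bigO_is_lim (b c : R) (f g : R -> R) : 0 < b ->
  bigO b (fun y => f y - c) -> (forall y, 1 <= y -> g y = f y) -> is_lim g p_infty c.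
Proof.
  intros Hb H E. apply is_lim_spec. intros eps.
  destruct (bigO_small b _ Hb H eps (cond_pos eps)) as [A [HA B]].
  exists A. intros x Hx. rewrite E by lra. apply B. lra.
Qed.

Lemma em_constant (r q j : nat) (a b : R) (P F : R -> R) :
  (1 <= r <= q)%nat -> 0 < a -> 0 < b < a + 1 ->
  (forall t, 0 < t -> is_derive P t (lpow a j t)) ->
  (forall y, 1 <= y -> F y = apsum r q (fun n => lpow a j (INR n)) (fl y) - P y / INR q) ->
  bigO b (em_error r q (lpow a j) P (real (Lim F p_infty))).
Proof.
  intros H Ha Hb HP HF.
  destruct (em_lpow r q j a b P H Hb HP) as [c Hc].
  rewrite (is_lim_unique F p_infty c); [exact Hc|].
  apply (bigO_is_lim (Rmin b (a / 2)) c
    (fun y => apsum r q (fun n => lpow a j (INR n)) (fl y) - P y / INR q));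
    [apply Rmin_pos; lra| |exact HF].
  apply (bigO_ext _ (fun y => (apsum r q (fun n => lpow a j (INR n)) (fl y) - P y / INR q
          - lpow a j y * saw r q (fl y) y - c) + saw r q (fl y) y * lpow a j y)); [intros; ring|].
  apply bigO_plus.
  - apply (bigO_weaken b); [apply Rmin_l|exact Hc].
  - apply (bigO_weaken (0 + a / 2)); [rewrite Rplus_0_l; apply Rmin_r|].
    apply bigO_mult; [now apply bigO_saw|apply bigO_lpow; lra].
Qed.

Lemma is_derive_lnpow (j : nat) (t : R) : 0 < t ->
  is_derive (fun t => ln t ^ (j + 1) / INR (j + 1)) t (lpow 1 j t).
Proof.
  intros Ht. rewrite lpow_1 by exact Ht. unfold Rdiv.
  apply (is_derive_ext (fun x => / INR (j + 1) * ln x ^ (j + 1))).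
  { intros; apply Rmult_comm. }
  evar_last.
  - apply is_derive_scal. apply (is_derive_pow ln (j + 1) t (/ t)). now apply is_derive_ln.
  - replace (pred (j + 1)) with j by lia. field.
    split; [lra|apply not_0_INR; lia].
Qed.

Lemma gamma_em (r q j : nat) (b : R) : (1 <= r <= q)%nat -> 0 < b < 2 ->
  bigO b (em_error r q (lpow 1 j) (fun t => ln t ^ (j + 1) / INR (j + 1)) (gamma j r q)).
Proof.
  intros H Hb. unfold gamma. apply em_constant; try lra; try assumption.
  - intros; now apply is_derive_lnpow.
  - intros y Hy. rewrite sum_ap_apsum. f_equal.
    + apply apsum_ext. intros i Hi. rewrite lpow_1; [reflexivity|].
      apply lt_0_INR; lia.
    + field. split; apply not_0_INR; lia.
Qed.

Lemma I_succ (j : nat) (t a : R) : a < 1 ->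
  I_ (S j) t a = / (1 - a) * (Rpower t (1 - a) * ln t ^ (S j)) - INR (S j) / (1 - a) * I_ j t a.
Proof.
  intros Ha. unfold I_. rewrite decomp_sum by lia. simpl Nat.pred.
  rewrite (sum_eq _ (fun i => ((-1) ^ i * (INR (fact j) / INR (fact (j - i)))
    * (ln t ^ (j - i) / (1 - a) ^ (i + 1))) * (- (INR (S j) / (1 - a))))).
  - rewrite <- scal_sum.
    replace (S j - 0)%nat with (S j) by lia. replace ((1 - a) ^ (0 + 1)) with (1 - a) by (simpl; ring).
    rewrite pow_O. field. split; [lra|apply INR_fact_neq_0].
  - intros i Hi. replace (S j - S i)%nat with (j - i)%nat by lia.
    rewrite fact_simpl, mult_INR. replace (S i + 1)%nat with (S (i + 1)) by lia.
    rewrite <- !tech_pow_Rmult. field.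
    split; [lra|split; [apply pow_nonzero; lra|apply INR_fact_neq_0]].
Qed.

Lemma I_0 (t a : R) : I_ 0 t a = / (1 - a) * Rpower t (1 - a).
Proof. unfold I_. simpl. unfold Rdiv. rewrite Rinv_1, !Rmult_1_r, !Rmult_1_l. apply Rmult_comm. Qed.

Lemma is_derive_I (j : nat) (a t : R) : a < 1 -> 0 < t ->
  is_derive (fun t => I_ j t a) t (lpow a j t).
Proof.
  intros Ha Ht. induction j as [|j IH].
  - apply (is_derive_ext (fun t => / (1 - a) * Rpower t (1 - a))).
    { intros; symmetry; apply I_0. }
    evar_last.
    + apply is_derive_scal, is_derive_Rpower, Ht.
    + unfold lpow. replace (1 - a - 1) with (- a) by ring. rewrite pow_O. field. lra.
  - apply (is_derive_ext (fun t => / (1 - a) * (Rpower t (1 - a) * ln t ^ (S j))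
      - INR (S j) / (1 - a) * I_ j t a)).
    { intros; symmetry; now apply I_succ. }
    evar_last.
    + apply @is_derive_minus.
      * apply is_derive_scal.
        apply (is_derive_mult (fun t => Rpower t (1 - a)) (fun t => ln t ^ (S j))).
        -- apply is_derive_Rpower, Ht.
        -- apply (is_derive_pow ln (S j) t (/ t)). now apply is_derive_ln.
        -- intros; apply Rmult_comm.
      * apply is_derive_scal, IH.
    + unfold minus, plus, opp, mult; simpl plus. unfold lpow.
      replace (1 - a - 1) with (- a) by ring.
      replace (Rpower t (1 - a)) with (t * Rpower t (- a))
        by (rewrite <- (Rpower_1 t) at 1 by exact Ht; rewrite <- Rpower_plus; f_equal; ring).
      replace (pred (S j)) with j by reflexivity. simpl. field. lra.
Qed.

Lemma I_at_1 (j : nat) (a : R) : a < 1 ->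
  I_ j 1 a = (-1) ^ j * INR (fact j) / (1 - a) ^ (j + 1).
Proof.
  intros Ha. induction j as [|j IH].
  - rewrite I_0, Rpower_1_l. simpl. field. lra.
  - rewrite I_succ, IH, ln_1, pow_i by (lia || exact Ha).
    rewrite fact_simpl, mult_INR. replace (S j + 1)%nat with (S (j + 1)) by lia.
    rewrite <- !tech_pow_Rmult. field. split; [apply pow_nonzero|]; lra.
Qed.

Lemma bigO_I (j : nat) (a b : R) : a < 1 -> b < a -> bigO (b - 1) (fun t => I_ j t a).
Proof.
  intros Ha Hb. induction j as [|j IH].
  - apply (bigO_ext _ (fun t => / (1 - a) * lpow (a - 1) 0 t)).
    { intros. rewrite I_0. unfold lpow. rewrite pow_O, Rmult_1_l. do 2 f_equal. ring. }
    apply bigO_scal, bigO_lpow. lra.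
  - apply (bigO_ext _ (fun t => / (1 - a) * lpow (a - 1) (S j) t
      + (- (INR (S j) / (1 - a))) * I_ j t a)).
    { intros. rewrite (I_succ j y a Ha). unfold lpow.
      replace (- (a - 1)) with (1 - a) by ring. ring. }
    apply bigO_plus; apply bigO_scal; [apply bigO_lpow; lra|exact IH].
Qed.

Lemma fact_C (k j : nat) : (j <= k)%nat ->
  Binomial.C k j * INR (fact j) = INR (fact k) / INR (fact (k - j)).
Proof. intros H. unfold Binomial.C. field. split; apply INR_fact_neq_0. Qed.

Lemma I_conv (k : nat) (a s : R) : a < 1 -> 0 < s ->
  bconv k (fun j => lpow a j s) (fun j => I_ j 1 a) = I_ k s a / s - 0 * lpow 1 (k + 1) s.
Proof.
  intros Ha Hs. rewrite bconv_comm. unfold I_ at 2, bconv.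
  replace (Rpower s (1 - a)) with (s * Rpower s (- a))
    by (rewrite <- (Rpower_1 s) at 1 by exact Hs; rewrite <- Rpower_plus; f_equal; ring).
  match goal with |- _ = s * _ * ?S / s - _ =>
    replace (s * Rpower s (- a) * S / s - 0 * lpow 1 (k + 1) s) with (Rpower s (- a) * S)
      by (field; lra) end.
  rewrite scal_sum. apply sum_eq. intros j Hj.
  rewrite I_at_1, <- fact_C by assumption. unfold lpow. field.
  apply pow_nonzero. lra.
Qed.

Lemma I_one (k : nat) (a : R) : a < 1 ->
  - I_ (k + 1) 1 a = bconv k (fun j => I_ j 1 a) (fun j => I_ j 1 a).
Proof.
  intros Ha. unfold bconv.
  rewrite (sum_eq _ (fun _ => (-1) ^ k * INR (fact k) / (1 - a) ^ (k + 2))).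
  - rewrite sum_cte, I_at_1 by exact Ha.
    replace (k + 1)%nat with (S k) by lia. rewrite fact_simpl, mult_INR.
    replace (k + 2)%nat with (S k + 1)%nat by lia. rewrite <- tech_pow_Rmult.
    field. apply pow_nonzero. lra.
  - intros j Hj. rewrite !I_at_1 by exact Ha.
    replace (Binomial.C k j * ((-1) ^ j * INR (fact j) / (1 - a) ^ (j + 1)))
      with ((Binomial.C k j * INR (fact j)) * (-1) ^ j / (1 - a) ^ (j + 1))
      by (field; apply pow_nonzero; lra).
    rewrite fact_C by exact Hj.
    replace ((-1) ^ k) with ((-1) ^ j * (-1) ^ (k - j)) by (rewrite <- pow_add; f_equal; lia).
    replace ((1 - a) ^ (k + 2)) with ((1 - a) ^ (j + 1) * (1 - a) ^ (k - j + 1))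
      by (rewrite <- pow_add; f_equal; lia).
    field. repeat split; try (apply pow_nonzero; lra). apply INR_fact_neq_0.
Qed.

Lemma zeta_em (r q j : nat) (a b : R) : (1 <= r <= q)%nat -> 0 < a < 1 -> 0 < b < a + 1 ->
  bigO b (em_error r q (lpow a j) (fun t => I_ j t a) (zeta_k j a r q)).
Proof.
  intros H Ha Hb. unfold zeta_k. apply em_constant; try lra; try assumption.
  - intros; apply is_derive_I; lra.
  - intros y Hy. rewrite sum_ap_apsum. f_equal.
    apply apsum_ext. intros i Hi. unfold lpow, Rdiv. now rewrite Rpower_Ropp.
Qed.

(** * The integral of the error term *)

Lemma is_derive_main_term (q1 q2 : nat) (g1 g2 x : R) : (1 <= q1)%nat -> (1 <= q2)%nat ->
  0 < x -> is_derive (main_term q1 q2 g1 g2) x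
    (ln x / (INR q1 * INR q2) + (g1 / INR q2 + g2 / INR q1)).
Proof.
  intros H1 H2 Hx. unfold main_term. auto_derive; [exact Hx|].
  field. repeat split; try lra; apply not_0_INR; lia.
Qed.

Lemma is_RInt_divisor (d : nat -> R) (q1 q2 k : nat) (a g1 g2 : R) (P : nat -> R -> R) :
  (1 <= q1)%nat -> (1 <= q2)%nat ->
  (forall j t, 0 < t -> is_derive (P j) t (lpow a j t)) ->
  forall X, 1 <= X ->
  is_RInt (fun x => - dlpow a k x * (psum d (fl x) - main_term q1 q2 g1 g2 x)) 1 X
    (psum (fun n => d n * (lpow a k (INR n) - lpow a k X)) (fl X)
     + (lpow a k X * main_term q1 q2 g1 g2 X - lpow a k 1 * main_term q1 q2 g1 g2 1)
     - (g1 / INR q2 + g2 / INR q1) * (P k X - P k 1)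
     - (P (k + 1)%nat X - P (k + 1)%nat 1) / (INR q1 * INR q2)).
Proof.
  intros H1 H2 HP.
  assert (Hq1 : INR q1 <> 0) by (apply not_0_INR; lia).
  assert (Hq2 : INR q2 <> 0) by (apply not_0_INR; lia).
  set (V := fun n X => psum (fun n => d n * lpow a k (INR n)) n - psum d n * lpow a k X
     + (lpow a k X * main_term q1 q2 g1 g2 X - lpow a k 1 * main_term q1 q2 g1 g2 1)
     - (g1 / INR q2 + g2 / INR q1) * (P k X - P k 1)
     - (P (k + 1)%nat X - P (k + 1)%nat 1) / (INR q1 * INR q2)).
  assert (EV : forall X, psum (fun n => d n * (lpow a k (INR n) - lpow a k X)) (fl X)
     + (lpow a k X * main_term q1 q2 g1 g2 X - lpow a k 1 * main_term q1 q2 g1 g2 1)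
     - (g1 / INR q2 + g2 / INR q1) * (P k X - P k 1)
     - (P (k + 1)%nat X - P (k + 1)%nat 1) / (INR q1 * INR q2) = V (fl X) X).
  { intros X. unfold V.
    rewrite (psum_ext _ (fun n => d n * lpow a k (INR n) + - lpow a k X * d n))
      by (intros; ring).
    rewrite psum_plus, psum_scal. ring. }
  set (f := fun x => - dlpow a k x * (psum d (fl x) - main_term q1 q2 g1 g2 x)).
  assert (piece : forall n X, (1 <= n)%nat -> INR n <= X <= INR n + 1 ->
    is_RInt f (INR n) X (V n X - V n (INR n))).
  { intros n X Hn HX.
    assert (1 <= INR n) by (change 1 with (INR 1); now apply le_INR).
    apply (is_RInt_ext (fun x => - dlpow a k x * (psum d n - main_term q1 q2 g1 g2 x))).
    { intros x Hx. rewrite Rmin_left, Rmax_right in Hx by lra. unfold f.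
      rewrite (fl_unique x n) by lra. reflexivity. }
    apply (is_RInt_derive (V n)).
    - intros x Hx. rewrite Rmin_left, Rmax_right in Hx by lra. unfold V.
      assert (Hx0 : 0 < x) by lra.
      assert (D1 := is_derive_lpow a k x Hx0).
      assert (D2 := is_derive_main_term q1 q2 g1 g2 x H1 H2 Hx0).
      assert (D3 := HP k x Hx0). assert (D4 := HP (k + 1)%nat x Hx0).
      auto_derive.
      + repeat split; eexists; eassumption.
      + rewrite (is_derive_unique (fun x : R => lpow a k x) _ _ D1),
          (is_derive_unique (fun x : R => main_term q1 q2 g1 g2 x) _ _ D2),
          (is_derive_unique (fun x : R => P k x) _ _ D3),
          (is_derive_unique (fun x : R => P (k + 1)%nat x) _ _ D4).
        replace (lpow a (k + 1) x) with (ln x * lpow a k x)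
          by (unfold lpow; rewrite pow_add; ring).
        field. split; assumption.
    - intros x Hx. rewrite Rmin_left, Rmax_right in Hx by lra.
      assert (Hx0 : 0 < x) by lra.
      apply (ex_derive_continuous (fun x => - dlpow a k x * (psum d n - main_term q1 q2 g1 g2 x))).
      apply (ex_derive_mult (fun x => - dlpow a k x)
        (fun x => psum d n - main_term q1 q2 g1 g2 x)).
      + apply (ex_derive_opp (dlpow a k)). unfold dlpow.
        apply (ex_derive_minus (fun t => INR k * lpow (a + 1) (k - 1) t)
          (fun t => a * lpow (a + 1) k t)); apply ex_derive_scal; eexists;
          now apply is_derive_lpow.
      + apply (ex_derive_minus (fun _ => psum d n) (main_term q1 q2 g1 g2)).
        * apply ex_derive_const.
        * eexists. now apply is_derive_main_term. }
  assert (jump : forall n, V n (INR (S n)) = V (S n) (INR (S n))).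
  { intros n. unfold V. cbn [psum]. ring. }
  assert (nat_case : forall n, is_RInt f 1 (INR (S n)) (V (S n) (INR (S n)))).
  { induction n as [|n IH].
    - change (INR 1) with 1.
      replace (V 1%nat 1) with 0; [apply @is_RInt_point|]. unfold V. cbn [psum].
      change (INR 1) with 1. unfold Rdiv. ring.
    - rewrite <- jump.
      replace (V (S n) (INR (S (S n)))) with (V (S n) (INR (S n)) +
        (V (S n) (INR (S (S n))) - V (S n) (INR (S n)))) by ring.
      apply (is_RInt_Chasles f 1 (INR (S n))); [exact IH|].
      apply piece; [lia|]. rewrite (S_INR (S n)). lra. }
  intros X HX. rewrite EV.
  destruct (fl_bounds X) as [b1 b2]; [lra|].
  assert (Hf : (1 <= fl X)%nat) by (apply fl_ge; simpl; lra).
  replace (V (fl X) X) with (V (fl X) (INR (fl X)) + (V (fl X) X - V (fl X) (INR (fl X)))) by ring.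
  apply (is_RInt_Chasles f 1 (INR (fl X))).
  - specialize (nat_case (fl X - 1)%nat). replace (S (fl X - 1)) with (fl X) in nat_case by lia.
    exact nat_case.
  - apply piece; [exact Hf|lra].
Qed.

Lemma is_RInt_gen_of_bigO (f F : R -> R) (b l : R) : 0 < b ->
  (forall X, 1 <= X -> is_RInt f 1 X (F X)) -> bigO b (fun y => F (y * y) - l) ->
  is_RInt_gen f (at_point 1) (Rbar_locally p_infty) l.
Proof.
  intros Hb HI HO Q [eps HQ].
  destruct (bigO_small b _ Hb HO eps (cond_pos eps)) as [A [HA B]].
  apply (Filter_prod _ _ _ (fun x => x = 1) (fun X => A * A < X)).
  - reflexivity.
  - exists (A * A). auto.
  - intros x X -> HX. exists (F X). split.
    + apply HI. nra.
    + apply HQ. assert (E : X = sqrt X * sqrt X) by (rewrite sqrt_sqrt; nra).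
      assert (A <= sqrt X).
      { rewrite <- (sqrt_square A) by lra. apply sqrt_le_1_alt. lra. }
      specialize (B (sqrt X) H). rewrite <- E in B. exact B.
Qed.

Lemma divisor_integral (r1 q1 r2 q2 k : nat) (a kap : R) (P : nat -> R -> R)
  (c1 c2 : nat -> R) (D : R -> R) :
  (1 <= r1 <= q1)%nat -> (1 <= r2 <= q2)%nat -> 0 < a <= 1 ->
  (forall j t, 0 < t -> is_derive (P j) t (lpow a j t)) ->
  (forall s, 0 < s -> bconv k (fun j => lpow a j s) (fun j => P j 1)
     = P k s / s - kap * lpow 1 (k + 1) s) ->
  - P (k + 1)%nat 1 = bconv k (fun j => P j 1) (fun j => P j 1) ->
  (forall j, bigO (a / 2 - 1) (P j)) ->
  (forall j, bigO (1 + a / 2) (em_error r1 q1 (lpow a j) (P j) (c1 j))) ->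
  (forall j, bigO (1 + a / 2) (em_error r2 q2 (lpow a j) (P j) (c2 j))) ->
  (forall x, 1 <= x -> D x = psum (fun n => INR (d_star r1 q1 r2 q2 n)) (fl x)
     - main_term q1 q2 (gamma 0 r1 q1) (gamma 0 r2 q2) x) ->
  is_RInt_gen (fun x => (a * ln x ^ k - INR k * ln x ^ (k - 1)) / Rpower x (1 + a) * D x)
    (at_point 1) (Rbar_locally p_infty)
    (bconv k c1 c2 - kap * gamma (k + 1) r1 q1 / INR q2 - kap * gamma (k + 1) r2 q2 / INR q1
     - lpow a k 1 * main_term q1 q2 (gamma 0 r1 q1) (gamma 0 r2 q2) 1
     + (gamma 0 r1 q1 / INR q2 + gamma 0 r2 q2 / INR q1) * P k 1
     + P (k + 1)%nat 1 / (INR q1 * INR q2)).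
Proof.
  intros H1 H2 Ha HP Hc Hone HPg HE1 HE2 HD.
  set (g1 := gamma 0 r1 q1) in *. set (g2 := gamma 0 r2 q2) in *.
  assert (ln_em : forall r q, (1 <= r <= q)%nat ->
    bigO (2 - a / 2) (em_error r q (lpow 1 0) ln (gamma 0 r q))).
  { intros r q H. generalize (gamma_em r q 0 (2 - a / 2) H ltac:(lra)).
    apply bigO_ext. intros y Hy. unfold em_error. simpl. field. apply not_0_INR; lia. }
  assert (k_em : forall r q, (1 <= r <= q)%nat ->
    bigO (a / 2) (em_error r q (lpow 1 (k + 1)) (fun t => ln t ^ (k + 2) / INR (k + 2))
      (gamma (k + 1) r q))).
  { intros r q H. generalize (gamma_em r q (k + 1) (a / 2) H ltac:(lra)).
    replace (k + 1 + 1)%nat with (k + 2)%nat by lia. exact (fun h => h). }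
  assert (HT := hyperbola_asymptotics r1 q1 r2 q2 k a (a / 2) kap P c1 c2 g1 g2 _ _ H1 H2
    ltac:(lra) ltac:(lra) HP Hc Hone HPg HE1 HE2 (ln_em _ _ H1) (ln_em _ _ H2)
    (k_em _ _ H1) (k_em _ _ H2)).
  apply (is_RInt_gen_of_bigO _ (fun X =>
     psum (fun n => INR (d_star r1 q1 r2 q2 n) * (lpow a k (INR n) - lpow a k X)) (fl X)
     + (lpow a k X * main_term q1 q2 g1 g2 X - lpow a k 1 * main_term q1 q2 g1 g2 1)
     - (g1 / INR q2 + g2 / INR q1) * (P k X - P k 1)
     - (P (k + 1)%nat X - P (k + 1)%nat 1) / (INR q1 * INR q2)) (a / 2)); [lra| |].
  - intros X HX.
    apply (is_RInt_ext (fun x => - dlpow a k x *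
      (psum (fun n => INR (d_star r1 q1 r2 q2 n)) (fl x) - main_term q1 q2 g1 g2 x))).
    + intros x Hx. rewrite Rmin_left, Rmax_right in Hx by lra.
      rewrite HD by lra. apply (f_equal (fun z => z * _)).
      unfold dlpow, lpow, Rdiv. rewrite !Rpower_Ropp, (Rplus_comm 1 a). ring.
    + apply is_RInt_divisor; [lia|lia|exact HP|exact HX].
  - revert HT. apply bigO_ext. intros y Hy. field.
    split; apply not_0_INR; lia.
Qed.

Lemma is_RInt_gen_ext_ge1 (f g : R -> R) (l : R) : (forall x, 1 <= x -> f x = g x) ->
  is_RInt_gen f (at_point 1) (Rbar_locally p_infty) l ->
  is_RInt_gen g (at_point 1) (Rbar_locally p_infty) l.
Proof.
  intros E. apply is_RInt_gen_ext.
  apply (Filter_prod _ _ _ (fun x => x = 1) (fun X => 1 < X)); [reflexivity|now exists 1|].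
  intros x y -> Hy t Ht. simpl in Ht. rewrite Rmin_left in Ht by lra. apply E. lra.
Qed.

Lemma lpow_at_1 (a : R) (k : nat) : lpow a k 1 = IZR (Int_part (1 / INR (k + 1))).
Proof.
  unfold lpow. rewrite ln_1, Rpower_1_l, Rmult_1_r. destruct k as [|k].
  - simpl INR. rewrite pow_O. replace (1 / 1) with 1 by field.
    rewrite <- (Int_part_spec 1 1) by lra. reflexivity.
  - rewrite pow_i by lia.
    assert (H : 0 <= 1 / INR (S k + 1) < 1).
    { assert (1 < INR (S k + 1)) by (apply lt_1_INR; lia).
      split; [apply Rdiv_le_0_compat; lra|]. apply (Rdiv_lt_1 1); lra. }
    rewrite <- (Int_part_spec (1 / INR (S k + 1)) 0) by lra. reflexivity.
Qed.

Lemma integral_gamma (r1 q1 r2 q2 k : nat) (D : R -> R) :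
  (1 <= r1 <= q1)%nat -> (1 <= r2 <= q2)%nat ->
  (forall x, 1 <= x -> D x = psum (fun n => INR (d_star r1 q1 r2 q2 n)) (fl x)
     - main_term q1 q2 (gamma 0 r1 q1) (gamma 0 r2 q2) x) ->
  is_RInt_gen
    (fun x => (ln x ^ k - INR k * ln x ^ (k - 1)) / x ^ 2 * D x)
    (at_point 1) (Rbar_locally p_infty)
    (sum_f_R0 (fun i => Binomial.C k i * gamma (k - i) r2 q2 * gamma i r1 q1) k
     + IZR (Int_part (1 / INR (k + 1)))
       * (1 / (INR q1 * INR q2) - gamma 0 r1 q1 / INR q2 - gamma 0 r2 q2 / INR q1)
     - gamma (k + 1) r2 q2 / (INR q1 * INR (k + 1))
     - gamma (k + 1) r1 q1 / (INR q2 * INR (k + 1))).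
Proof.
  intros H1 H2 HD.
  assert (Hk : forall j, INR (j + 1) <> 0) by (intros; apply not_0_INR; lia).
  assert (Z : forall j, ln 1 ^ (j + 1) / INR (j + 1) = 0).
  { intros j. rewrite ln_1, pow_i by lia. unfold Rdiv. ring. }
  apply (is_RInt_gen_ext_ge1 (fun x =>
    (1 * ln x ^ k - INR k * ln x ^ (k - 1)) / Rpower x (1 + 1) * D x)).
  { intros x Hx. rewrite Rmult_1_l. do 2 f_equal.
    rewrite <- Rpower_pow by lra. f_equal. }
  rewrite <- (lpow_at_1 1 k).
  evar_last.
  - apply (divisor_integral r1 q1 r2 q2 k 1 (/ INR (k + 1))
      (fun j t => ln t ^ (j + 1) / INR (j + 1))
      (fun j => gamma j r1 q1) (fun j => gamma j r2 q2)); try assumption; try lra.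
    + intros. now apply is_derive_lnpow.
    + intros s Hs.
      rewrite (bconv_ext k _ (fun j => lpow 1 j s) _ (fun j => 0 * 0))
        by (intros; try rewrite Z; ring).
      rewrite bconv_scal_r, lpow_1 by exact Hs. field. split; [lra|apply Hk].
    + rewrite Z.
      rewrite (bconv_ext k _ (fun j => 0 * 0) _ (fun j => 0)) by (intros; rewrite Z; ring).
      rewrite bconv_scal_l. ring.
    + intros j. apply (bigO_ext _ (fun t => / INR (j + 1) * lpow 0 (j + 1) t)).
      { intros y Hy. unfold lpow. rewrite Ropp_0, Rpower_O by lra. field. apply Hk. }
      apply bigO_scal, bigO_lpow. lra.
    + intros j. apply gamma_em; [assumption|lra].
    + intros j. apply gamma_em; [assumption|lra].
  - rewrite !Z. unfold main_term. rewrite ln_1.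
    rewrite (sum_eq (fun i => Binomial.C k i * gamma (k - i) r2 q2 * gamma i r1 q1)
      (fun i => Binomial.C k i * gamma i r1 q1 * gamma (k - i) r2 q2)) by (intros; ring).
    fold (bconv k (fun j => gamma j r1 q1) (fun j => gamma j r2 q2)).
    field. repeat split; try apply Hk; apply not_0_INR; lia.
Qed.

Lemma integral_zeta (r1 q1 r2 q2 k : nat) (a : R) (D : R -> R) :
  (1 <= r1 <= q1)%nat -> (1 <= r2 <= q2)%nat -> 0 < a < 1 ->
  (forall x, 1 <= x -> D x = psum (fun n => INR (d_star r1 q1 r2 q2 n)) (fl x)
     - main_term q1 q2 (gamma 0 r1 q1) (gamma 0 r2 q2) x) ->
  is_RInt_gen
    (fun x => (a * ln x ^ k - INR k * ln x ^ (k - 1)) / Rpower x (1 + a) * D x)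
    (at_point 1) (Rbar_locally p_infty)
    (sum_f_R0 (fun l => Binomial.C k l * zeta_k l a r1 q1 * zeta_k (k - l) a r2 q2) k
     + IZR (Int_part (1 / INR (k + 1)))
       * (1 / (INR q1 * INR q2) - gamma 0 r1 q1 / INR q2 - gamma 0 r2 q2 / INR q1)
     - 1 / (INR q1 * INR q2) * (INR (fact (k + 1)) / (a - 1) ^ (k + 2))
     - (gamma 0 r1 q1 / INR q2 + gamma 0 r2 q2 / INR q1)
       * (INR (fact k) / (a - 1) ^ (k + 1))).
Proof.
  intros H1 H2 Ha HD.
  assert (I1 : forall j, I_ j 1 a = - (INR (fact j) / (a - 1) ^ (j + 1))).
  { intros j. rewrite I_at_1 by lra.
    replace ((1 - a) ^ (j + 1)) with ((-1) ^ j * (-1) * (a - 1) ^ (j + 1)).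
    - field. split; apply pow_nonzero; lra.
    - replace ((-1) ^ j * -1) with ((-1) ^ (j + 1)) by (rewrite pow_add; ring).
      rewrite <- Rpow_mult_distr. f_equal. ring. }
  rewrite <- (lpow_at_1 a k).
  evar_last.
  - apply (divisor_integral r1 q1 r2 q2 k a 0 (fun j t => I_ j t a)
      (fun j => zeta_k j a r1 q1) (fun j => zeta_k j a r2 q2)); try assumption; try lra.
    + intros. apply is_derive_I; lra.
    + intros s Hs. apply I_conv; lra.
    + apply I_one; lra.
    + intros j. apply bigO_I; lra.
    + intros j. apply zeta_em; [assumption|lra|lra].
    + intros j. apply zeta_em; [assumption|lra|lra].
  - rewrite !I1. unfold main_term. rewrite ln_1.
    fold (bconv k (fun j => zeta_k j a r1 q1) (fun j => zeta_k j a r2 q2)).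
    replace (k + 1 + 1)%nat with (k + 2)%nat by lia.
    field. repeat split; try (apply pow_nonzero; lra); apply not_0_INR; lia.
Qed.

(** * Complex power series *)

Notation is_Cseries := (@is_series C_AbsRing C_NormedModule).
Notation is_Cpseries := (@is_pseries C_AbsRing C_NormedModule).

(** Coquelicot states equalities of complex numbers in various structures,
    which [ring] does not recognize. *)
Ltac as_C := match goal with |- ?x = ?y => change (@eq C x y) end.

Lemma sum_n_Re (u : nat -> C) (n : nat) :
  Re (@sum_n C_AbelianMonoid u n) = sum_n (fun k => Re (u k)) n.
Proof. induction n as [|n IH]; [now rewrite !sum_O|]. rewrite !sum_Sn, <- IH. reflexivity. Qed.

Lemma sum_n_Im (u : nat -> C) (n : nat) :
  Im (@sum_n C_AbelianMonoid u n) = sum_n (fun k => Im (u k)) n.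
Proof. induction n as [|n IH]; [now rewrite !sum_O|]. rewrite !sum_Sn, <- IH. reflexivity. Qed.

Lemma is_Cseries_components (u : nat -> C) (l : C) :
  is_Cseries u l <->
  is_series (fun n => Re (u n)) (Re l) /\ is_series (fun n => Im (u n)) (Im l).
Proof.
  unfold is_series. split.
  - intros H. split; intros P [e HP].
    + destruct (H (fun z => P (Re z))) as [N HN].
      { exists e. intros z [Hz _]. apply HP, Hz. }
      exists N. intros n Hn. rewrite <- sum_n_Re. apply HN, Hn.
    + destruct (H (fun z => P (Im z))) as [N HN].
      { exists e. intros z [_ Hz]. apply HP, Hz. }
      exists N. intros n Hn. rewrite <- sum_n_Im. apply HN, Hn.
  - intros [H1 H2] P [e HP].
    destruct (H1 (ball (Re l) e)) as [N1 HN1]; [now exists e|].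
    destruct (H2 (ball (Im l) e)) as [N2 HN2]; [now exists e|].
    exists (Nat.max N1 N2). intros n Hn. apply HP. split.
    + change (ball (Re l) e (Re (@sum_n C_AbelianMonoid u n))).
      rewrite sum_n_Re. apply HN1. lia.
    + change (ball (Im l) e (Im (@sum_n C_AbelianMonoid u n))).
      rewrite sum_n_Im. apply HN2. lia.
Qed.

Lemma is_Cpseries_series (c : nat -> C) (w l : C) :
  is_Cpseries c w l <-> is_Cseries (fun n => (c n * w ^ n)%C) l.
Proof.
  assert (E : forall n, @scal C_AbsRing C_NormedModule (pow_n w n) (c n) = (c n * w ^ n)%C).
  { intros n. change (Cmult (@pow_n C_AbsRing w n) (c n) = (c n * w ^ n)%C).
    rewrite Cmult_comm. reflexivity. }
  unfold is_pseries. split; apply is_series_ext; intros n; [|symmetry]; apply E.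
Qed.

Lemma is_Cseries_unique (u : nat -> C) (l l' : C) :
  is_Cseries u l -> is_Cseries u l' -> l = l'.
Proof.
  rewrite !is_Cseries_components. intros [H1 H2] [H3 H4].
  apply is_series_unique in H1, H2, H3, H4.
  destruct l, l'; simpl in *. congruence.
Qed.

Lemma Re_mult_R (z : C) (r : R) : Re (z * RtoC r)%C = Re z * r.
Proof. unfold Re, Cmult, RtoC. simpl. ring. Qed.

Lemma Im_mult_R (z : C) (r : R) : Im (z * RtoC r)%C = Im z * r.
Proof. unfold Im, Cmult, RtoC. simpl. ring. Qed.

Lemma Cmod_le_sum (z : C) : Cmod z <= Rabs (Re z) + Rabs (Im z).
Proof.
  destruct z as [x y]. replace (x, y) with (RtoC x + Ci * RtoC y)%C.
  - eapply Rle_trans; [apply Cmod_triangle|].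
    rewrite Cmod_mult, Cmod_Ci, !Cmod_R. simpl.
    replace (x + (0 * y - 1 * 0)) with x by ring.
    replace (0 + (0 * 0 + 1 * y)) with y by ring. lra.
  - apply injective_projections; simpl; ring.
Qed.

Lemma Im_le_Cmod (z : C) : Rabs (Im z) <= Cmod z.
Proof. eapply Rle_trans; [|apply Rmax_Cmod]. apply Rmax_r. Qed.

Lemma ex_series_le_abs (u v : nat -> R) :
  (forall n, Rabs (u n) <= v n) -> ex_series v -> ex_series (fun n => Rabs (u n)).
Proof.
  intros H. apply (ex_series_le (fun n => Rabs (u n)) v).
  intros n. unfold norm; simpl. unfold abs; simpl. rewrite Rabs_Rabsolu. apply H.
Qed.

Definition abs_summable (c : nat -> C) (rho : R) : Prop :=
  ex_series (fun n => Cmod (c n) * rho ^ n).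

Lemma term_le (c : nat -> C) (rho : R) (w : C) (n : nat) : Cmod w <= rho ->
  Cmod (c n * w ^ n) <= Cmod (c n) * rho ^ n.
Proof.
  intros H. rewrite Cmod_mult, Cmod_pow.
  apply Rmult_le_compat_l; [apply Cmod_ge_0|].
  apply pow_incr. split; [apply Cmod_ge_0|exact H].
Qed.

Lemma abs_summable_Re (c : nat -> C) (rho : R) (w : C) : Cmod w <= rho ->
  abs_summable c rho -> ex_series (fun n => Rabs (Re (c n * w ^ n)%C)).
Proof.
  intros Hw. apply ex_series_le_abs. intros n.
  eapply Rle_trans; [apply re_le_Cmod|now apply term_le].
Qed.

Lemma abs_summable_Im (c : nat -> C) (rho : R) (w : C) : Cmod w <= rho ->
  abs_summable c rho -> ex_series (fun n => Rabs (Im (c n * w ^ n)%C)).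
Proof.
  intros Hw. apply ex_series_le_abs. intros n.
  eapply Rle_trans; [apply Im_le_Cmod|now apply term_le].
Qed.

Lemma abs_summable_ex (c : nat -> C) (rho : R) (w : C) : Cmod w <= rho ->
  abs_summable c rho -> exists l, is_Cpseries c w l.
Proof.
  intros Hw H.
  assert (H1 := abs_summable_Re c rho w Hw H). assert (H2 := abs_summable_Im c rho w Hw H).
  apply ex_series_Rabs in H1, H2. destruct H1 as [x Hx]. destruct H2 as [y Hy].
  exists (x, y). apply is_Cpseries_series, is_Cseries_components. split; assumption.
Qed.

Lemma abs_summable_le (c : nat -> C) (rho rho' : R) : 0 <= rho' <= rho ->
  abs_summable c rho -> abs_summable c rho'.
Proof.
  intros Hr. apply (ex_series_le (fun n => Cmod (c n) * rho' ^ n) (fun n => Cmod (c n) * rho ^ n)).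
  intros n. unfold norm; simpl. unfold abs; simpl.
  rewrite Rabs_right.
  - apply Rmult_le_compat_l; [apply Cmod_ge_0|]. now apply pow_incr.
  - apply Rle_ge, Rmult_le_pos; [apply Cmod_ge_0|now apply pow_le].
Qed.

Lemma abs_summable_geom (c : nat -> C) (K rho rho' : R) : 0 <= rho' < rho ->
  (forall n, Cmod (c n) * rho ^ n <= K) -> abs_summable c rho'.
Proof.
  intros Hr H.
  assert (HK : 0 <= K).
  { eapply Rle_trans; [|apply (H 0%nat)]. apply Rmult_le_pos; [apply Cmod_ge_0|simpl; lra]. }
  apply (ex_series_le (fun n => Cmod (c n) * rho' ^ n) (fun n => K * (rho' / rho) ^ n)).
  - intros n. unfold norm; simpl. unfold abs; simpl.
    assert (0 < rho ^ n) by (apply pow_lt; lra).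
    rewrite Rabs_right.
    + unfold Rdiv. rewrite Rpow_mult_distr, pow_inv.
      replace (Cmod (c n) * rho' ^ n) with (Cmod (c n) * rho ^ n * (rho' ^ n * / rho ^ n))
        by (field; lra).
      apply Rmult_le_compat_r; [|apply H].
      apply Rmult_le_pos; [apply pow_le; lra|left; now apply Rinv_0_lt_compat].
    + apply Rle_ge, Rmult_le_pos; [apply Cmod_ge_0|apply pow_le; lra].
  - apply (ex_series_scal K (fun n => (rho' / rho) ^ n)). apply ex_series_geom.
    rewrite Rabs_right.
    + apply (Rdiv_lt_1 rho' rho); lra.
    + apply Rle_ge, Rdiv_le_0_compat; lra.
Qed.

Fixpoint Csum (f : nat -> C) (n : nat) : C :=
  match n with O => f O | S m => (Csum f m + f (S m))%C end.

Lemma Csum_Re (f : nat -> C) (n : nat) : Re (Csum f n) = sum_f_R0 (fun k => Re (f k)) n.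
Proof. induction n as [|n IH]; simpl; [reflexivity|now rewrite <- IH]. Qed.

Lemma Csum_Im (f : nat -> C) (n : nat) : Im (Csum f n) = sum_f_R0 (fun k => Im (f k)) n.
Proof. induction n as [|n IH]; simpl; [reflexivity|now rewrite <- IH]. Qed.

Lemma Csum_ext (f g : nat -> C) (n : nat) :
  (forall k, (k <= n)%nat -> f k = g k) -> Csum f n = Csum g n.
Proof.
  intros H. induction n as [|n IH]; simpl; [now apply H|].
  rewrite IH, (H (S n)); auto.
Qed.

Lemma Csum_mult_r (f : nat -> C) (z : C) (n : nat) :
  (Csum f n * z)%C = Csum (fun k => (f k * z)%C) n.
Proof. induction n as [|n IH]; simpl; [reflexivity|]. rewrite <- IH. ring. Qed.

Lemma Cmod_Csum (f : nat -> C) (n : nat) :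
  Cmod (Csum f n) <= sum_f_R0 (fun k => Cmod (f k)) n.
Proof.
  induction n as [|n IH]; simpl; [lra|].
  eapply Rle_trans; [apply Cmod_triangle|]. lra.
Qed.

Definition cauchy_prod (a b : nat -> C) (n : nat) : C :=
  Csum (fun k => (a k * b (n - k)%nat)%C) n.

Lemma abs_summable_cauchy_prod (a b : nat -> C) (rho : R) : 0 <= rho ->
  abs_summable a rho -> abs_summable b rho -> abs_summable (cauchy_prod a b) rho.
Proof.
  intros Hr Ha Hb.
  assert (pos : forall c n, 0 <= Cmod (c n) * rho ^ n).
  { intros. apply Rmult_le_pos; [apply Cmod_ge_0|now apply pow_le]. }
  destruct Ha as [la Ha]. destruct Hb as [lb Hb].
  assert (M := is_series_mult_pos _ _ _ _ Ha Hb (pos a) (pos b)).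
  refine (ex_series_le (fun n => Cmod (cauchy_prod a b n) * rho ^ n) _ _ (ex_intro _ _ M)).
  intros n. unfold norm; simpl. unfold abs; simpl.
  rewrite Rabs_right by (apply Rle_ge, pos).
  rewrite Rmult_comm.
  eapply Rle_trans; [apply Rmult_le_compat_l; [now apply pow_le|apply Cmod_Csum]|].
  rewrite scal_sum. right. apply sum_eq. intros j Hj.
  rewrite Cmod_mult. replace (rho ^ n) with (rho ^ j * rho ^ (n - j))
    by (rewrite <- pow_add; f_equal; lia). ring.
Qed.

Lemma is_Cpseries_mult (a b : nat -> C) (rho : R) (w la lb : C) : Cmod w <= rho ->
  abs_summable a rho -> abs_summable b rho ->
  is_Cpseries a w la -> is_Cpseries b w lb -> is_Cpseries (cauchy_prod a b) w (la * lb)%C.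
Proof.
  intros Hw Sa Sb. rewrite !is_Cpseries_series, !is_Cseries_components.
  intros [a1 a2] [b1 b2].
  assert (A1 := abs_summable_Re _ _ _ Hw Sa). assert (A2 := abs_summable_Im _ _ _ Hw Sa).
  assert (B1 := abs_summable_Re _ _ _ Hw Sb). assert (B2 := abs_summable_Im _ _ _ Hw Sb).
  assert (E : forall n, (cauchy_prod a b n * w ^ n)%C =
    Csum (fun k => ((a k * w ^ k) * (b (n - k)%nat * w ^ (n - k)))%C) n).
  { intros n. unfold cauchy_prod. rewrite Csum_mult_r. apply Csum_ext. intros k Hk.
    replace (w ^ n)%C with (w ^ k * w ^ (n - k))%C; [ring|].
    rewrite <- Cpow_add_r. f_equal. lia. }
  split.
  - apply (is_series_ext (fun n => sum_f_R0 (fun k => Re (a k * w ^ k)%C * Re (b (n - k)%nat * w ^ (n - k))%C) n -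
       sum_f_R0 (fun k => Im (a k * w ^ k)%C * Im (b (n - k)%nat * w ^ (n - k))%C) n)).
    + intros n. rewrite E, Csum_Re. symmetry.
      exact (minus_sum (fun k => Re (a k * w ^ k)%C * Re (b (n - k)%nat * w ^ (n - k))%C)
        (fun k => Im (a k * w ^ k)%C * Im (b (n - k)%nat * w ^ (n - k))%C) n).
    + apply (is_series_minus (fun n => sum_f_R0 (fun k => Re (a k * w ^ k)%C * Re (b (n - k)%nat * w ^ (n - k))%C) n)
        (fun n => sum_f_R0 (fun k => Im (a k * w ^ k)%C * Im (b (n - k)%nat * w ^ (n - k))%C) n)
        (Re la * Re lb) (Im la * Im lb)).
      * apply (is_series_mult (fun k => Re (a k * w ^ k)%C) (fun k => Re (b k * w ^ k)%C));
        eassumption.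
      * apply (is_series_mult (fun k => Im (a k * w ^ k)%C) (fun k => Im (b k * w ^ k)%C));
        eassumption.
  - apply (is_series_ext (fun n => sum_f_R0 (fun k => Re (a k * w ^ k)%C * Im (b (n - k)%nat * w ^ (n - k))%C) n +
       sum_f_R0 (fun k => Im (a k * w ^ k)%C * Re (b (n - k)%nat * w ^ (n - k))%C) n)).
    + intros n. rewrite E, Csum_Im. symmetry.
      exact (plus_sum (fun k => Re (a k * w ^ k)%C * Im (b (n - k)%nat * w ^ (n - k))%C)
        (fun k => Im (a k * w ^ k)%C * Re (b (n - k)%nat * w ^ (n - k))%C) n).
    + apply (is_series_plus (fun n => sum_f_R0 (fun k => Re (a k * w ^ k)%C * Im (b (n - k)%nat * w ^ (n - k))%C) n)
        (fun n => sum_f_R0 (fun k => Im (a k * w ^ k)%C * Re (b (n - k)%nat * w ^ (n - k))%C) n)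
        (Re la * Im lb) (Im la * Re lb)).
      * apply (is_series_mult (fun k => Re (a k * w ^ k)%C) (fun k => Im (b k * w ^ k)%C));
        eassumption.
      * apply (is_series_mult (fun k => Im (a k * w ^ k)%C) (fun k => Re (b k * w ^ k)%C));
        eassumption.
Qed.

Definition expansion (f : C -> C) (a : C) (c : nat -> C) (rho : R) : Prop :=
  0 < rho /\ abs_summable c rho /\
  forall s, 0 < Cmod (s - a) < rho -> is_Cpseries c (s - a)%C (f s).

Lemma expansion_ext (f g : C -> C) (a : C) (c : nat -> C) (rho : R) :
  (forall s, 0 < Cmod (s - a) < rho -> f s = g s) ->
  expansion f a c rho -> expansion g a c rho.
Proof.
  intros E [H1 [H2 H3]]. repeat split; try assumption.
  intros s Hs. rewrite <- E by exact Hs. now apply H3.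
Qed.

Lemma expansion_shrink (f : C -> C) (a : C) (c : nat -> C) (rho rho' : R) :
  0 < rho' <= rho -> expansion f a c rho -> expansion f a c rho'.
Proof.
  intros Hr [H1 [H2 H3]]. repeat split; [lra| |].
  - apply (abs_summable_le c rho); [lra|exact H2].
  - intros s Hs. apply H3. lra.
Qed.

Lemma expansion_mult (f g : C -> C) (a : C) (c d : nat -> C) (rho rho' : R) :
  expansion f a c rho -> expansion g a d rho' ->
  expansion (fun s => (f s * g s)%C) a (cauchy_prod c d) (Rmin rho rho').
Proof.
  intros Hf Hg.
  assert (H0 : 0 < Rmin rho rho') by (apply Rmin_pos; [apply Hf|apply Hg]).
  apply (expansion_shrink _ _ _ _ (Rmin rho rho')) in Hf; [|split; [exact H0|apply Rmin_l]].
  apply (expansion_shrink _ _ _ _ (Rmin rho rho')) in Hg; [|split; [exact H0|apply Rmin_r]].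
  destruct Hf as [_ [F2 F3]]. destruct Hg as [_ [G2 G3]].
  repeat split; [exact H0|apply abs_summable_cauchy_prod; try assumption; lra|].
  intros s Hs. apply (is_Cpseries_mult c d (Rmin rho rho')); auto; lra.
Qed.

Lemma expansion_laurent (f : C -> C) (a : C) (m : nat) (c : nat -> C) (rho : R) :
  expansion (fun s => ((s - a) ^ m * f s)%C) a c rho -> is_laurent f a m c.
Proof. intros [H1 [_ H3]]. exists (mkposreal rho H1). exact H3. Qed.

Lemma is_series_bounded (u : nat -> R) : ex_series u -> exists K, forall n, Rabs (u n) <= K.
Proof.
  intros H. apply ex_series_lim_0 in H.
  apply is_lim_seq_Reals in H.
  destruct (maj_by_pos u (exist _ 0 H)) as [K [_ HK]]. exists K. exact HK.
Qed.

Lemma laurent_expansion (f : C -> C) (a : C) (m : nat) (c : nat -> C) :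
  is_laurent f a m c ->
  exists rho, expansion (fun s => ((s - a) ^ m * f s)%C) a c rho.
Proof.
  intros [delta H]. set (t := delta / 2). assert (Ht : 0 < t < delta).
  { unfold t. generalize (cond_pos delta). lra. }
  assert (E : ((a + RtoC t) - a)%C = RtoC t) by ring.
  assert (M : Cmod (RtoC t) = t) by (rewrite Cmod_R, Rabs_right; lra).
  specialize (H (a + RtoC t)%C) as Ht'. rewrite E, M in Ht'. specialize (Ht' Ht).
  rewrite is_Cpseries_series, is_Cseries_components in Ht'. destruct Ht' as [h1 h2].
  destruct (is_series_bounded _ (ex_intro _ _ h1)) as [K1 HK1].
  destruct (is_series_bounded _ (ex_intro _ _ h2)) as [K2 HK2].
  exists (t / 2). repeat split; [lra| |].
  - apply (abs_summable_geom c (K1 + K2) t); [lra|].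
    intros n. replace (Cmod (c n) * t ^ n) with (Cmod (c n * RtoC t ^ n)%C)
      by (rewrite Cmod_mult, Cmod_pow, M; reflexivity).
    eapply Rle_trans; [apply Cmod_le_sum|]. apply Rplus_le_compat; auto.
  - intros s Hs. apply H. lra.
Qed.

Definition cexp (z : C) : C := (exp (Re z) * cos (Im z), exp (Re z) * sin (Im z)).

Lemma cexp_plus (z w : C) : cexp (z + w) = (cexp z * cexp w)%C.
Proof.
  unfold cexp. destruct z as [x y], w as [x' y']. simpl.
  rewrite exp_plus, cos_plus, sin_plus. apply injective_projections; simpl; ring.
Qed.

Lemma cexp_taylor (z : C) (n : nat) :
  forall t, 0 <= t <= 1 ->
  let L := Rabs (Re z) + Rabs (Im z) in
  let B := exp (Rabs (Re z)) * (L * t) ^ n / INR (fact n) in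
  Rabs (exp (Re z * t) * cos (Im z * t)
    - match n with O => 0 | S m => sum_f_R0 (fun k => Re (z ^ k)%C * t ^ k / INR (fact k)) m end)
    <= B /\
  Rabs (exp (Re z * t) * sin (Im z * t)
    - match n with O => 0 | S m => sum_f_R0 (fun k => Im (z ^ k)%C * t ^ k / INR (fact k)) m end)
    <= B.
Proof.
  set (x := Re z). set (y := Im z). set (L := Rabs x + Rabs y).
  assert (Lx := Rabs_pos x). assert (Ly := Rabs_pos y).
  assert (zS : forall k, Re (z ^ S k)%C = x * Re (z ^ k)%C - y * Im (z ^ k)%C
    /\ Im (z ^ S k)%C = x * Im (z ^ k)%C + y * Re (z ^ k)%C) by (intros; split; reflexivity).
  set (Tr := fun n t => match n with O => 0
    | S m => sum_f_R0 (fun k => Re (z ^ k)%C * t ^ k / INR (fact k)) m end).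
  set (Ti := fun n t => match n with O => 0
    | S m => sum_f_R0 (fun k => Im (z ^ k)%C * t ^ k / INR (fact k)) m end).
  assert (mono : forall (al : nat -> R) k t,
    is_derive (fun t => al k * t ^ k / INR (fact k)) t
      (match k with O => 0 | S j => al (S j) * t ^ j / INR (fact j) end)).
  { intros al k t. auto_derive; [exact I|]. destruct k as [|j]; [simpl; field|].
    simpl pred. rewrite fact_simpl, mult_INR. field.
    split; [apply INR_fact_neq_0|apply not_0_INR; lia]. }
  assert (poly : forall (al : nat -> R) n t,
    is_derive (fun t => sum_f_R0 (fun k => al k * t ^ k / INR (fact k)) n) t
      (match n with O => 0 | S m => sum_f_R0 (fun k => al (S k) * t ^ k / INR (fact k)) m end)).
  { intros al N t. evar_last.
    - apply (is_derive_sum_f_R0 (fun k t => al k * t ^ k / INR (fact k))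
        (fun k t => match k with O => 0 | S j => al (S j) * t ^ j / INR (fact j) end)).
      intros j _. apply mono.
    - destruct N as [|N]; [reflexivity|]. rewrite decomp_sum by lia. simpl Nat.pred. ring. }
  assert (rec_r : forall n t, (match n with O => 0 | S m =>
    sum_f_R0 (fun k => Re (z ^ S k)%C * t ^ k / INR (fact k)) m end) = x * Tr n t - y * Ti n t).
  { intros [|m] t; unfold Tr, Ti; [ring|]. rewrite !scal_sum, <- minus_sum.
    apply sum_eq. intros j _. destruct (zS j) as [-> _]. unfold Rdiv. ring. }
  assert (rec_i : forall n t, (match n with O => 0 | S m =>
    sum_f_R0 (fun k => Im (z ^ S k)%C * t ^ k / INR (fact k)) m end) = x * Ti n t + y * Tr n t).
  { intros [|m] t; unfold Tr, Ti; [ring|]. rewrite !scal_sum, <- plus_sum.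
    apply sum_eq. intros j _. destruct (zS j) as [_ ->]. unfold Rdiv. ring. }
  induction n as [|n IH]; intros t Ht L0 B; unfold B, L0; clear B L0.
  - assert (exp (x * t) <= exp (Rabs x)).
    { assert (x * t <= Rabs x) by (generalize (Rle_abs x); nra).
      destruct H as [H|H]; [left; now apply exp_increasing|rewrite H; lra]. }
    assert (0 < exp (x * t)) by apply exp_pos.
    assert (Rabs (cos (y * t)) <= 1) by (apply Rabs_le, COS_bound).
    assert (Rabs (sin (y * t)) <= 1) by (apply Rabs_le, SIN_bound).
    simpl. replace (exp (Rabs x) * 1 / 1) with (exp (Rabs x)) by field.
    rewrite !Rminus_0_r, !Rabs_mult, (Rabs_right (exp (x * t))) by lra.
    split; rewrite <- (Rmult_1_r (exp (Rabs x))); apply Rmult_le_compat;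
      try apply Rabs_pos; lra.
  - set (M := exp (Rabs x)) in *.
    assert (HM : 0 < M) by apply exp_pos.
    set (h := fun t => M * (L * t) ^ S n / INR (fact (S n))).
    assert (Hh : forall t, is_derive h t (L * (M * (L * t) ^ n / INR (fact n)))).
    { intros u. unfold h.
      assert (Ef : INR (fact (S n)) = INR (S n) * INR (fact n))
        by (rewrite fact_simpl; apply mult_INR).
      rewrite Ef. assert (F1 := INR_fact_neq_0 n). assert (F2 := not_0_INR (S n) ltac:(lia)).
      evar_last.
      - apply (is_derive_ext (fun u => M / (INR (S n) * INR (fact n)) * (L * u) ^ S n)).
        { intros v. unfold Rdiv. simpl. ring. }
        apply is_derive_scal. apply (is_derive_pow (fun u => L * u) (S n) u L).
        evar_last; [apply is_derive_scal; apply @is_derive_id|]. apply Rmult_1_r.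
      - change (pred (S n)) with n. field. split; assumption. }
    assert (h0 : h 0 = 0) by (unfold h; rewrite Rmult_0_r, pow_i by lia; unfold Rdiv; ring).
    fold (h t).
    assert (bound : forall u p r0, 0 <= u <= t ->
      Rabs p <= M * (L * u) ^ n / INR (fact n) -> Rabs r0 <= M * (L * u) ^ n / INR (fact n) ->
      Rabs (x * p + y * r0) <= L * (M * (L * u) ^ n / INR (fact n))).
    { intros u p r0 Hu Hp Hr. eapply Rle_trans; [apply Rabs_triang|].
      rewrite !Rabs_mult. unfold L at 1. rewrite Rmult_plus_distr_r.
      apply Rplus_le_compat; apply Rmult_le_compat_l; assumption. }
    split.
    + set (F := fun t => exp (x * t) * cos (y * t)
        - sum_f_R0 (fun k => Re (z ^ k)%C * t ^ k / INR (fact k)) n).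
      replace (h t) with (h t - h 0) by (rewrite h0; ring).
      change (Rabs (F t) <= h t - h 0). replace (F t) with (F t - F 0).
      2:{ assert (S0 : sum_f_R0 (fun k => Re (z ^ k)%C * 0 ^ k / INR (fact k)) n = 1).
          { clear. induction n as [|n IH]; [simpl; field|].
            rewrite tech5, IH, pow_i by lia. unfold Rdiv. ring. }
          unfold F. rewrite S0, !Rmult_0_r, exp_0, cos_0. ring. }
      apply (abs_mvt F (fun t => x * (exp (x * t) * cos (y * t) - Tr n t)
        + - y * (exp (x * t) * sin (y * t) - Ti n t)) h
        (fun t => L * (M * (L * t) ^ n / INR (fact n)))); [lra| |auto|].
      * intros u Hu. unfold F. evar_last.
        -- apply @is_derive_minus; [|apply poly].
           auto_derive; [exact I|reflexivity].
        -- rewrite rec_r. unfold minus, plus, opp; simpl. ring.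
      * intros u Hu. destruct (IH u ltac:(lra)) as [i1 i2].
        replace (- y * (exp (x * u) * sin (y * u) - Ti n u))
          with (y * - (exp (x * u) * sin (y * u) - Ti n u)) by ring.
        apply bound; [exact Hu|exact i1|rewrite Rabs_Ropp; exact i2].
    + set (F := fun t => exp (x * t) * sin (y * t)
        - sum_f_R0 (fun k => Im (z ^ k)%C * t ^ k / INR (fact k)) n).
      replace (h t) with (h t - h 0) by (rewrite h0; ring).
      change (Rabs (F t) <= h t - h 0). replace (F t) with (F t - F 0).
      2:{ assert (S0 : sum_f_R0 (fun k => Im (z ^ k)%C * 0 ^ k / INR (fact k)) n = 0).
          { clear. induction n as [|n IH]; [simpl; field|].
            rewrite tech5, IH, pow_i by lia. unfold Rdiv. ring. }
          unfold F. rewrite S0, !Rmult_0_r, exp_0, sin_0. ring. }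
      apply (abs_mvt F (fun t => x * (exp (x * t) * sin (y * t) - Ti n t)
        + y * (exp (x * t) * cos (y * t) - Tr n t)) h
        (fun t => L * (M * (L * t) ^ n / INR (fact n)))); [lra| |auto|].
      * intros u Hu. unfold F. evar_last.
        -- apply @is_derive_minus; [|apply poly].
           auto_derive; [exact I|reflexivity].
        -- rewrite rec_i. unfold minus, plus, opp; simpl. ring.
      * intros u Hu. destruct (IH u ltac:(lra)) as [i1 i2].
        apply bound; [exact Hu|exact i2|exact i1].
Qed.

Lemma is_lim_seq_of_bound (u e : nat -> R) (l : R) :
  (forall n, Rabs (u n - l) <= e n) -> is_lim_seq e 0 -> is_lim_seq u l.
Proof.
  intros H He. apply (is_lim_seq_le_le (fun n => l - e n) u (fun n => l + e n)).
  - intros n. specialize (H n). apply Rabs_le_between in H. lra.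
  - replace (Finite l) with (Finite (l - 0)) by (f_equal; ring).
    apply is_lim_seq_minus'; [apply is_lim_seq_const|exact He].
  - replace (Finite l) with (Finite (l + 0)) by (f_equal; ring).
    apply is_lim_seq_plus'; [apply is_lim_seq_const|exact He].
Qed.

Lemma is_Cseries_cexp (z : C) :
  is_Cseries (fun k => (z ^ k * RtoC (/ INR (fact k)))%C) (cexp z).
Proof.
  set (L := Rabs (Re z) + Rabs (Im z)).
  assert (HL : is_lim_seq (fun n => exp (Rabs (Re z)) * (L * 1) ^ (S n) / INR (fact (S n))) 0).
  { apply (is_lim_seq_incr_1 (fun n => exp (Rabs (Re z)) * (L * 1) ^ n / INR (fact n))).
    apply (is_lim_seq_ext (fun n => exp (Rabs (Re z)) * (/ INR (fact n) * L ^ n))).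
    { intros n. rewrite Rmult_1_r. unfold Rdiv. ring. }
    replace (Finite 0) with (Rbar_mult (exp (Rabs (Re z))) 0) by (simpl; f_equal; ring).
    apply is_lim_seq_scal_l. apply ex_series_lim_0.
    exists (exp L).
    exact (proj1 (is_pseries_R (fun n => / INR (fact n)) L (exp L)) (is_exp_Reals L)). }
  apply is_Cseries_components. split.
  - apply is_lim_seq_of_bound with (2 := HL). intros n.
    destruct (cexp_taylor z (S n) 1 ltac:(lra)) as [B _]. rewrite !Rmult_1_r in B.
    rewrite sum_n_Reals, Rabs_minus_sym. rewrite !Rmult_1_r. unfold L.
    rewrite (sum_eq _ (fun k => Re (z ^ k * RtoC (/ INR (fact k)))%C)) in B;
      [exact B|].
    intros k _. rewrite pow1, Re_mult_R. field. apply INR_fact_neq_0.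
  - apply is_lim_seq_of_bound with (2 := HL). intros n.
    destruct (cexp_taylor z (S n) 1 ltac:(lra)) as [_ B]. rewrite !Rmult_1_r in B.
    rewrite sum_n_Reals, Rabs_minus_sym. rewrite !Rmult_1_r. unfold L.
    rewrite (sum_eq _ (fun k => Im (z ^ k * RtoC (/ INR (fact k)))%C)) in B;
      [exact B|].
    intros k _. rewrite pow1, Im_mult_R. field. apply INR_fact_neq_0.
Qed.

(** * Continuation of the zeta functions and the residue at 1 *)

Lemma Re_plus (z w : C) : Re (z + w)%C = Re z + Re w.
Proof. reflexivity. Qed.

Lemma Im_plus (z w : C) : Im (z + w)%C = Im z + Im w.
Proof. reflexivity. Qed.

Lemma cpow_cexp (t : R) (s : C) : cpow t s = cexp (s * RtoC (ln t)).
Proof. unfold cpow, cexp. rewrite Re_mult_R, Im_mult_R. reflexivity. Qed.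

Lemma cpow_plus (t : R) (s w : C) : cpow t (s + w) = (cpow t s * cpow t w)%C.
Proof. rewrite !cpow_cexp, <- cexp_plus. f_equal. ring. Qed.

Lemma Cmod_cpow (t : R) (s : C) : Cmod (cpow t s) = Rpower t (Re s).
Proof.
  unfold cpow, Cmod, Rpower. simpl fst; simpl snd.
  set (e := exp (Re s * ln t)). set (u := Im s * ln t).
  replace ((e * cos u) ^ 2 + (e * sin u) ^ 2) with (e ^ 2).
  - rewrite <- Rsqr_pow2. apply sqrt_Rsqr. left. apply exp_pos.
  - generalize (sin2_cos2 u). unfold Rsqr. intros H.
    replace ((e * cos u) ^ 2 + (e * sin u) ^ 2)
      with (e ^ 2 * (sin u * sin u + cos u * cos u)) by ring.
    rewrite H. ring.
Qed.

Lemma is_Cpseries_plus (c d : nat -> C) (w l m : C) :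
  is_Cpseries c w l -> is_Cpseries d w m ->
  is_Cpseries (fun k => (c k + d k)%C) w (l + m)%C.
Proof. apply (@is_pseries_plus C_AbsRing C_NormedModule). Qed.

Lemma is_Cpseries_scal (z : C) (c : nat -> C) (w l : C) :
  is_Cpseries c w l -> is_Cpseries (fun k => (z * c k)%C) w (z * l)%C.
Proof.
  apply (@is_pseries_scal C_AbsRing C_NormedModule). apply Cmult_comm.
Qed.

Definition shift1 (c : nat -> C) (k : nat) : C :=
  match k with O => RtoC 0 | S j => c j end.

Lemma is_Cpseries_shift1 (c : nat -> C) (w l : C) :
  is_Cpseries c w l -> is_Cpseries (shift1 c) w (w * l)%C.
Proof.
  intros H. apply (@is_pseries_incr_1 C_AbsRing C_NormedModule) in H.
  revert H. apply is_pseries_ext. intros [|n]; reflexivity.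
Qed.

Lemma is_Cpseries_0 (w : C) : is_Cpseries (fun _ => RtoC 0) w (RtoC 0).
Proof.
  apply is_Cpseries_series, is_Cseries_components.
  assert (H : forall u : nat -> R, (forall n, u n = 0) -> is_series u 0).
  { intros u Hu. apply (is_series_ext (fun _ => 0)); [auto|].
    apply (filterlim_ext (fun _ : nat => 0)); [|apply filterlim_const].
    intros n. symmetry. apply (sum_n_m_const_zero (G := R_AbelianGroup)). }
  split; apply H; intros n; simpl; ring.
Qed.

(** The coefficient of [(s - a) ^ k] in [t ^ (- s)]. *)
Definition dcoef (a : C) (t : R) (k : nat) : C :=
  (cpow t (- a) * RtoC ((- ln t) ^ k / INR (fact k)))%C.

Lemma is_Cpseries_dcoef (a w : C) (t : R) :
  is_Cpseries (dcoef a t) w (cpow t (- (a + w))).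
Proof.
  replace (- (a + w))%C with (- a + - w)%C by ring. rewrite cpow_plus.
  apply is_Cpseries_scal. rewrite cpow_cexp.
  assert (H := is_Cseries_cexp (- w * RtoC (ln t))). apply is_Cpseries_series.
  revert H. apply is_series_ext. intros n.
  replace (- w * RtoC (ln t))%C with (RtoC (- ln t) * w)%C by (rewrite RtoC_opp; ring).
  rewrite Cpow_mult_l, <- RtoC_pow. unfold Rdiv. rewrite RtoC_mult.
  as_C. ring.
Qed.

Lemma Cmod_dcoef (a : C) (rho t : R) (k : nat) : 0 < rho -> 1 <= t ->
  Cmod (dcoef a t k) <= Rpower t (rho - Re a) * (/ rho) ^ k.
Proof.
  intros Hr Ht. unfold dcoef. rewrite Cmod_mult, Cmod_cpow, Cmod_R.
  assert (Hl : 0 <= ln t) by (rewrite <- ln_1; apply ln_le; lra).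
  assert (E : Rabs ((- ln t) ^ k / INR (fact k)) <= Rpower t rho * (/ rho) ^ k).
  { unfold Rdiv. rewrite Rabs_mult, <- RPow_abs, Rabs_Ropp, (Rabs_right (ln t)) by lra.
    assert (F : 0 < INR (fact k)) by apply lt_0_INR, lt_O_fact.
    rewrite Rabs_right by (left; now apply Rinv_0_lt_compat).
    assert (T := pow_div_fact_le_exp (rho * ln t) k ltac:(nra)).
    fold (Rpower t rho) in T. rewrite Rpow_mult_distr in T.
    assert (Hp : 0 < rho ^ k) by now apply pow_lt.
    rewrite pow_inv. apply (Rmult_le_reg_r (rho ^ k)); [exact Hp|].
    rewrite (Rmult_assoc (Rpower t rho)), Rinv_l by lra. unfold Rdiv in T. lra. }
  replace (rho - Re a) with (- Re a + rho) by ring. rewrite Rpower_plus, Rmult_assoc.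
  apply Rmult_le_compat_l; [left; apply Rpower_pos|exact E].
Qed.

Lemma Cmod_shift1 (c : nat -> C) (rho B : R) : 0 < rho ->
  (forall k, Cmod (c k) <= B * (/ rho) ^ k) ->
  forall k, Cmod (shift1 c k) <= rho * B * (/ rho) ^ k.
Proof.
  intros Hr H k.
  assert (HB : 0 <= B).
  { generalize (H 0%nat) (Cmod_ge_0 (c 0%nat)). simpl. lra. }
  destruct k as [|k]; simpl.
  - rewrite Cmod_0. nra.
  - replace (rho * B * (/ rho * (/ rho) ^ k)) with (B * (/ rho) ^ k) by (field; lra). apply H.
Qed.

Definition Cis_derive (f : R -> C) (t : R) (l : C) : Prop :=
  is_derive (fun t => Re (f t)) t (Re l) /\ is_derive (fun t => Im (f t)) t (Im l).

Lemma Cis_derive_plus (f g : R -> C) (t : R) (l m : C) :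
  Cis_derive f t l -> Cis_derive g t m -> Cis_derive (fun t => (f t + g t)%C) t (l + m)%C.
Proof.
  intros [f1 f2] [g1 g2]. split.
  - apply (is_derive_plus (fun t => Re (f t)) (fun t => Re (g t))); assumption.
  - apply (is_derive_plus (fun t => Im (f t)) (fun t => Im (g t))); assumption.
Qed.

Lemma Cis_derive_scal (z : C) (f : R -> C) (t : R) (l : C) :
  Cis_derive f t l -> Cis_derive (fun t => (z * f t)%C) t (z * l)%C.
Proof.
  intros [f1 f2]. split.
  - apply (is_derive_minus (fun t => Re z * Re (f t)) (fun t => Im z * Im (f t)));
      apply is_derive_scal; assumption.
  - apply (is_derive_plus (fun t => Re z * Im (f t)) (fun t => Im z * Re (f t)));
      apply is_derive_scal; assumption.
Qed.

Lemma Cis_derive_mult_R (f : R -> C) (r : R -> R) (t : R) (l : C) (dr : R) :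
  Cis_derive f t l -> is_derive r t dr ->
  Cis_derive (fun t => (f t * RtoC (r t))%C) t (l * RtoC (r t) + f t * RtoC dr)%C.
Proof.
  intros [f1 f2] Hr. split.
  - apply (is_derive_ext (fun t => Re (f t) * r t)); [intros; symmetry; apply Re_mult_R|].
    evar_last.
    + apply (is_derive_mult (fun t => Re (f t)) r); [exact f1|exact Hr|intros; apply Rmult_comm].
    + rewrite Re_plus, !Re_mult_R. reflexivity.
  - apply (is_derive_ext (fun t => Im (f t) * r t)); [intros; symmetry; apply Im_mult_R|].
    evar_last.
    + apply (is_derive_mult (fun t => Im (f t)) r); [exact f2|exact Hr|intros; apply Rmult_comm].
    + rewrite Im_plus, !Im_mult_R. reflexivity.
Qed.

Lemma Cis_derive_cpow (s : C) (t : R) : 0 < t ->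
  Cis_derive (fun t => cpow t s) t (RtoC (/ t) * (s * cpow t s))%C.
Proof.
  intros Ht. unfold cpow. split; simpl.
  - auto_derive; [tauto|]. unfold Re, Im; simpl. ring.
  - auto_derive; [tauto|]. unfold Re, Im; simpl. ring.
Qed.

Lemma Cis_derive_dcoef (a : C) (t : R) (k : nat) : 0 < t ->
  Cis_derive (fun t => dcoef a t k) t
    (RtoC (- / t) * (a * dcoef a t k + shift1 (dcoef a t) k))%C.
Proof.
  intros Ht. unfold dcoef at 1.
  set (dr := match k with O => 0 | S j => - / t * ((- ln t) ^ j / INR (fact j)) end).
  assert (Hr : is_derive (fun t => (- ln t) ^ k / INR (fact k)) t dr).
  { unfold dr. unfold Rdiv.
    apply (is_derive_ext (fun t => / INR (fact k) * (- ln t) ^ k)); [intros; apply Rmult_comm|].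
    evar_last.
    - apply is_derive_scal. apply (is_derive_pow (fun t => - ln t) k t (- / t)).
      apply (is_derive_opp ln). now apply is_derive_ln.
    - destruct k as [|j]; [simpl; ring|].
      rewrite fact_simpl, mult_INR. simpl pred. field.
      repeat split; try apply INR_fact_neq_0; try (apply not_0_INR; lia); lra. }
  assert (H := Cis_derive_mult_R _ _ t _ _ (Cis_derive_cpow (- a) t Ht) Hr).
  cbv beta in H.
  replace (RtoC (- / t) * (a * dcoef a t k + shift1 (dcoef a t) k))%C
    with (RtoC (/ t) * (- a * cpow t (- a)) * RtoC ((- ln t) ^ k / INR (fact k))
      + cpow t (- a) * RtoC dr)%C; [exact H|].
  unfold dr, dcoef. rewrite RtoC_opp. destruct k as [|j]; simpl shift1.
  - ring.
  - rewrite (RtoC_mult (- / t)), RtoC_opp. ring.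
Qed.

Lemma Cis_derive_shift1_dcoef (a : C) (t : R) (k : nat) : 0 < t ->
  Cis_derive (fun t => shift1 (dcoef a t) k) t
    (RtoC (- / t) * (a * shift1 (dcoef a t) k + shift1 (shift1 (dcoef a t)) k))%C.
Proof.
  intros Ht. destruct k as [|k].
  - simpl. replace (RtoC (- / t) * (a * 0 + 0))%C with (RtoC 0) by ring.
    split; apply @is_derive_const.
  - now apply Cis_derive_dcoef.
Qed.

(** [gcoef] and [Gcoef] are the coefficients of [(s - 1) * t ^ (- s)] and of its
    primitive [- t ^ (1 - s)]. *)
Definition gcoef (a : C) (t : R) (k : nat) : C :=
  ((a - 1) * dcoef a t k + shift1 (dcoef a t) k)%C.

Definition Gcoef (a : C) (t : R) (k : nat) : C := (dcoef a t k * RtoC (- t))%C.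

Definition dgcoef (a : C) (t : R) (k : nat) : C :=
  (RtoC (- / t) * ((a - 1) * (a * dcoef a t k + shift1 (dcoef a t) k)
     + (a * shift1 (dcoef a t) k + shift1 (shift1 (dcoef a t)) k)))%C.

Lemma Cis_derive_gcoef (a : C) (t : R) (k : nat) : 0 < t ->
  Cis_derive (fun t => gcoef a t k) t (dgcoef a t k).
Proof.
  intros Ht. unfold gcoef.
  replace (dgcoef a t k) with
    ((a - 1) * (RtoC (- / t) * (a * dcoef a t k + shift1 (dcoef a t) k))
     + RtoC (- / t) * (a * shift1 (dcoef a t) k + shift1 (shift1 (dcoef a t)) k))%C
    by (unfold dgcoef; ring).
  apply Cis_derive_plus.
  - apply Cis_derive_scal, Cis_derive_dcoef, Ht.
  - apply Cis_derive_shift1_dcoef, Ht.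
Qed.

Lemma Cis_derive_Gcoef (a : C) (t : R) (k : nat) : 0 < t ->
  Cis_derive (fun t => Gcoef a t k) t (gcoef a t k).
Proof.
  intros Ht. unfold Gcoef.
  assert (H := Cis_derive_mult_R _ (fun t => - t) t _ (- 1) (Cis_derive_dcoef a t k Ht)).
  cbv beta in H.
  replace (gcoef a t k) with
    (RtoC (- / t) * (a * dcoef a t k + shift1 (dcoef a t) k) * RtoC (- t)
     + dcoef a t k * RtoC (- 1))%C.
  - apply H. auto_derive; [exact I|ring].
  - unfold gcoef.
    replace (RtoC (- / t) * (a * dcoef a t k + shift1 (dcoef a t) k) * RtoC (- t))%C
      with (RtoC (- / t * - t) * (a * dcoef a t k + shift1 (dcoef a t) k))%C
      by (rewrite RtoC_mult; ring).
    replace (- / t * - t) with 1 by (field; lra).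
    replace (RtoC (- 1)) with (- RtoC 1)%C by (apply injective_projections; simpl; ring).
    ring.
Qed.

Lemma Cmod_dgcoef (a : C) (rho t : R) (k : nat) : 0 < rho -> 1 <= t ->
  Cmod (dgcoef a t k) <=
  ((Cmod (a - 1) + rho) * (Cmod a + rho)) * (/ rho) ^ k * Rpower t (- (Re a - rho) - 1).
Proof.
  intros Hr Ht.
  set (B := Rpower t (rho - Re a)).
  assert (b0 := fun k => Cmod_dcoef a rho t k Hr Ht). fold B in b0.
  assert (b1 := Cmod_shift1 _ _ _ Hr b0). assert (b2 := Cmod_shift1 _ _ _ Hr b1).
  specialize (b0 k). specialize (b1 k). specialize (b2 k).
  set (z0 := dcoef a t k) in *. set (z1 := shift1 (dcoef a t) k) in *.
  set (z2 := shift1 (shift1 (dcoef a t)) k) in *. set (p := (/ rho) ^ k) in *.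
  assert (h : forall u v, Cmod (a * u + v) <= Cmod a * Cmod u + Cmod v).
  { intros. eapply Rle_trans; [apply Cmod_triangle|]. rewrite Cmod_mult. lra. }
  assert (A0 := Cmod_ge_0 a). assert (A1 := Cmod_ge_0 (a - 1)).
  assert (k0 : Cmod (a * z0 + z1) <= (Cmod a + rho) * (B * p)).
  { eapply Rle_trans; [apply h|]. nra. }
  assert (k1 : Cmod (a * z1 + z2) <= (Cmod a + rho) * (rho * B * p)).
  { eapply Rle_trans; [apply h|]. nra. }
  unfold dgcoef. fold z0 z1 z2.
  rewrite Cmod_mult, Cmod_R, Rabs_Ropp, Rabs_right
    by (left; apply Rinv_0_lt_compat; lra).
  replace (Rpower t (- (Re a - rho) - 1)) with (/ t * B).
  2:{ unfold B. replace (- (Re a - rho) - 1) with (- (1) + (rho - Re a)) by ring.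
      rewrite Rpower_plus, Rpower_Ropp, Rpower_1 by lra. reflexivity. }
  replace ((Cmod (a - 1) + rho) * (Cmod a + rho) * p * (/ t * B))
    with (/ t * (Cmod (a - 1) * ((Cmod a + rho) * (B * p)) + (Cmod a + rho) * (rho * B * p)))
    by ring.
  apply Rmult_le_compat_l; [left; apply Rinv_0_lt_compat; lra|].
  eapply Rle_trans; [apply Cmod_triangle|]. rewrite Cmod_mult.
  apply Rplus_le_compat; [|exact k1]. apply Rmult_le_compat_l; assumption.
Qed.

Fixpoint Capsum (r q : nat) (f : nat -> C) (n : nat) : C :=
  match n with
  | O => RtoC 0
  | S m => (Capsum r q f m + RtoC (chi r q (S m)) * f (S m))%C
  end.

Lemma Capsum_Re (r q : nat) (f : nat -> C) (n : nat) :
  Re (Capsum r q f n) = apsum r q (fun j => Re (f j)) n.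
Proof.
  induction n as [|n IH]; [reflexivity|]. unfold apsum in *. cbn [psum Capsum].
  rewrite <- IH, Cmult_comm. rewrite Re_plus, Re_mult_R. ring.
Qed.

Lemma Capsum_Im (r q : nat) (f : nat -> C) (n : nat) :
  Im (Capsum r q f n) = apsum r q (fun j => Im (f j)) n.
Proof.
  induction n as [|n IH]; [reflexivity|]. unfold apsum in *. cbn [psum Capsum].
  rewrite <- IH, Cmult_comm. rewrite Im_plus, Im_mult_R. ring.
Qed.

Lemma Capsum_scal (r q : nat) (z : C) (f : nat -> C) (n : nat) :
  Capsum r q (fun j => (z * f j)%C) n = (z * Capsum r q f n)%C.
Proof. induction n as [|n IH]; cbn [Capsum]; [ring|rewrite IH; ring]. Qed.

(** A sum over the progression, corrected as in [em_first_order]. *)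
Definition em_sum (r q : nat) (g P : R -> C) (n : nat) : C :=
  (Capsum r q (fun j => g (INR j)) n
   + (RtoC (- / INR q) * P (INR n)
      + RtoC (- (cnt r q n - INR n / INR q)) * g (INR n)))%C.

Lemma em_sum_limit (r q : nat) (g g1 P : R -> C) (K eta : R) :
  (1 <= r <= q)%nat -> 0 < eta -> 0 <= K ->
  (forall t, 1 <= t -> Cis_derive P t (g t)) ->
  (forall t, 1 <= t -> Cis_derive g t (g1 t)) ->
  (forall t, 1 <= t -> Cmod (g1 t) <= K * Rpower t (- eta - 1)) ->
  exists c, forall n, (1 <= n)%nat ->
    Cmod (em_sum r q g P n - c) <= 2 * K / eta * Rpower (INR n) (- eta).
Proof.
  intros H He HK HP Hg Hb.
  assert (Hq : INR q <> 0) by (apply not_0_INR; lia).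
  destruct (em_first_order r q (fun t => Re (g t)) (fun t => Re (g1 t)) (fun t => Re (P t)) K eta)
    as [x Hx]; try assumption.
  - intros; now apply HP.
  - intros; now apply Hg.
  - intros. eapply Rle_trans; [apply re_le_Cmod|auto].
  - destruct (em_first_order r q (fun t => Im (g t)) (fun t => Im (g1 t)) (fun t => Im (P t)) K eta)
      as [y Hy]; try assumption.
    + intros; now apply HP.
    + intros; now apply Hg.
    + intros. eapply Rle_trans; [apply Im_le_Cmod|auto].
    + exists (x, y). intros n Hn.
      assert (Hn1 : 1 <= INR n) by (change 1 with (INR 1); now apply le_INR).
      specialize (Hx _ Hn1). specialize (Hy _ Hn1). rewrite fl_INR in Hx, Hy.
      eapply Rle_trans; [apply Cmod_le_sum|].
      replace (2 * K / eta * Rpower (INR n) (- eta)) with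
        (K / eta * Rpower (INR n) (- eta) + K / eta * Rpower (INR n) (- eta)) by (field; lra).
      apply Rplus_le_compat; eapply Rle_trans; [|exact Hx| |exact Hy]; right; f_equal;
        unfold em_sum.
      * rewrite !(Cmult_comm (RtoC _)). unfold Cminus.
        rewrite !Re_plus, !Re_mult_R, Capsum_Re.
        simpl. field. exact Hq.
      * rewrite !(Cmult_comm (RtoC _)). unfold Cminus.
        rewrite !Im_plus, !Im_mult_R, Capsum_Im.
        simpl. field. exact Hq.
Qed.

Lemma is_Cpseries_em_sum (r q n : nat) (g P : R -> nat -> C) (G Q : R -> C) (w : C) :
  (forall t, is_Cpseries (g t) w (G t)) -> (forall t, is_Cpseries (P t) w (Q t)) ->
  is_Cpseries (fun k => em_sum r q (fun t => g t k) (fun t => P t k) n) w (em_sum r q G Q n).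
Proof.
  intros Hg HP. unfold em_sum.
  apply is_Cpseries_plus; [|apply is_Cpseries_plus; apply is_Cpseries_scal; auto].
  induction n as [|n IH]; cbn [Capsum]; [apply is_Cpseries_0|].
  apply is_Cpseries_plus; [exact IH|]. apply is_Cpseries_scal, Hg.
Qed.

Lemma is_series_abs_le (u v : nat -> R) (l L : R) :
  (forall n, Rabs (u n) <= v n) -> is_series u l -> is_series v L -> Rabs l <= L.
Proof.
  intros H Hu Hv.
  assert (HA : ex_series (fun n => Rabs (u n))).
  { apply (ex_series_le_abs u v H). now exists L. }
  rewrite <- (is_series_unique _ _ Hu), <- (is_series_unique _ _ Hv).
  eapply Rle_trans; [now apply Series_Rabs|]. apply Series_le; [|now exists L].
  intros n. split; [apply Rabs_pos|apply H].
Qed.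

Lemma is_Cpseries_bound (c : nat -> C) (w l : C) (B rho : R) : 0 < rho -> Cmod w < rho ->
  (forall k, Cmod (c k) <= B * (/ rho) ^ k) -> is_Cpseries c w l ->
  Cmod l <= 2 * B / (1 - Cmod w / rho).
Proof.
  intros Hr Hw Hc H. rewrite is_Cpseries_series, is_Cseries_components in H.
  destruct H as [h1 h2].
  assert (Hx : 0 <= Cmod w / rho < 1).
  { split; [apply Rdiv_le_0_compat; [apply Cmod_ge_0|lra]|]. apply (Rdiv_lt_1 _ rho); lra. }
  assert (G : is_series (fun k => B * (Cmod w / rho) ^ k) (B * / (1 - Cmod w / rho))).
  { apply (is_series_scal B (fun k => (Cmod w / rho) ^ k)). apply is_series_geom.
    rewrite Rabs_right; lra. }
  assert (T : forall k, Cmod (c k * w ^ k)%C <= B * (Cmod w / rho) ^ k).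
  { intros k. rewrite Cmod_mult, Cmod_pow. unfold Rdiv. rewrite Rpow_mult_distr.
    replace (B * (Cmod w ^ k * (/ rho) ^ k)) with (B * (/ rho) ^ k * Cmod w ^ k) by ring.
    apply Rmult_le_compat_r; [apply pow_le, Cmod_ge_0|apply Hc]. }
  eapply Rle_trans; [apply Cmod_le_sum|].
  replace (2 * B / (1 - Cmod w / rho)) with
    (B * / (1 - Cmod w / rho) + B * / (1 - Cmod w / rho)) by (field; lra).
  apply Rplus_le_compat.
  - apply (is_series_abs_le _ _ _ _ (fun k => Rle_trans _ _ _ (re_le_Cmod _) (T k)) h1 G).
  - apply (is_series_abs_le _ _ _ _ (fun k => Rle_trans _ _ _ (Im_le_Cmod _) (T k)) h2 G).
Qed.

Lemma is_lim_seq_Rpower (B eta : R) : 0 < eta ->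
  is_lim_seq (fun n => B * Rpower (INR n) (- eta)) 0.
Proof.
  intros He.
  assert (H : is_lim (fun y => B * Rpower y (- eta)) p_infty 0).
  { apply (bigO_is_lim eta 0 (fun y => B * Rpower y (- eta))); [exact He| |reflexivity].
    apply (bigO_ext _ (fun y => B * Rpower y (- eta))); [intros; ring|].
    apply bigO_scal. exists 1. split; [lra|]. intros y Hy.
    rewrite Rabs_right; [lra|left; apply Rpower_pos]. }
  apply (is_lim_comp_seq _ INR p_infty 0 H).
  - exists 0%nat. intros n _. discriminate.
  - apply is_lim_seq_INR.
Qed.

Definition Clim (u : nat -> C) : C :=
  (real (Lim_seq (fun n => Re (u n))), real (Lim_seq (fun n => Im (u n)))).

Lemma is_lim_seq_Cmod_bound (u : nat -> C) (l : C) (B eta : R) : 0 < eta ->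
  (forall n, (1 <= n)%nat -> Cmod (u n - l) <= B * Rpower (INR n) (- eta)) ->
  is_lim_seq (fun n => Re (u n)) (Re l) /\ is_lim_seq (fun n => Im (u n)) (Im l).
Proof.
  intros He H.
  assert (L := is_lim_seq_Rpower B eta He). apply is_lim_seq_incr_1 in L.
  split; apply is_lim_seq_incr_1; apply is_lim_seq_of_bound with (2 := L); intros n;
    (eapply Rle_trans; [|apply H; lia]).
  - apply (re_le_Cmod (u (S n) - l)).
  - apply (Im_le_Cmod (u (S n) - l)).
Qed.

Lemma Clim_unique (u : nat -> C) (l : C) (B eta : R) : 0 < eta ->
  (forall n, (1 <= n)%nat -> Cmod (u n - l) <= B * Rpower (INR n) (- eta)) -> Clim u = l.
Proof.
  intros He H. destruct (is_lim_seq_Cmod_bound u l B eta He H) as [h1 h2].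
  unfold Clim. rewrite (is_lim_seq_unique _ _ h1), (is_lim_seq_unique _ _ h2).
  destruct l; reflexivity.
Qed.

(** [(s - 1) zeta (s; r, q)], continued to [Re s > 0]. *)
Definition reg_zeta (r q : nat) (s : C) : C :=
  Clim (em_sum r q (fun t => ((s - 1) * cpow t (- s))%C) (fun t => (RtoC (- t) * cpow t (- s))%C)).

Lemma reg_zeta_expansion (r q : nat) (a : C) : (1 <= r <= q)%nat -> 0 < Re a ->
  exists c B, abs_summable c (Re a / 4) /\
    (forall k n, (1 <= n)%nat ->
       Cmod (em_sum r q (fun t => gcoef a t k) (fun t => Gcoef a t k) n - c k)
       <= B * (/ (Re a / 2)) ^ k * Rpower (INR n) (- (Re a / 2))) /\
    forall s, Cmod (s - a) < Re a / 2 ->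
      is_Cpseries c (s - a)%C (reg_zeta r q s) /\
      exists B', forall n, (1 <= n)%nat ->
        Cmod (em_sum r q (fun t => ((s - 1) * cpow t (- s))%C)
                (fun t => (RtoC (- t) * cpow t (- s))%C) n - reg_zeta r q s)
        <= B' * Rpower (INR n) (- (Re a / 2)).
Proof.
  intros H Ha. set (rho := Re a / 2). assert (Hr : 0 < rho) by (unfold rho; lra).
  set (M := (Cmod (a - 1) + rho) * (Cmod a + rho)).
  assert (A0 := Cmod_ge_0 a). assert (A1 := Cmod_ge_0 (a - 1)).
  assert (HM : 0 <= M) by (unfold M; nra).
  set (v := fun n k => em_sum r q (fun t => gcoef a t k) (fun t => Gcoef a t k) n).
  set (B := 2 * M / rho).
  assert (HB : 0 <= B) by (apply Rdiv_le_0_compat; lra).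
  assert (Hp : forall k, 0 < (/ rho) ^ k) by (intros; apply pow_lt, Rinv_0_lt_compat, Hr).
  assert (Hex : forall k, exists c, forall n, (1 <= n)%nat ->
    Cmod (v n k - c) <= B * (/ rho) ^ k * Rpower (INR n) (- rho)).
  { intros k. destruct (em_sum_limit r q (fun t => gcoef a t k) (fun t => dgcoef a t k)
      (fun t => Gcoef a t k) (M * (/ rho) ^ k) rho) as [c Hc]; try assumption.
    - generalize (Hp k). nra.
    - intros; apply Cis_derive_Gcoef; lra.
    - intros; apply Cis_derive_gcoef; lra.
    - intros t Ht. generalize (Cmod_dgcoef a rho t k Hr Ht).
      replace (- (Re a - rho)) with (- rho) by (unfold rho; field). exact (fun h => h).
    - exists c. intros n Hn. eapply Rle_trans; [apply Hc, Hn|]. right. unfold B. field. lra. }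
  set (c := fun k => proj1_sig (constructive_indefinite_description _ (Hex k))).
  assert (Hc : forall k n, (1 <= n)%nat ->
    Cmod (v n k - c k) <= B * (/ rho) ^ k * Rpower (INR n) (- rho)).
  { intros k. exact (proj2_sig (constructive_indefinite_description _ (Hex k))). }
  clearbody c.
  assert (Hq : 1 <= INR q) by (change 1 with (INR 1); apply le_INR; lia).
  assert (v1 : forall k, Cmod (v 1%nat k) <= (1 + 2 * (Cmod (a - 1) + rho)) * (/ rho) ^ k).
  { intros k.
    assert (b0 := fun k => Cmod_dcoef a rho 1 k Hr (Rle_refl 1)).
    rewrite Rpower_1_l in b0. assert (b1 := Cmod_shift1 _ _ _ Hr b0).
    specialize (b0 k). specialize (b1 k). rewrite Rmult_1_l in b0. rewrite Rmult_1_r in b1.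
    assert (bg : Cmod (gcoef a 1 k) <= (Cmod (a - 1) + rho) * (/ rho) ^ k).
    { unfold gcoef. eapply Rle_trans; [apply Cmod_triangle|]. rewrite Cmod_mult. nra. }
    assert (bG : Cmod (Gcoef a 1 k) <= (/ rho) ^ k).
    { unfold Gcoef. rewrite Cmod_mult, Cmod_R, Rabs_Ropp, Rabs_R1. lra. }
    unfold v, em_sum. cbn [Capsum]. change (INR 1) with 1.
    eapply Rle_trans; [apply Cmod_triangle|].
    eapply Rle_trans; [apply Rplus_le_compat; [apply Cmod_triangle|apply Cmod_triangle]|].
    rewrite !Cmod_mult, Cmod_0, !Cmod_R.
    assert (0 < / INR q <= 1).
    { split; [apply Rinv_0_lt_compat; lra|]. rewrite <- Rinv_1. apply Rinv_le_contravar; lra. }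
    assert (X := chi_bounds r q 1).
    assert (c1 : Rabs (chi r q 1) <= 1) by (apply Rabs_le; lra).
    assert (c2 : Rabs (- / INR q) <= 1) by (apply Rabs_le; lra).
    assert (c3 : Rabs (- (cnt r q 1 - 1 / INR q)) <= 1).
    { unfold cnt. cbn [psum]. unfold Rdiv. apply Rabs_le. lra. }
    assert (mono : forall x y z, 0 <= y -> Rabs x <= 1 -> y <= z -> Rabs x * y <= z).
    { intros x y z Hy0 Hx0 Hyz. generalize (Rabs_pos x). nra. }
    assert (m1 := mono _ _ _ (Cmod_ge_0 _) c1 bg). assert (m2 := mono _ _ _ (Cmod_ge_0 _) c2 bG).
    assert (m3 := mono _ _ _ (Cmod_ge_0 _) c3 bg). lra. }
  assert (cK : forall k, Cmod (c k) * rho ^ k <= (1 + 2 * (Cmod (a - 1) + rho)) + B).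
  { intros k. assert (E : c k = (v 1%nat k + - (v 1%nat k - c k))%C) by ring.
    assert (Ck : Cmod (c k) <= ((1 + 2 * (Cmod (a - 1) + rho)) + B) * (/ rho) ^ k).
    { rewrite E at 1. eapply Rle_trans; [apply Cmod_triangle|]. rewrite Cmod_opp.
      generalize (Hc k 1%nat ltac:(lia)) (v1 k). change (INR 1) with 1. rewrite Rpower_1_l. lra. }
    assert (P0 : 0 < rho ^ k) by now apply pow_lt.
    apply (Rmult_le_compat_r (rho ^ k)) in Ck; [|lra].
    rewrite Rmult_assoc, pow_inv, Rinv_l, Rmult_1_r in Ck by lra. exact Ck. }
  exists c, B. split; [|split].
  - refine (abs_summable_geom c _ rho _ _ cK). unfold rho. lra.
  - exact Hc.
  - intros s Hs.
    set (w := (s - a)%C) in *. assert (Es : s = (a + w)%C) by (unfold w; ring).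
    set (V := em_sum r q (fun t => ((s - 1) * cpow t (- s))%C)
      (fun t => (RtoC (- t) * cpow t (- s))%C)).
    assert (HV : forall n, is_Cpseries (v n) w (V n)).
    { intros n. apply is_Cpseries_em_sum; intros t.
      - assert (D := is_Cpseries_dcoef a w t). rewrite <- Es in D.
        replace ((s - 1) * cpow t (- s))%C
          with ((a - 1) * cpow t (- s) + w * cpow t (- s))%C by (rewrite Es; ring).
        apply is_Cpseries_plus; [now apply is_Cpseries_scal|now apply is_Cpseries_shift1].
      - assert (D := is_Cpseries_dcoef a w t). rewrite <- Es in D.
        apply (is_Cpseries_scal (RtoC (- t))) in D. revert D.
        apply is_pseries_ext. intros k. apply Cmult_comm. }
    destruct (abs_summable_ex c (Cmod w) w (Rle_refl _)) as [l Hl].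
    { apply (abs_summable_geom c _ rho _ (conj (Cmod_ge_0 _) Hs) cK). }
    set (B' := 2 * B / (1 - Cmod w / rho)).
    assert (HL : forall n, (1 <= n)%nat -> Cmod (V n - l) <= B' * Rpower (INR n) (- rho)).
    { intros n Hn.
      assert (HD : is_Cpseries (fun k => (v n k + -1 * c k)%C) w (V n + -1 * l)%C).
      { apply is_Cpseries_plus; [apply HV|]. now apply is_Cpseries_scal. }
      apply (is_Cpseries_bound _ _ _ (B * Rpower (INR n) (- rho)) rho Hr Hs) in HD.
      - replace (V n - l)%C with (V n + -1 * l)%C by ring.
        eapply Rle_trans; [exact HD|]. right. unfold B', Rdiv. ring.
      - intros k. replace (v n k + -1 * c k)%C with (v n k - c k)%C by ring.
        eapply Rle_trans; [apply Hc, Hn|]. right. ring. }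
    assert (EW : reg_zeta r q s = l) by exact (Clim_unique V l B' rho Hr HL).
    rewrite EW. split; [exact Hl|]. exists B'. exact HL.
Qed.

Lemma RtoC_sub_neq (s a : C) : s <> a -> (s - a)%C <> RtoC 0.
Proof. intros H E. apply H. replace s with ((s - a) + a)%C by ring. rewrite E. ring. Qed.

Lemma Cpow_S (z : C) (n : nat) : (z ^ S n)%C = (z * z ^ n)%C.
Proof. reflexivity. Qed.

Lemma is_Cpseries_geom (w : C) : Cmod w < 1 ->
  is_Cpseries (fun n => ((-1) ^ n)%C) w (/ (1 + w))%C.
Proof.
  intros Hw. apply is_Cpseries_series.
  assert (H1 : (1 + w)%C <> RtoC 0).
  { intros E. assert (w = (- (1))%C).
    { replace w with ((1 + w) - 1)%C by ring. rewrite E. ring. }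
    subst w. rewrite Cmod_m1 in Hw. lra. }
  assert (E : forall n, @sum_n C_AbelianMonoid (fun n => ((-1) ^ n * w ^ n)%C) n
     = (/ (1 + w) * (1 - (- w) ^ S n))%C).
  { induction n as [|n IH].
    - rewrite sum_O. as_C.
      simpl. field. exact H1.
    - rewrite sum_Sn, IH. as_C.
      change (plus ?u ?v) with (u + v)%C.
      replace ((-1) ^ S n * w ^ S n)%C with ((- w) ^ S n)%C.
      + rewrite (Cpow_S _ (S n)). field. exact H1.
      + replace (- w)%C with (-1 * w)%C by (apply injective_projections; simpl; ring).
        apply Cpow_mult_l. }
  assert (H0 : 0 <= Cmod w) by apply Cmod_ge_0.
  assert (L : is_lim_seq (fun n => / Cmod (1 + w) * Cmod w ^ S n) 0).
  { replace (Finite 0) with (Rbar_mult (/ Cmod (1 + w)) 0) by (simpl; f_equal; ring).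
    apply is_lim_seq_scal_l. apply (is_lim_seq_incr_1 (fun n => Cmod w ^ n)).
    apply is_lim_seq_geom. rewrite Rabs_right; lra. }
  assert (D : forall n, (@sum_n C_AbelianMonoid (fun n => ((-1) ^ n * w ^ n)%C) n - / (1 + w))%C
     = (- (/ (1 + w) * (- w) ^ S n))%C).
  { intros n. rewrite E. field. exact H1. }
  assert (M : forall n, Cmod (@sum_n C_AbelianMonoid (fun n => ((-1) ^ n * w ^ n)%C) n - / (1 + w))
     <= / Cmod (1 + w) * Cmod w ^ S n).
  { intros n. rewrite D, Cmod_opp, Cmod_mult, Cmod_pow, Cmod_opp, Cmod_inv by exact H1.
    apply Rle_refl. }
  apply is_Cseries_components. split; apply is_lim_seq_of_bound with (2 := L); intros n.
  - rewrite <- sum_n_Re. eapply Rle_trans; [|apply M]. apply (re_le_Cmod (_ - _)).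
  - rewrite <- sum_n_Im. eapply Rle_trans; [|apply M]. apply (Im_le_Cmod (_ - _)).
Qed.

Definition inv_coef (d : C) (k : nat) : C := (/ d * (- / d) ^ k)%C.

Lemma expansion_inv (p a : C) : a <> p ->
  expansion (fun s => / (s - p))%C a (inv_coef (a - p)) (Cmod (a - p) / 2).
Proof.
  intros Hap. set (d := (a - p)%C). assert (Hd : d <> RtoC 0) by now apply RtoC_sub_neq.
  assert (Hd0 : 0 < Cmod d) by now apply Cmod_gt_0.
  split; [lra|]. split.
  - apply (abs_summable_geom _ (/ Cmod d) (Cmod d)); [lra|].
    intros n. unfold inv_coef.
    rewrite Cmod_mult, Cmod_pow, Cmod_opp, !Cmod_inv, pow_inv by exact Hd.
    assert (0 < Cmod d ^ n) by now apply pow_lt. right. field. lra.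
  - intros s Hs. set (w := (s - a)%C) in *.
    assert (Hw : Cmod (w / d) < 1).
    { rewrite Cmod_div by exact Hd. apply (Rdiv_lt_1 _ (Cmod d)); lra. }
    assert (G := is_Cpseries_geom (w / d) Hw). rewrite is_Cpseries_series in G.
    assert (E : (s - p)%C = (d * (1 + w / d))%C).
    { unfold w, d. field. now apply RtoC_sub_neq. }
    assert (H1 : (1 + w / d)%C <> RtoC 0).
    { intros Z. assert (X : (w / d)%C = (- (1))%C).
      { replace (w / d)%C with ((1 + w / d) - 1)%C by ring. rewrite Z. ring. }
      rewrite X, Cmod_m1 in Hw. lra. }
    rewrite E. replace (/ (d * (1 + w / d)))%C with (/ d * / (1 + w / d))%C
      by (revert H1; generalize (1 + w / d)%C; intros x Hx; field; split; assumption).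
    apply is_Cpseries_scal. apply is_Cpseries_series. revert G.
    apply is_series_ext. intros n.
    replace (w / d)%C with (w * / d)%C by reflexivity.
    replace (- / d)%C with (-1 * / d)%C by (apply injective_projections; simpl; ring).
    rewrite !Cpow_mult_l. as_C. ring.
Qed.

Lemma reg_zeta_expansion_at (r q : nat) (a : C) : (1 <= r <= q)%nat -> 0 < Re a ->
  exists c rho, expansion (reg_zeta r q) a c rho.
Proof.
  intros H Ha. destruct (reg_zeta_expansion r q a H Ha) as [c [B [H1 [_ H2]]]].
  exists c, (Re a / 4). repeat split; [lra|exact H1|].
  intros s Hs. apply H2. lra.
Qed.

Definition zeta_model (r q : nat) (s : C) : C := (reg_zeta r q s * / (s - 1))%C.

Lemma zeta_model_meromorphic (r q : nat) (a : C) : (1 <= r <= q)%nat -> 0 < Re a ->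
  meromorphic_at (zeta_model r q) a.
Proof.
  intros H Ha. destruct (reg_zeta_expansion_at r q a H Ha) as [c [rho Hc]].
  destruct (excluded_middle_informative (a = RtoC 1)) as [->|Hne].
  - exists 1%nat, c. apply (expansion_laurent _ _ _ _ rho). revert Hc.
    apply expansion_ext. intros s Hs. unfold zeta_model.
    assert (s - 1 <> 0)%C by (apply Cmod_gt_0; lra).
    rewrite Cpow_1_r. field. assumption.
  - assert (E := expansion_mult _ _ _ _ _ _ _ Hc (expansion_inv 1 a Hne)).
    exists 0%nat, (cauchy_prod c (inv_coef (a - 1))). apply (expansion_laurent _ _ _ _ (Rmin rho (Cmod (a - 1) / 2))).
    revert E. apply expansion_ext. intros s Hs. unfold zeta_model. simpl. ring.
Qed.

Lemma sum_n_Capsum (r q : nat) (s : C) (n : nat) :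
  @sum_n C_AbelianMonoid
    (fun j => if congb (S j) r q then cpow (INR (S j)) (- s) else RtoC 0) n
  = Capsum r q (fun j => cpow (INR j) (- s)) (S n).
Proof.
  assert (E : forall j, (if congb (S j) r q then cpow (INR (S j)) (- s) else RtoC 0)
    = (RtoC (chi r q (S j)) * cpow (INR (S j)) (- s))%C).
  { intros j. unfold chi. destruct (congb (S j) r q); ring. }
  induction n as [|n IH].
  - rewrite sum_O, E. cbn [Capsum]. as_C. ring.
  - rewrite sum_Sn, IH, E. reflexivity.
Qed.

Lemma zeta_model_series (r q : nat) (s : C) : (1 <= r <= q)%nat -> 1 < Re s ->
  is_Cseries (fun j => if congb (S j) r q then cpow (INR (S j)) (- s) else RtoC 0)
    (zeta_model r q s).
Proof.
  intros H Hs. assert (Hq : 1 <= INR q) by (change 1 with (INR 1); apply le_INR; lia).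
  assert (Hs1 : (s - 1)%C <> RtoC 0).
  { apply RtoC_sub_neq. intros E. rewrite E in Hs. simpl in Hs. lra. }
  assert (M1 : 0 < Cmod (s - 1)) by now apply Cmod_gt_0.
  destruct (reg_zeta_expansion r q s H ltac:(lra)) as [c [B0 [_ [_ HW]]]].
  destruct (HW s) as [_ [B HB]].
  { replace (s - s)%C with (RtoC 0) by ring. rewrite Cmod_0. lra. }
  set (W := reg_zeta r q s) in *.
  set (eta := Rmin (Re s / 2) (Re s - 1)).
  assert (He : 0 < eta) by (apply Rmin_pos; lra).
  set (K := / Cmod (s - 1) * (Rabs B + 1 + Cmod (s - 1))).
  assert (L := is_lim_seq_Rpower K eta He). apply is_lim_seq_incr_1 in L.
  assert (D : forall n, (1 <= n)%nat ->
    Cmod (Capsum r q (fun j => cpow (INR j) (- s)) n - zeta_model r q s)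
    <= K * Rpower (INR n) (- eta)).
  { intros n Hn.
    assert (Hn1 : 1 <= INR n) by (change 1 with (INR 1); now apply le_INR).
    specialize (HB n Hn). unfold em_sum in HB.
    rewrite (Capsum_scal r q (s - 1) (fun j => cpow (INR j) (- s))) in HB.
    set (S := Capsum r q (fun j => cpow (INR j) (- s)) n) in *.
    set (z := cpow (INR n) (- s)) in *.
    set (X := ((s - 1) * S + (RtoC (- / INR q) * (RtoC (- INR n) * z)
          + RtoC (- (cnt r q n - INR n / INR q)) * ((s - 1) * z)) - W)%C) in *.
    assert (E : (S - zeta_model r q s)%C = (/ (s - 1) * (X + (- (RtoC (- / INR q)
        * (RtoC (- INR n) * z)) + - (RtoC (- (cnt r q n - INR n / INR q)) * ((s - 1) * z)))))%C).
    { unfold X, zeta_model. fold W. field. exact Hs1. }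
    rewrite E, Cmod_mult, Cmod_inv by exact Hs1. unfold K.
    rewrite Rmult_assoc. apply Rmult_le_compat_l; [left; now apply Rinv_0_lt_compat|].
    eapply Rle_trans; [apply Cmod_triangle|].
    eapply Rle_trans; [apply Rplus_le_compat_l, Cmod_triangle|].
    rewrite !Cmod_opp, !Cmod_mult, !Cmod_R.
    assert (Hz : Cmod z = Rpower (INR n) (- Re s)) by apply Cmod_cpow.
    assert (P0 := Rpower_pos (INR n) (- eta)).
    assert (Hz1 : INR n * Cmod z <= Rpower (INR n) (- eta)).
    { rewrite Hz. rewrite <- (Rpower_1 (INR n)) at 1 by lra. rewrite <- Rpower_plus.
      apply Rle_Rpower; [exact Hn1|]. generalize (Rmin_r (Re s / 2) (Re s - 1)).
      fold eta. lra. }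
    assert (Hz2 : Cmod z <= Rpower (INR n) (- eta)).
    { generalize (Cmod_ge_0 z). nra. }
    assert (HX : Cmod X <= Rabs B * Rpower (INR n) (- eta)).
    { eapply Rle_trans; [exact HB|]. apply (Rle_trans _ (Rabs B * Rpower (INR n) (- (Re s / 2)))).
      - apply Rmult_le_compat_r; [left; apply Rpower_pos|apply Rle_abs].
      - apply Rmult_le_compat_l; [apply Rabs_pos|]. apply Rle_Rpower; [exact Hn1|].
        generalize (Rmin_l (Re s / 2) (Re s - 1)). fold eta. lra. }
    assert (c2 : Rabs (- / INR q) <= 1).
    { rewrite Rabs_Ropp, Rabs_right by (left; apply Rinv_0_lt_compat; lra).
      rewrite <- Rinv_1. apply Rinv_le_contravar; lra. }
    assert (c3 : Rabs (- (cnt r q n - INR n / INR q)) <= 1).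
    { rewrite Rabs_Ropp. replace (cnt r q n - INR n / INR q)
        with (saw r q n (INR n) + mean r q) by (unfold saw; ring).
      eapply Rle_trans; [apply Rabs_triang|].
      generalize (saw_bound r q n (INR n) H ltac:(lra)) (mean_bound r q H). lra. }
    rewrite (Rabs_Ropp (INR n)), (Rabs_right (INR n)) by lra.
    assert (A2 := Rabs_pos (- / INR q)). assert (A3 := Rabs_pos (- (cnt r q n - INR n / INR q))).
    assert (T1 : Rabs (- / INR q) * (INR n * Cmod z) <= Rpower (INR n) (- eta)).
    { generalize (Cmod_ge_0 z). intros. assert (0 <= INR n * Cmod z) by nra. nra. }
    assert (T2 : Rabs (- (cnt r q n - INR n / INR q)) * (Cmod (s - 1) * Cmod z)
      <= Cmod (s - 1) * Rpower (INR n) (- eta)).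
    { assert (0 <= Cmod (s - 1) * Cmod z) by (generalize (Cmod_ge_0 z); nra).
      apply (Rle_trans _ (Cmod (s - 1) * Cmod z)); [nra|].
      apply Rmult_le_compat_l; lra. }
    lra. }
  apply is_Cseries_components. split; apply is_lim_seq_of_bound with (2 := L); intros n.
  - rewrite <- sum_n_Re, sum_n_Capsum. eapply Rle_trans; [|apply D; lia].
    apply (re_le_Cmod (_ - _)).
  - rewrite <- sum_n_Im, sum_n_Capsum. eapply Rle_trans; [|apply D; lia].
    apply (Im_le_Cmod (_ - _)).
Qed.

Lemma zeta_ap_spec (r q : nat) : (1 <= r <= q)%nat -> is_zeta_ap r q (zeta_ap r q).
Proof.
  intros H. unfold zeta_ap. apply epsilon_spec. exists (zeta_model r q). split.
  - intros s Hs. now apply zeta_model_series.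
  - intros a Ha. now apply zeta_model_meromorphic.
Qed.

Lemma zeta_ap_eq (r q : nat) (s : C) : (1 <= r <= q)%nat -> 1 < Re s ->
  zeta_ap r q s = zeta_model r q s.
Proof.
  intros H Hs. eapply is_Cseries_unique; [now apply (zeta_ap_spec r q H)|].
  now apply zeta_model_series.
Qed.

Lemma Cmod_limit_real (u : nat -> C) (x : nat -> R) (l : C) (y B eta : R) : 0 < eta ->
  (forall n, (1 <= n)%nat -> u n = RtoC (x n)) ->
  (forall n, (1 <= n)%nat -> Cmod (u n - l) <= B * Rpower (INR n) (- eta)) ->
  is_lim_seq x y -> l = RtoC y.
Proof.
  intros He E H Hx. destruct (is_lim_seq_Cmod_bound u l B eta He H) as [h1 h2].
  apply is_lim_seq_incr_1 in h1, h2, Hx.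
  apply (is_lim_seq_ext _ (fun n => x (S n))) in h1; [|intros n; rewrite E by lia; reflexivity].
  apply (is_lim_seq_ext _ (fun n => 0)) in h2; [|intros n; rewrite E by lia; reflexivity].
  apply is_lim_seq_unique in h1, h2, Hx. rewrite Hx in h1. rewrite Lim_seq_const in h2.
  injection h1 as h1. injection h2 as h2.
  apply injective_projections; simpl; [symmetry; exact h1|symmetry; exact h2].
Qed.

Lemma em_sum_R (r q n : nat) (g P : R -> C) (x y : R -> R) : (1 <= n)%nat ->
  (forall t, 1 <= t -> g t = RtoC (x t)) -> (forall t, 1 <= t -> P t = RtoC (y t)) ->
  em_sum r q g P n = RtoC (apsum r q (fun j => x (INR j)) n
    - y (INR n) / INR q - x (INR n) * (cnt r q n - INR n / INR q)).
Proof.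
  intros Hn Hg HP.
  assert (H1 : forall j, (1 <= j)%nat -> 1 <= INR j).
  { intros j Hj. change 1 with (INR 1). now apply le_INR. }
  assert (E : forall m, Capsum r q (fun j => g (INR j)) m = RtoC (apsum r q (fun j => x (INR j)) m)).
  { induction m as [|m IH]; [reflexivity|]. unfold apsum in *. cbn [Capsum psum].
    rewrite IH, Hg by (apply H1; lia). rewrite RtoC_plus, RtoC_mult. reflexivity. }
  unfold em_sum. rewrite E, (Hg (INR n)), (HP (INR n)) by auto.
  rewrite <- !RtoC_mult, <- !RtoC_plus. f_equal. unfold Rdiv. ring.
Qed.

Lemma cpow_RtoC (t x : R) : cpow t (RtoC x) = RtoC (Rpower t x).
Proof.
  unfold cpow, Rpower. simpl. rewrite Rmult_0_l, cos_0, sin_0.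
  apply injective_projections; simpl; ring.
Qed.

Lemma dcoef_1 (t : R) (k : nat) : 0 < t ->
  dcoef 1 t k = RtoC (/ t * ((- ln t) ^ k / INR (fact k))).
Proof.
  intros Ht. unfold dcoef. rewrite <- RtoC_opp, cpow_RtoC, Rpower_Ropp, Rpower_1 by exact Ht.
  now rewrite <- RtoC_mult.
Qed.

Lemma gcoef_1 (t : R) (k : nat) : gcoef 1 t k = shift1 (dcoef 1 t) k.
Proof. unfold gcoef. ring. Qed.

Lemma Gcoef_1 (t : R) (k : nat) : 0 < t ->
  Gcoef 1 t k = RtoC (- ((- ln t) ^ k / INR (fact k))).
Proof.
  intros Ht. unfold Gcoef. rewrite dcoef_1, <- RtoC_mult by exact Ht. f_equal. field.
  split; [apply INR_fact_neq_0|lra].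
Qed.

Lemma reg_zeta_at_1 (r q : nat) : (1 <= r <= q)%nat ->
  exists c rho, expansion (reg_zeta r q) 1 c rho /\
    c 0%nat = RtoC (/ INR q) /\ c 1%nat = RtoC (gamma 0 r q).
Proof.
  intros H. assert (Hq : INR q <> 0) by (apply not_0_INR; lia).
  destruct (reg_zeta_expansion r q 1 H) as [c [B [H1 [Hc H2]]]]; [simpl; lra|].
  change (Re 1) with 1 in *.
  assert (shape : forall k n, (1 <= n)%nat ->
    Cmod (em_sum r q (fun t => gcoef 1 t k) (fun t => Gcoef 1 t k) n - c k)
    <= B * (/ (1 / 2)) ^ k * Rpower (INR n) (- (1 / 2))) by exact Hc.
  exists c, (1 / 4). split; [|split].
  - repeat split; [lra|exact H1|]. intros s Hs. apply H2. lra.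
  - apply (Cmod_limit_real _ (fun _ => / INR q) _ _ _ (1 / 2)) with (3 := shape 0%nat);
      [lra| |apply is_lim_seq_const].
    intros n Hn. rewrite (em_sum_R r q n _ _ (fun _ => 0) (fun _ => -1)); [|exact Hn| |].
    + f_equal. rewrite apsum_const. field. exact Hq.
    + intros t Ht. apply gcoef_1.
    + intros t Ht. rewrite Gcoef_1 by lra. f_equal. simpl. field.
  - apply (Cmod_limit_real _ (fun n => apsum r q (fun j => / INR j) n
      - ln (INR n) / INR q - / INR n * (cnt r q n - INR n / INR q)) _ _ _ (1 / 2))
      with (3 := shape 1%nat); [lra| |].
    + intros n Hn. apply (em_sum_R r q n _ _ (fun t => / t) (fun t => ln t)); [exact Hn| |].
      * intros t Ht. rewrite gcoef_1. simpl shift1. rewrite dcoef_1 by lra. f_equal.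
        simpl. field. lra.
      * intros t Ht. rewrite Gcoef_1 by lra. f_equal. simpl. field.
    + assert (G := gamma_em r q 0 (1 / 2) H ltac:(lra)).
      assert (O : bigO (1 / 2) (fun y => em_error r q (lpow 1 0)
        (fun t => ln t ^ (0 + 1) / INR (0 + 1)) (gamma 0 r q) y + - mean r q * lpow 1 0 y)).
      { apply bigO_plus; [exact G|]. apply bigO_scal, bigO_lpow. lra. }
      destruct O as [K [HK O]].
      assert (L := is_lim_seq_Rpower K (1 / 2) ltac:(lra)). apply is_lim_seq_incr_1 in L.
      apply is_lim_seq_incr_1. apply is_lim_seq_of_bound with (2 := L). intros n.
      assert (Hn : 1 <= INR (S n)) by (change 1 with (INR 1); apply le_INR; lia).
      eapply Rle_trans; [|apply (O _ Hn)]. right. f_equal. unfold em_error, saw.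
      rewrite fl_INR, lpow_1_0 by lra.
      rewrite (apsum_ext _ _ (fun n => lpow 1 0 (INR n)) (fun j => / INR j)).
      * replace (ln (INR (S n)) ^ (0 + 1) / INR (0 + 1)) with (ln (INR (S n)))
          by (simpl; field). ring.
      * intros i Hi. apply lpow_1_0, lt_0_INR. lia.
Qed.

Lemma PSeries_zero_right (d : nat -> R) (delta : R) : 0 < delta ->
  (forall h, 0 < h < delta -> is_pseries d h 0) -> forall n, d n = 0.
Proof.
  intros Hd H.
  assert (CV : Rbar_lt 0 (CV_radius d)).
  { destruct (Rbar_lt_dec 0 (CV_radius d)) as [L|L]; [exact L|exfalso].
    apply (CV_disk_outside d (delta / 2)).
    - apply Rbar_not_lt_le in L. apply (Rbar_le_lt_trans _ 0); [exact L|].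
      simpl. rewrite Rabs_right; lra.
    - apply ex_series_lim_0. exists 0. apply (proj1 (is_pseries_R d _ _)), H. lra. }
  intros n. induction n as [n IH] using (well_founded_induction lt_wf).
  set (e := PS_decr_n d n).
  assert (He : forall h, 0 < h < delta -> PSeries e h = 0).
  { intros h Hh. assert (E := PSeries_decr_n_aux d n h IH).
    rewrite (is_pseries_unique _ _ _ (H h Hh)) in E.
    assert (0 < h ^ n) by (apply pow_lt; lra). fold e in E. symmetry in E.
    apply Rmult_integral in E. destruct E; [lra|assumption]. }
  assert (C0 : continuity_pt (PSeries e) 0).
  { assert (R0 : forall n, CV_radius (PS_decr_n d n) = CV_radius d).
    { clear. induction n as [|n IH]; [reflexivity|].
      rewrite <- IH, <- (CV_radius_decr_1 (PS_decr_n d n)). apply CV_radius_ext. intros k.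
      unfold PS_decr_1, PS_decr_n. f_equal. lia. }
    apply PSeries_continuity. unfold e. rewrite R0, Rabs_R0. exact CV. }
  assert (Z : PSeries e 0 = 0).
  { destruct (Req_dec (PSeries e 0) 0) as [|N]; [assumption|exfalso].
    assert (P0 : 0 < Rabs (PSeries e 0)) by now apply Rabs_pos_lt.
    destruct (C0 (Rabs (PSeries e 0)) P0) as [al [Hal Hx]].
    set (h := Rmin al delta / 2).
    assert (Hm : 0 < Rmin al delta) by (apply Rmin_pos; lra).
    assert (M1 := Rmin_l al delta). assert (M2 := Rmin_r al delta).
    specialize (Hx h). unfold D_x, no_cond, dist in Hx. simpl in Hx. unfold R_dist, Rdist in Hx.
    rewrite (He h) in Hx by (unfold h; lra).
    rewrite !Rminus_0_l, Rabs_Ropp, Rminus_0_r in Hx.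
    assert (Rabs (PSeries e 0) < Rabs (PSeries e 0)); [|lra].
    apply Hx. split; [split; [exact I|unfold h; lra]|].
    rewrite Rabs_right; unfold h; lra. }
  rewrite PSeries_0 in Z. unfold e, PS_decr_n in Z. rewrite Nat.add_0_r in Z. exact Z.
Qed.

(** The two expansions at [s = 1] are known to agree only for [Re s > 1], hence the
    one-sided hypothesis. *)
Lemma is_Cpseries_real_unique (c d : nat -> C) (delta : R) : 0 < delta ->
  (forall h, 0 < h < delta -> exists l, is_Cpseries c (RtoC h) l /\ is_Cpseries d (RtoC h) l) ->
  forall n, c n = d n.
Proof.
  intros Hd H.
  assert (comp : forall (p : C -> R), (forall z x, p (z * RtoC x)%C = p z * x) ->
    (forall u l, is_Cseries u l -> is_series (fun n => p (u n)) (p l)) ->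
    forall n, p (c n) - p (d n) = 0).
  { intros p Hmul Hser.
    apply (PSeries_zero_right _ delta Hd). intros h Hh.
    destruct (H h Hh) as [l [Hl Hl']].
    rewrite is_Cpseries_series in Hl, Hl'. apply Hser in Hl, Hl'.
    apply is_pseries_R.
    replace 0 with (p l - p l) by ring.
    apply (is_series_ext (fun n => p (c n * RtoC h ^ n)%C - p (d n * RtoC h ^ n)%C)).
    - intros n. rewrite <- RtoC_pow, !Hmul.
      symmetry. apply Rmult_minus_distr_r.
    - apply (is_series_minus (fun n => p (c n * RtoC h ^ n)%C) (fun n => p (d n * RtoC h ^ n)%C));
        assumption. }
  intros n. apply injective_projections; apply Rminus_diag_uniq.
  - apply (comp Re); [apply Re_mult_R|]. intros u l Hu.
    now apply is_Cseries_components in Hu.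
  - apply (comp Im); [apply Im_mult_R|]. intros u l Hu.
    now apply is_Cseries_components in Hu.
Qed.

Lemma expansion_cpow (x : R) : 0 < x ->
  exists c, (forall rho, 0 < rho -> expansion (cpow x) 1 c rho) /\
    c 0%nat = RtoC x /\ c 1%nat = RtoC (x * ln x).
Proof.
  intros Hx. exists (fun k => (cpow x 1 * RtoC ((ln x) ^ k / INR (fact k)))%C).
  assert (E1 : cpow x 1 = RtoC x) by (rewrite cpow_RtoC, Rpower_1; auto).
  split; [|split].
  - intros rho Hr. split; [exact Hr|]. split.
    + unfold abs_summable.
      apply (ex_series_ext (fun n => Cmod (cpow x 1) * (/ INR (fact n) * (Rabs (ln x) * rho) ^ n))).
      { intros n. rewrite Cmod_mult, Cmod_R. unfold Rdiv.
        rewrite Rabs_mult, <- RPow_abs, Rpow_mult_distr.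
        rewrite (Rabs_right (/ _)).
        - match goal with |- ?u = ?v => change (@eq R u v) end. ring.
        - left. apply Rinv_0_lt_compat, lt_0_INR, lt_O_fact. }
      apply (ex_series_scal (Cmod (cpow x 1))
        (fun n => / INR (fact n) * (Rabs (ln x) * rho) ^ n)).
      exists (exp (Rabs (ln x) * rho)).
      exact (proj1 (is_pseries_R (fun n => / INR (fact n)) _ _) (is_exp_Reals _)).
    + intros s _. replace (cpow x s) with (cpow x 1 * cpow x (s - 1))%C
        by (rewrite <- cpow_plus; f_equal; ring).
      apply is_Cpseries_scal. rewrite (cpow_cexp x (s - 1)).
      apply is_Cpseries_series. assert (G := is_Cseries_cexp ((s - 1) * RtoC (ln x))).
      revert G. apply is_series_ext. intros n.
      rewrite Cpow_mult_l, <- RtoC_pow. unfold Rdiv. rewrite RtoC_mult. as_C. ring.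
  - rewrite E1. simpl. rewrite <- RtoC_mult. f_equal. field.
  - rewrite E1. simpl. rewrite <- RtoC_mult. f_equal. field.
Qed.

Lemma cauchy_prod_0 (a b : nat -> C) : cauchy_prod a b 0 = (a 0%nat * b 0%nat)%C.
Proof. reflexivity. Qed.

Lemma cauchy_prod_1 (a b : nat -> C) :
  cauchy_prod a b 1 = (a 0%nat * b 1%nat + a 1%nat * b 0%nat)%C.
Proof. reflexivity. Qed.

Definition perron_integrand (r1 q1 r2 q2 : nat) (x : R) (s : C) : C :=
  (zeta_ap r1 q1 s * zeta_ap r2 q2 s * (cpow x s / s))%C.

Lemma perron_residue_exists (r1 q1 r2 q2 : nat) (x : R) :
  (1 <= r1 <= q1)%nat -> (1 <= r2 <= q2)%nat -> 0 < x ->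
  exists rho, is_residue (perron_integrand r1 q1 r2 q2 x) 1 rho.
Proof.
  intros H1 H2 Hx.
  destruct (zeta_ap_spec r1 q1 H1) as [_ M1]. destruct (zeta_ap_spec r2 q2 H2) as [_ M2].
  destruct (M1 1) as [m1 [c1 L1]]; [simpl; lra|]. destruct (M2 1) as [m2 [c2 L2]]; [simpl; lra|].
  apply laurent_expansion in L1, L2. destruct L1 as [e1 L1]. destruct L2 as [e2 L2].
  destruct (expansion_cpow x Hx) as [c [Hc _]].
  assert (N10 : RtoC 1 <> RtoC 0) by (intros E; apply RtoC_inj in E; lra).
  assert (T := expansion_mult _ _ _ _ _ _ _ (expansion_mult _ _ _ _ _ _ _ L1 L2)
    (expansion_mult _ _ _ _ _ _ _ (Hc 1 ltac:(lra)) (expansion_inv 0 1 N10))).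
  destruct T as [T0 [_ T]].
  match type of T with forall s, _ -> is_Cpseries ?d _ _ => set (w := d) in * end.
  exists (PS_incr_1 w (m1 + m2)%nat), (m1 + m2)%nat, (PS_incr_1 w). split; [|reflexivity].
  eexists (mkposreal _ T0). intros s Hs. simpl in Hs.
  replace ((s - 1) ^ S (m1 + m2) * perron_integrand r1 q1 r2 q2 x s)%C
    with ((s - 1) * ((s - 1) ^ m1 * zeta_ap r1 q1 s * ((s - 1) ^ m2 * zeta_ap r2 q2 s)
      * (cpow x s * / (s - 0))))%C.
  - apply (@is_pseries_incr_1 C_AbsRing C_NormedModule). exact (T s Hs).
  - unfold perron_integrand. rewrite Cpow_S, Cpow_add_r.
    replace (s - 0)%C with s by ring. unfold Cdiv. ring.
Qed.

Lemma perron_residue_unique (r1 q1 r2 q2 : nat) (x : R) (rho : C) :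
  (1 <= r1 <= q1)%nat -> (1 <= r2 <= q2)%nat -> 0 < x ->
  is_residue (perron_integrand r1 q1 r2 q2 x) 1 rho ->
  rho = RtoC (main_term q1 q2 (gamma 0 r1 q1) (gamma 0 r2 q2) x).
Proof.
  intros H1 H2 Hx [m [c [[delta HL] ->]]].
  destruct (reg_zeta_at_1 r1 q1 H1) as [c1 [e1 [L1 [c10 c11]]]].
  destruct (reg_zeta_at_1 r2 q2 H2) as [c2 [e2 [L2 [c20 c21]]]].
  destruct (expansion_cpow x Hx) as [cx [Hc [cx0 cx1]]].
  assert (N10 : RtoC 1 <> RtoC 0) by (intros E; apply RtoC_inj in E; lra).
  assert (T := expansion_mult _ _ _ _ _ _ _ (expansion_mult _ _ _ _ _ _ _ L1 L2)
    (expansion_mult _ _ _ _ _ _ _ (Hc 1 ltac:(lra)) (expansion_inv 0 1 N10))).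
  destruct T as [T0 [_ T]].
  match type of T with forall s, _ < _ < ?b -> is_Cpseries ?d _ _ =>
    set (w := d) in *; set (eps := b) in * end.
  assert (E : PS_incr_n c 2 (2 + m)%nat = PS_incr_n w (S m) (S m + 1)%nat).
  { replace (S m + 1)%nat with (2 + m)%nat by lia.
    apply (is_Cpseries_real_unique _ _ (Rmin delta eps)).
    - apply Rmin_pos; [apply cond_pos|exact T0].
    - intros h Hh. generalize (Rmin_l delta eps) (Rmin_r delta eps). intros Q1 Q2.
      set (s := (1 + RtoC h)%C).
      assert (Es : (s - 1)%C = RtoC h) by (unfold s; ring).
      assert (Mh : Cmod (RtoC h) = h) by (rewrite Cmod_R, Rabs_right; lra).
      assert (A := HL s). assert (A' := T s). rewrite Es, Mh in A, A'.
      specialize (A ltac:(lra)). specialize (A' ltac:(lra)).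
      apply (@is_pseries_incr_n C_AbsRing C_NormedModule _ 2) in A.
      apply (@is_pseries_incr_n C_AbsRing C_NormedModule _ (S m)) in A'.
      eexists. split; [exact A|].
      match type of A with is_pseries _ _ ?l => match type of A' with is_pseries _ _ ?l' =>
        replace l with l'; [exact A'|] end end.
      assert (Hs : 1 < Re s) by (simpl; lra).
      unfold perron_integrand. rewrite !zeta_ap_eq by assumption. unfold zeta_model. rewrite Es.
      assert (Hh0 : RtoC h <> RtoC 0) by (intros Z; apply RtoC_inj in Z; lra).
      assert (Hs0 : s <> RtoC 0) by (intros Z; rewrite Z in Hs; simpl in Hs; lra).
      replace (s - 0)%C with s by ring.
      change (RtoC h ^ S m * (reg_zeta r1 q1 s * reg_zeta r2 q2 s * (cpow x s * / s))
        = RtoC h ^ 2 * (RtoC h ^ S m * (reg_zeta r1 q1 s * / RtoC h * (reg_zeta r2 q2 s * / RtoC h)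
          * (cpow x s / s))))%C.
      field. split; assumption. }
  assert (G : forall (d : nat -> C) n k,
    @PS_incr_n C_AbsRing C_NormedModule d n (n + k)%nat = d k).
  { intros d n k. induction n as [|n IH]; [reflexivity|exact IH]. }
  rewrite !G in E.
  rewrite E. unfold w. rewrite cauchy_prod_1, !cauchy_prod_1, !cauchy_prod_0.
  rewrite c10, c11, c20, c21, cx0, cx1. unfold inv_coef, main_term.
  replace (1 - 0)%C with (RtoC 1) by ring.
  assert (I1 : (/ RtoC 1)%C = RtoC 1) by (field; exact N10). rewrite I1.
  apply injective_projections; simpl; field; repeat split; apply not_0_INR; lia.
Qed.

Lemma Delta2_formula (r1 q1 r2 q2 : nat) (x : R) :
  (1 <= r1 <= q1)%nat -> (1 <= r2 <= q2)%nat -> 0 < x ->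
  Delta2 x r1 q1 r2 q2 = psum (fun n => INR (d_star r1 q1 r2 q2 n)) (fl x)
    - main_term q1 q2 (gamma 0 r1 q1) (gamma 0 r2 q2) x.
Proof.
  intros H1 H2 Hx. unfold Delta2. rewrite sum_upto_psum. f_equal. f_equal.
  fold (perron_integrand r1 q1 r2 q2 x).
  rewrite (perron_residue_unique r1 q1 r2 q2 x
    (Residue (perron_integrand r1 q1 r2 q2 x) 1) H1 H2 Hx); [reflexivity|].
  unfold Residue. apply epsilon_spec. now apply perron_residue_exists.
Qed.

Theorem theorem3 (r1 q1 r2 q2 : nat)
  (hr1 : (1 <= r1)%nat) (hrq1 : (r1 <= q1)%nat)
  (hr2 : (1 <= r2)%nat) (hrq2 : (r2 <= q2)%nat) (k : nat) :
  is_RInt_gen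
    (fun x => (ln x ^ k - INR k * ln x ^ (k - 1)) / x ^ 2
              * Delta2 x r1 q1 r2 q2)
    (at_point 1) (Rbar_locally p_infty)
    (sum_f_R0 (fun i => Binomial.C k i * gamma (k - i) r2 q2 * gamma i r1 q1) k
     + IZR (Int_part (1 / INR (k + 1)))
       * (1 / (INR q1 * INR q2) - gamma 0 r1 q1 / INR q2 - gamma 0 r2 q2 / INR q1)
     - gamma (k + 1) r2 q2 / (INR q1 * INR (k + 1))
     - gamma (k + 1) r1 q1 / (INR q2 * INR (k + 1)))
  /\
  forall alpha : R, 131 / 416 < alpha < 1 ->
  is_RInt_gen
    (fun x => (alpha * ln x ^ k - INR k * ln x ^ (k - 1)) / Rpower x (1 + alpha)
              * Delta2 x r1 q1 r2 q2)
    (at_point 1) (Rbar_locally p_infty)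
    (sum_f_R0 (fun l => Binomial.C k l
                        * zeta_k l alpha r1 q1 * zeta_k (k - l) alpha r2 q2) k
     + IZR (Int_part (1 / INR (k + 1)))
       * (1 / (INR q1 * INR q2) - gamma 0 r1 q1 / INR q2 - gamma 0 r2 q2 / INR q1)
     - 1 / (INR q1 * INR q2) * (INR (fact (k + 1)) / (alpha - 1) ^ (k + 2))
     - (gamma 0 r1 q1 / INR q2 + gamma 0 r2 q2 / INR q1)
       * (INR (fact k) / (alpha - 1) ^ (k + 1))).
Proof.
  assert (HD : forall x, 1 <= x -> Delta2 x r1 q1 r2 q2 =
    psum (fun n => INR (d_star r1 q1 r2 q2 n)) (fl x)
    - main_term q1 q2 (gamma 0 r1 q1) (gamma 0 r2 q2) x).
  { intros x Hx. apply Delta2_formula; [lia|lia|lra]. }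
  split.
  - apply integral_gamma; [lia|lia|exact HD].
  - intros alpha Ha. apply integral_zeta; [lia|lia|lra|exact HD].
Qed.
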